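(* Let $p$ be a prime and let $\mathbf k$ be a field of characteristic $p$. Every operadic Lie algebra in $\mathsf{Ver}_p$ with length $1$ is isomorphic to either $\mathfrak{sl}(L_1)$ (which only exists for $p\geq5$) or the trivial Lie algebra (zero bracket) on $L_n$ for some $n\in\{0,\dots,p-2\}$.
   Context: $V_n$ is the dual Weyl module of $\mathrm{SL}_2$ over $\mathbf{k}$ with highest weight $n$. $\mathsf{Ver}_p$ is the semisimplification (quotient by negligible morphisms) of the symmetric monoidal category of tilting modules of $\mathrm{SL}_2$ over $\mathbf k$; its simple objects are $L_0,\dots,L_{p-2}$, with $L_i$ the image of $V_i$. An operadic Lie algebra in a symmetric tensor category is an (ind-)object $\mathfrak{g}$ with a morphism $[,]:\mathfrak{g}\otimes\mathfrak{g}\to\mathfrak{g}$ such that $[,]\circ\mathrm{braid}_{\mathfrak g,\mathfrak g}=-[,]$ and $[[,],]\circ(\mathrm{id}+\sigma+\sigma^2)=0$, where $\sigma$ is the cyclic braiding on $\mathfrak{g}^{\otimes 3}$. Isomorphisms are isomorphisms of objects commuting with brackets. For $X$ an object, $\mathfrak{gl}(X)=X\otimes X^*$ with the commutator bracket of the multiplication $\mathrm{id}_X\otimes\mathrm{ev}_X\otimes\mathrm{id}_{X^*}$, and $\mathfrak{sl}(X)$ is the kernel of $\mathrm{ev}_X\circ\mathrm{braid}_{X,X^*}$. For $p\ge5$, $\mathfrak{sl}(L_1)$ is the image in $\mathsf{Ver}_p$ of $\mathfrak{sl}_2\cong V_2$ with its Lie bracket, so has underlying object $L_2$. *)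

(* Defs.v *)
From mathcomp Require Import all_boot all_order all_algebra.
From mathcomp Require Export mxtens.

Set Implicit Arguments.
Unset Strict Implicit.
Unset Printing Implicit Defensive.

Import GRing.Theory.
Local Open Scope ring_scope.

(* A finite-dimensional representation of the group scheme SL_2 over k, as a
   homomorphism of group functors SL_2 -> GL_rdim on commutative k-algebras.
   A k-algebra is a commutative ring A with its structure map phi : k -> A, and
   [ract phi g] is only constrained for g in SL_2(A).  Matrices act on column
   vectors. *)
Record sl2rep (k : fieldType) : Type := Sl2Rep {
  rdim : nat;
  ract : forall A : comNzRingType, {rmorphism k -> A} -> 'M[A]_2 -> 'M[A]_rdim;
  ract1 : forall (A : comNzRingType) (phi : {rmorphism k -> A}),
    ract phi 1%:M = 1%:M;
  ractM : forall (A : comNzRingType) (phi : {rmorphism k -> A}) (g h : 'M[A]_2),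
    \det g = 1 -> \det h = 1 -> ract phi (g *m h) = ract phi g *m ract phi h;
  ract_nat : forall (A B : comNzRingType) (phi : {rmorphism k -> A})
      (psi : {rmorphism k -> B}) (e : {rmorphism A -> B}) (g : 'M[A]_2),
    (forall c, e (phi c) = psi c) -> \det g = 1 ->
    ract psi (map_mx e g) = map_mx e (ract phi g)
}.

Arguments ract {k} s {A} phi g.

Record hom (k : fieldType) (X Y : sl2rep k) : Type := Hom {
  hmx :> 'M[k]_(rdim Y, rdim X);
  hom_equiv : forall (A : comNzRingType) (phi : {rmorphism k -> A}) (g : 'M[A]_2),
    \det g = 1 -> map_mx phi hmx *m ract X phi g = ract Y phi g *m map_mx phi hmx
}.

Section HomOperations.
Variable k : fieldType.
Implicit Types X Y Z W : sl2rep k.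

Lemma hom_id_subproof X (A : comNzRingType) (phi : {rmorphism k -> A})
    (g : 'M[A]_2) : \det g = 1 ->
  map_mx phi (1%:M : 'M_(rdim X)) *m ract X phi g
    = ract X phi g *m map_mx phi 1%:M.
Proof. by rewrite map_mx1 mul1mx mulmx1. Qed.
Definition hom_id X : hom X X := Hom (@hom_id_subproof X).

Lemma hom_comp_subproof X Y Z (f : hom Y Z) (h : hom X Y)
    (A : comNzRingType) (phi : {rmorphism k -> A}) (g : 'M[A]_2) :
  \det g = 1 -> map_mx phi (f *m h) *m ract X phi g
                = ract Z phi g *m map_mx phi (f *m h).
Proof.
by move=> dg; rewrite map_mxM -mulmxA hom_equiv // !mulmxA hom_equiv.
Qed.
Definition hom_comp X Y Z (f : hom Y Z) (h : hom X Y) : hom X Z :=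
  Hom (hom_comp_subproof f h).

Lemma hom_zero_subproof X Y (A : comNzRingType) (phi : {rmorphism k -> A})
    (g : 'M[A]_2) : \det g = 1 ->
  map_mx phi (0 : 'M_(rdim Y, rdim X)) *m ract X phi g
    = ract Y phi g *m map_mx phi 0.
Proof. by rewrite map_mx0 mul0mx mulmx0. Qed.
Definition hom_zero X Y : hom X Y := Hom (@hom_zero_subproof X Y).

Lemma hom_add_subproof X Y (f h : hom X Y)
    (A : comNzRingType) (phi : {rmorphism k -> A}) (g : 'M[A]_2) :
  \det g = 1 -> map_mx phi (hmx f + hmx h) *m ract X phi g
                = ract Y phi g *m map_mx phi (hmx f + hmx h).
Proof. by move=> dg; rewrite map_mxD mulmxDl mulmxDr !hom_equiv. Qed.
Definition hom_add X Y (f h : hom X Y) : hom X Y := Hom (hom_add_subproof f h).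

Lemma hom_opp_subproof X Y (f : hom X Y)
    (A : comNzRingType) (phi : {rmorphism k -> A}) (g : 'M[A]_2) :
  \det g = 1 -> map_mx phi (- hmx f) *m ract X phi g
                = ract Y phi g *m map_mx phi (- hmx f).
Proof. by move=> dg; rewrite map_mxN mulNmx mulmxN hom_equiv. Qed.
Definition hom_opp X Y (f : hom X Y) : hom X Y := Hom (hom_opp_subproof f).

Definition hom_sub X Y (f h : hom X Y) : hom X Y := hom_add f (hom_opp h).

End HomOperations.

Arguments hom_id {k} X.
Arguments hom_zero {k} X Y.

Section Duals.
Variable k : fieldType.

Lemma det_adj1 (A : comNzRingType) n (g : 'M[A]_n) :
  \det g = 1 -> \det (\adj g) = 1.
Proof.
move=> dg; have := congr1 determinant (mul_adj_mx g).
by rewrite det_mulmx dg mulr1 det1.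
Qed.

Lemma adjM1 (A : comNzRingType) n (g h : 'M[A]_n) :
  \det g = 1 -> \det h = 1 -> \adj (g *m h) = \adj h *m \adj g.
Proof.
move=> dg dh.
have e1 : (g *m h) *m (\adj h *m \adj g) = 1%:M.
  by rewrite mulmxA -(mulmxA g) mul_mx_adj dh mulmx1 mul_mx_adj dg.
rewrite -[LHS]mulmx1 -e1 mulmxA mul_adj_mx det_mulmx dg dh mulr1.
by rewrite mul1mx.
Qed.

Variable X : sl2rep k.

(* [\adj g] is the inverse of g when \det g = 1. *)
Definition dual_act (A : comNzRingType) (phi : {rmorphism k -> A}) (g : 'M[A]_2) :
  'M[A]_(rdim X) := (ract X phi (\adj g))^T.

Lemma dual_act1 A phi : @dual_act A phi 1%:M = 1%:M.
Proof.
rewrite /dual_act; have -> : \adj (1%:M : 'M[A]_2) = 1%:M.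
  by rewrite -[LHS]mulmx1 mul_adj_mx det1.
by rewrite ract1 trmx1.
Qed.

Lemma dual_actM (A : comNzRingType) (phi : {rmorphism k -> A}) (g h : 'M[A]_2) : \det g = 1 -> \det h = 1 ->
  @dual_act A phi (g *m h) = dual_act phi g *m dual_act phi h.
Proof.
by move=> dg dh; rewrite /dual_act adjM1 // ractM ?det_adj1 // trmx_mul.
Qed.

Lemma dual_act_nat (A B : comNzRingType) (phi : {rmorphism k -> A})
    (psi : {rmorphism k -> B}) (e : {rmorphism A -> B}) g :
  (forall c, e (phi c) = psi c) -> \det g = 1 ->
  @dual_act B psi (map_mx e g) = map_mx e (@dual_act A phi g).
Proof.
move=> he dg; rewrite /dual_act -map_mx_adj (ract_nat X he) ?det_adj1 //.
by rewrite map_trmx.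
Qed.

Definition dual : sl2rep k := Sl2Rep dual_act1 dual_actM dual_act_nat.

End Duals.

Section TensorUnit.
Variable k : fieldType.

Definition unit_act (A : comNzRingType) (phi : {rmorphism k -> A}) (g : 'M[A]_2) :
  'M[A]_1 := 1%:M.

Lemma unit_act1 A phi : @unit_act A phi 1%:M = 1%:M.
Proof. by []. Qed.

Lemma unit_actM (A : comNzRingType) (phi : {rmorphism k -> A}) (g h : 'M[A]_2) : \det g = 1 -> \det h = 1 ->
  @unit_act A phi (g *m h) = unit_act phi g *m unit_act phi h.
Proof. by rewrite mulmx1. Qed.

Lemma unit_act_nat (A B : comNzRingType) (phi : {rmorphism k -> A})
    (psi : {rmorphism k -> B}) (e : {rmorphism A -> B}) g :
  (forall c, e (phi c) = psi c) -> \det g = 1 ->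
  @unit_act B psi (map_mx e g) = map_mx e (@unit_act A phi g).
Proof. by rewrite map_mx1. Qed.

Definition tunit : sl2rep k := Sl2Rep unit_act1 unit_actM unit_act_nat.

Variables X Y : sl2rep k.

Definition tens_act (A : comNzRingType) (phi : {rmorphism k -> A}) (g : 'M[A]_2) :
  'M[A]_(rdim X * rdim Y) := ract X phi g *t ract Y phi g.

Lemma tens1mx1 (A : comNzRingType) m n :
  (1%:M : 'M[A]_m) *t (1%:M : 'M[A]_n) = 1%:M.
Proof.
apply/matrixP=> i j; case: (mxtens_indexP i) => i1 i2; case: (mxtens_indexP j) => j1 j2.
rewrite tensmxE !mxE -natrM mulnb (can_eq (@mxtens_indexK m n)).
by rewrite xpair_eqE.
Qed.

Lemma tens_act1 A phi : @tens_act A phi 1%:M = 1%:M.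
Proof. by rewrite /tens_act !ract1 tens1mx1. Qed.

Lemma tens_actM (A : comNzRingType) (phi : {rmorphism k -> A}) (g h : 'M[A]_2) : \det g = 1 -> \det h = 1 ->
  @tens_act A phi (g *m h) = tens_act phi g *m tens_act phi h.
Proof. by move=> dg dh; rewrite /tens_act !ractM // tensmx_mul. Qed.

Lemma tens_act_nat (A B : comNzRingType) (phi : {rmorphism k -> A})
    (psi : {rmorphism k -> B}) (e : {rmorphism A -> B}) g :
  (forall c, e (phi c) = psi c) -> \det g = 1 ->
  @tens_act B psi (map_mx e g) = map_mx e (@tens_act A phi g).
Proof.
by move=> he dg; rewrite /tens_act !(ract_nat _ he dg) map_mxT.
Qed.

Definition tens : sl2rep k := Sl2Rep tens_act1 tens_actM tens_act_nat.

End TensorUnit.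

Section DualWeyl.
Variables (k : fieldType) (n : nat).

(* The homogeneous polynomial x^j y^(n-j) of degree n in the standard basis
   x, y of k^2 is dehomogenised as 'X^j; a matrix g sends it to
   (g00 x + g10 y)^j (g01 x + g11 y)^(n-j). *)
Definition substx (A : comNzRingType) (g : 'M[A]_2) : {poly A} :=
  g 0 0 *: 'X + (g 1 0)%:P.
Definition substy (A : comNzRingType) (g : 'M[A]_2) : {poly A} :=
  g 0 1 *: 'X + (g 1 1)%:P.

Definition sym_act (A : comNzRingType) (phi : {rmorphism k -> A}) (g : 'M[A]_2) :
  'M[A]_n.+1 :=
  \matrix_(i < n.+1, j < n.+1) (substx g ^+ j * substy g ^+ (n - j))`_i.

(* The action of g on all polynomials of degree at most m; it is multiplicative
   in the degree, whence [sym_actM]. *)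
Definition hsub (A : comNzRingType) (g : 'M[A]_2) m (q : {poly A}) : {poly A} :=
  \sum_(j < m.+1) q`_j *: (substx g ^+ j * substy g ^+ (m - j)).

Lemma hsubMl (A : comNzRingType) (g : 'M[A]_2) m (q : {poly A}) u v :
  (size q <= m.+1)%N ->
  hsub g m.+1 (q * (u *: 'X + v%:P))
    = hsub g m q * (u *: substx g + v *: substy g).
Proof.
move=> sq; rewrite /hsub.
have cE j : (q * (u *: 'X + v%:P))`_j = u * (q * 'X)`_j + v * q`_j.
  by rewrite mulrDr -scalerAr coefD coefZ coefMC [_ * v]mulrC.
under eq_bigr => j _ do rewrite cE scalerDl.
rewrite big_split /= mulrDr; congr (_ + _).
  rewrite big_ord_recl /= coefMX /= mulr0 scale0r add0r mulr_suml.
  apply: eq_bigr => j _; rewrite /bump /= add1n coefMX /= subSS.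
  rewrite exprS -scalerAr -!scalerAl !scalerA; congr (_ *: _).
  by rewrite [RHS]mulrC mulrA.
rewrite big_ord_recr /= (nth_default _ sq) mulr0 scale0r addr0 mulr_suml.
apply: eq_bigr => j _; rewrite (subSn (ltn_ord j : (j <= m)%N)) exprSr.
by rewrite -scalerAr -!scalerAl !scalerA mulrA.
Qed.

Lemma size_lin (A : comNzRingType) (u v : A) :
  (size (u *: 'X + v%:P)%R <= 2)%N.
Proof.
apply: leq_trans (size_polyD _ _) _; rewrite geq_max.
rewrite (leq_trans (size_scale_leq _ _)) ?size_polyX //.
by rewrite (leq_trans (size_polyC_leq1 _)).
Qed.

Lemma size_linM (A : comNzRingType) (u v : A) (q : {poly A}) m :
  (size q <= m.+1)%N -> (size (q * (u *: 'X + v%:P))%R <= m.+2)%N.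
Proof.
move=> sq; apply: leq_trans (size_polyMleq _ _) _.
by have := leq_add sq (size_lin u v); rewrite addn2 -ltnS; case: (_ + _)%N.
Qed.

Lemma size_subst (A : comNzRingType) (g : 'M[A]_2) (a b : nat) :
  (size (substx g ^+ a * substy g ^+ b)%R <= (a + b).+1)%N.
Proof.
elim: b => [|b IH]; last by rewrite exprSr mulrA addnS; apply: size_linM.
rewrite addn0 mulr1; elim: a => [|a IH]; first by rewrite size_poly1.
by rewrite exprSr; apply: size_linM.
Qed.

Lemma substxM (A : comNzRingType) (g h : 'M[A]_2) :
  substx (g *m h) = h 0 0 *: substx g + h 1 0 *: substy g.
Proof.
rewrite /substx /substy !mxE !big_ord_recl !big_ord0 !addr0.
have -> : lift ord0 ord0 = 1 :> 'I_2 by apply: val_inj.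
have -> : ord0 = 0 :> 'I_2 by [].
rewrite !scalerDr !scalerA !scalerDl !polyCD !polyCM -!mul_polyC.
rewrite !polyCM ![(h _ _)%:P * _]mulrC -!addrA; congr (_ + _).
by rewrite addrCA.
Qed.

Lemma substyM (A : comNzRingType) (g h : 'M[A]_2) :
  substy (g *m h) = h 0 1 *: substx g + h 1 1 *: substy g.
Proof.
rewrite /substx /substy !mxE !big_ord_recl !big_ord0 !addr0.
have -> : lift ord0 ord0 = 1 :> 'I_2 by apply: val_inj.
have -> : ord0 = 0 :> 'I_2 by [].
rewrite !scalerDr !scalerA !scalerDl !polyCD !polyCM -!mul_polyC.
rewrite !polyCM ![(h _ _)%:P * _]mulrC -!addrA; congr (_ + _).
by rewrite addrCA.
Qed.

Lemma hsub_subst (A : comNzRingType) (g h : 'M[A]_2) (a b : nat) :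
  hsub g (a + b) (substx h ^+ a * substy h ^+ b)
    = substx (g *m h) ^+ a * substy (g *m h) ^+ b.
Proof.
elim: b => [|b IH]; last first.
  by rewrite !exprSr !mulrA addnS hsubMl ?size_subst // IH -substyM.
rewrite addn0 !mulr1; elim: a => [|a IH].
  by rewrite /hsub big_ord1 !expr0 coef1 scale1r mulr1.
rewrite !exprSr hsubMl ?IH -?substxM //.
by have := size_subst h a 0; rewrite mulr1 addn0.
Qed.

Lemma sym_act1 A phi : @sym_act A phi 1%:M = 1%:M.
Proof.
apply/matrixP=> i j; rewrite !mxE /substx /substy !mxE /=.
by rewrite !scale1r scale0r addr0 add0r expr1n mulr1 coefXn.
Qed.

Lemma sym_actM (A : comNzRingType) (phi : {rmorphism k -> A}) (g h : 'M[A]_2) : \det g = 1 -> \det h = 1 ->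
  @sym_act A phi (g *m h) = sym_act phi g *m sym_act phi h.
Proof.
move=> _ _; apply/matrixP=> i j; rewrite !mxE.
have jn : (j + (n - j) = n)%N by rewrite subnKC // -ltnS.
have := hsub_subst g h j (n - j); rewrite jn => <-.
rewrite /hsub coef_sum; apply: eq_bigr => l _.
by rewrite coefZ !mxE mulrC.
Qed.

Lemma sym_act_nat (A B : comNzRingType) (phi : {rmorphism k -> A})
    (psi : {rmorphism k -> B}) (e : {rmorphism A -> B}) g :
  (forall c, e (phi c) = psi c) -> \det g = 1 ->
  @sym_act B psi (map_mx e g) = map_mx e (@sym_act A phi g).
Proof.
move=> _ _; apply/matrixP=> i j; rewrite !mxE -coef_map rmorphM !rmorphXn /=.
by rewrite /substx /substy !rmorphD /= !map_polyZ !map_polyX !map_polyC !mxE.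
Qed.

(* The dual Weyl module V_n, i.e. the n-th symmetric power of k^2. *)
Definition dualWeyl : sl2rep k := Sl2Rep sym_act1 sym_actM sym_act_nat.

End DualWeyl.

Arguments dualWeyl k n : clear implicits.

Section SymmetricStructure.
Variable k : fieldType.
Implicit Types X Y Z : sl2rep k.

(* The linear map sending the j-th basis vector to the (s j)-th one. *)
Definition reindex_mx m n (s : 'I_m -> 'I_n) : 'M[k]_(n, m) :=
  \matrix_(i, j) (i == s j)%:R.

Lemma reindex_hom_subproof X Y (s : 'I_(rdim X) -> 'I_(rdim Y)) t
    (st : cancel s t) (ts : cancel t s)
    (H : forall (A : comNzRingType) (phi : {rmorphism k -> A}) (g : 'M[A]_2) i j,
      ract Y phi g (s i) (s j) = ract X phi g i j)
    (A : comNzRingType) (phi : {rmorphism k -> A}) (g : 'M[A]_2) :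
  \det g = 1 -> map_mx phi (reindex_mx s) *m ract X phi g
                = ract Y phi g *m map_mx phi (reindex_mx s).
Proof.
move=> _; apply/matrixP=> i j; rewrite !mxE.
rewrite (bigD1 (t i)) //= big1 ?addr0; last first.
  move=> l nl; rewrite !mxE (_ : (i == s l) = false) ?rmorph0 ?mul0r //.
  by apply: contra_neqF nl => /eqP ->; rewrite st.
rewrite [RHS](bigD1 (s j)) //= big1 ?addr0; last first.
  by move=> l nl; rewrite !mxE (negbTE nl) rmorph0 mulr0.
by rewrite !mxE ts !eqxx !rmorph1 mulr1 mul1r -{2}[i]ts H.
Qed.

Definition reindex_hom X Y (s : 'I_(rdim X) -> 'I_(rdim Y)) t
    (st : cancel s t) (ts : cancel t s)
    (H : forall (A : comNzRingType) (phi : {rmorphism k -> A}) (g : 'M[A]_2) i j,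
      ract Y phi g (s i) (s j) = ract X phi g i j) : hom X Y :=
  @Hom k X Y _ (reindex_hom_subproof st ts H).

Lemma hom_tens_subproof X X' Y Y' (f : hom X X') (h : hom Y Y')
    (A : comNzRingType) (phi : {rmorphism k -> A}) (g : 'M[A]_2) :
  \det g = 1 -> map_mx phi (hmx f *t hmx h) *m ract (tens X Y) phi g
                = ract (tens X' Y') phi g *m map_mx phi (hmx f *t hmx h).
Proof.
by move=> dg; rewrite map_mxT /= /tens_act !tensmx_mul !hom_equiv.
Qed.
Definition hom_tens X X' Y Y' (f : hom X X') (h : hom Y Y') :
  hom (tens X Y) (tens X' Y') := 
  @Hom k (tens X Y) (tens X' Y') _ (hom_tens_subproof f h).

Definition swap_ix m n (i : 'I_(m * n)) : 'I_(n * m) :=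
  mxtens_index ((mxtens_unindex i).2, (mxtens_unindex i).1).
Lemma swap_ixK m n : cancel (@swap_ix m n) (@swap_ix n m).
Proof. by move=> i; rewrite /swap_ix mxtens_indexK -surjective_pairing mxtens_unindexK. Qed.

Lemma braid_subproof X Y (A : comNzRingType) (phi : {rmorphism k -> A})
    (g : 'M[A]_2) i j :
  ract (tens Y X) phi g (swap_ix i) (swap_ix j) = ract (tens X Y) phi g i j.
Proof. by rewrite /= /tens_act !mxE !mxtens_indexK /= mulrC. Qed.
Definition braid X Y : hom (tens X Y) (tens Y X) :=
  @reindex_hom (tens X Y) (tens Y X) _ _ (@swap_ixK _ _) (@swap_ixK _ _)
    (@braid_subproof X Y).

Definition assoc_ix m n p (r : 'I_((m * n) * p)) : 'I_(m * (n * p)) :=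
  let: (ij, l) := mxtens_unindex r in let: (i, j) := mxtens_unindex ij in
  mxtens_index (i, mxtens_index (j, l)).
Definition assoc_inv_ix m n p (r : 'I_(m * (n * p))) : 'I_((m * n) * p) :=
  let: (i, jl) := mxtens_unindex r in let: (j, l) := mxtens_unindex jl in
  mxtens_index (mxtens_index (i, j), l).
Lemma assoc_ixE m n p i j l :
  @assoc_ix m n p (mxtens_index (mxtens_index (i, j), l))
    = mxtens_index (i, mxtens_index (j, l)).
Proof. by rewrite /assoc_ix !mxtens_indexK. Qed.
Lemma assoc_inv_ixE m n p i j l :
  @assoc_inv_ix m n p (mxtens_index (i, mxtens_index (j, l)))
    = mxtens_index (mxtens_index (i, j), l).
Proof. by rewrite /assoc_inv_ix !mxtens_indexK. Qed.
Lemma assoc_ixK m n p : cancel (@assoc_ix m n p) (@assoc_inv_ix m n p).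
Proof.
move=> r; case: (mxtens_indexP r) => ij l; case: (mxtens_indexP ij) => i j.
by rewrite assoc_ixE assoc_inv_ixE.
Qed.
Lemma assoc_inv_ixK m n p : cancel (@assoc_inv_ix m n p) (@assoc_ix m n p).
Proof.
move=> r; case: (mxtens_indexP r) => i jl; case: (mxtens_indexP jl) => j l.
by rewrite assoc_inv_ixE assoc_ixE.
Qed.

Lemma assoc_subproof X Y Z (A : comNzRingType) (phi : {rmorphism k -> A})
    (g : 'M[A]_2) r s :
  ract (tens X (tens Y Z)) phi g (assoc_ix r) (assoc_ix s)
    = ract (tens (tens X Y) Z) phi g r s.
Proof.
case: (mxtens_indexP r) => ij l; case: (mxtens_indexP ij) => i j.
case: (mxtens_indexP s) => ij' l'; case: (mxtens_indexP ij') => i' j'.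
by rewrite !assoc_ixE /= /tens_act !tensmxE mulrA.
Qed.
Lemma assoc_inv_subproof X Y Z (A : comNzRingType) (phi : {rmorphism k -> A})
    (g : 'M[A]_2) r s :
  ract (tens (tens X Y) Z) phi g (assoc_inv_ix r) (assoc_inv_ix s)
    = ract (tens X (tens Y Z)) phi g r s.
Proof. by rewrite -assoc_subproof !assoc_inv_ixK. Qed.

Definition assoc X Y Z : hom (tens (tens X Y) Z) (tens X (tens Y Z)) :=
  @reindex_hom (tens (tens X Y) Z) (tens X (tens Y Z)) _ _
    (@assoc_ixK _ _ _) (@assoc_inv_ixK _ _ _) (@assoc_subproof X Y Z).
Definition assoc_inv X Y Z : hom (tens X (tens Y Z)) (tens (tens X Y) Z) :=
  @reindex_hom (tens X (tens Y Z)) (tens (tens X Y) Z) _ _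
    (@assoc_inv_ixK _ _ _) (@assoc_ixK _ _ _)
    (@assoc_inv_subproof X Y Z).

Definition lunit_ix n (r : 'I_(1 * n)) : 'I_n := (mxtens_unindex r).2.
Definition lunit_inv_ix n (i : 'I_n) : 'I_(1 * n) := mxtens_index (ord0, i).
Lemma lunit_ixK n : cancel (@lunit_ix n) (@lunit_inv_ix n).
Proof.
move=> r; case: (mxtens_indexP r) => i j.
by rewrite /lunit_ix /lunit_inv_ix mxtens_indexK [i]ord1.
Qed.
Lemma lunit_inv_ixK n : cancel (@lunit_inv_ix n) (@lunit_ix n).
Proof. by move=> i; rewrite /lunit_ix mxtens_indexK. Qed.
Lemma lunit_subproof X (A : comNzRingType) (phi : {rmorphism k -> A})
    (g : 'M[A]_2) r s :
  ract X phi g (lunit_ix r) (lunit_ix s) = ract (tens (tunit k) X) phi g r s.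
Proof.
case: (mxtens_indexP r) => i j; case: (mxtens_indexP s) => i' j'.
rewrite /= /tens_act tensmxE /lunit_ix !mxtens_indexK !ord1 /=.
by rewrite /unit_act mxE eqxx mul1r.
Qed.
Definition lunit X : hom (tens (tunit k) X) X :=
  @reindex_hom (tens (tunit k) X) X _ _ (@lunit_ixK _) (@lunit_inv_ixK _)
    (@lunit_subproof X).

Definition ev_mx n : 'M[k]_(1, n * n) :=
  \matrix_(_, r) ((mxtens_unindex r).1 == (mxtens_unindex r).2)%:R.
Lemma ev_subproof X (A : comNzRingType) (phi : {rmorphism k -> A})
    (g : 'M[A]_2) : \det g = 1 ->
  map_mx phi (ev_mx (rdim X)) *m ract (tens (dual X) X) phi g
    = ract (tunit k) phi g *m map_mx phi (ev_mx (rdim X)).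
Proof.
move=> dg; rewrite /= /unit_act mul1mx; apply/matrixP=> u r.
case: (mxtens_indexP r) => a b.
rewrite mxE (reindex (@mxtens_index (rdim X) (rdim X))) /=; last first.
  exists (@mxtens_unindex _ _) => ? _; by rewrite (mxtens_indexK, mxtens_unindexK).
set F := BIG_F; rewrite (eq_bigr (fun ij => F (ij.1, ij.2))); last by case.
rewrite -(pair_bigA _ (fun i j => F (i, j))) /F !mxE mxtens_indexK /=.
have H : ract X phi (\adj g) *m ract X phi g = 1%:M.
  by rewrite -ractM ?det_adj1 // mul_adj_mx dg ract1.
have := congr1 (fun M : 'M_(_) => M a b) H; rewrite !mxE => E.
rewrite rmorph_nat -E; apply: eq_bigr => i _.
rewrite (bigD1 i) //= big1 ?addr0.
  by rewrite /tens_act tensmxE !mxE mxtens_indexK eqxx rmorph1 mul1r.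
move=> j nj; rewrite !mxE mxtens_indexK /= eq_sym (negbTE nj) rmorph0 mul0r //.
Qed.

Definition ev X : hom (tens (dual X) X) (tunit k) :=
  @Hom k (tens (dual X) X) (tunit k) _ (@ev_subproof X).

End SymmetricStructure.

Section Tilting.
Variable k : fieldType.
Implicit Types X Y Z : sl2rep k.

(* 0 -> X -> Y -> Z -> 0; the transposes are there because [kermx] is the
   kernel of the action on row vectors. *)
Definition short_exact X Y Z (i : hom X Y) (q : hom Y Z) : Prop :=
  [/\ row_full i, row_free q & (i^T == kermx (q^T))%MS].

(* X has a finite filtration all of whose subquotients belong to the family M. *)
Inductive filtered (M : nat -> sl2rep k) : sl2rep k -> Prop :=
| filtered_nil X : rdim X = 0%N -> filtered M X
| filtered_cons X Y n (i : hom X Y) (q : hom Y (M n)) :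
    filtered M X -> short_exact i q -> filtered M Y.

(* The Weyl module of highest weight n is the dual of V_n. *)
Definition tilting X : Prop :=
  filtered (dualWeyl k) X /\ filtered (fun n => dual (dualWeyl k n)) X.

End Tilting.

(* The category Ver_p for p = char k: its objects are the tilting modules, and its morphisms
   are the classes of SL_2-equivariant maps modulo negligible ones; morphisms
   are handled through representatives, [f ≡ h] being equality in Ver_p.  The
   categorical trace of representations is the trace of matrices.  The homs, and
   the operations on them, make sense for all representations: the tilting
   modules are a full subcategory closed under tensor products and duals, so
   only objects have to be required to be tilting. *)
Section Verlinde.
Variable k : fieldType.
Implicit Types X Y Z : sl2rep k.

Definition negligible X Y (f : hom X Y) : Prop :=
  forall h : hom Y X, \tr (h *m f) = 0.

Definition ver_eq X Y (f h : hom X Y) : Prop := negligible (hom_sub f h).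

Local Notation "f ≡ h" := (ver_eq f h) (at level 70).
Local Notation "f ∘ h" := (hom_comp f h) (at level 40, left associativity).

Definition ver_iso X Y (f : hom X Y) : Prop :=
  exists h : hom Y X, h ∘ f ≡ hom_id X /\ f ∘ h ≡ hom_id Y.

Definition ver_zero X : Prop := hom_id X ≡ hom_zero X X.

Definition ver_mono X Y (f : hom X Y) : Prop :=
  forall Z, tilting Z -> forall u v : hom Z X, f ∘ u ≡ f ∘ v -> u ≡ v.

(* Length 1, i.e. X is simple: it is nonzero, and its only subobjects are 0
   and X. *)
Definition ver_length1 X : Prop :=
  ~ ver_zero X /\
  forall Y, tilting Y -> forall i : hom Y X, ver_mono i ->
    ver_zero Y \/ ver_iso i.

Definition ver_kernel K X Y (i : hom K X) (f : hom X Y) : Prop :=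
  f ∘ i ≡ hom_zero K Y /\
  forall Z, tilting Z -> forall h : hom Z X, f ∘ h ≡ hom_zero Z Y ->
    exists u : hom Z K, i ∘ u ≡ h /\
      forall u' : hom Z K, i ∘ u' ≡ h -> u' ≡ u.

Record alg : Type := Alg {
  alg_obj : sl2rep k;
  alg_br : hom (tens alg_obj alg_obj) alg_obj
}.

(* The cyclic braiding x ⊗ y ⊗ z |-> z ⊗ x ⊗ y. *)
Definition cyc X : hom (tens (tens X X) X) (tens (tens X X) X) :=
  assoc_inv X X X ∘ braid (tens X X) X.

(* The second condition is the only antisymmetry required, also for p = 2. *)
Definition operadic_lie (g : alg) : Prop :=
  let b := alg_br g in let X := alg_obj g in
  [/\ tilting X,
      b ∘ braid X X ≡ hom_opp b
    & b ∘ hom_tens b (hom_id X) ∘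
        hom_add (hom_add (hom_id _) (cyc X)) (cyc X ∘ cyc X)
      ≡ hom_zero _ _].

Definition alg_iso (g h : alg) : Prop :=
  exists f : hom (alg_obj g) (alg_obj h),
    ver_iso f /\ f ∘ alg_br g ≡ alg_br h ∘ hom_tens f f.

Definition trivial_alg X : alg := Alg (hom_zero (tens X X) X).

(* The multiplication id ⊗ ev ⊗ id of X ⊗ X^*. *)
Definition gl_mul X :
  hom (tens (tens X (dual X)) (tens X (dual X))) (tens X (dual X)) :=
  hom_tens (hom_id X)
    (lunit (dual X) ∘ hom_tens (ev X) (hom_id (dual X))
       ∘ assoc_inv (dual X) X (dual X))
  ∘ assoc X (dual X) (tens X (dual X)).

Definition gl X : alg :=
  Alg (hom_sub (gl_mul X) (gl_mul X ∘ braid (tens X (dual X)) (tens X (dual X)))).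

Definition gl_trace X : hom (tens X (dual X)) (tunit k) :=
  ev X ∘ braid X (dual X).

(* s is sl(X): its object is a kernel in Ver_p of the trace of gl(X), with the
   bracket restricted from gl(X). *)
Definition is_sl X (s : alg) : Prop :=
  tilting (alg_obj s) /\
  exists i : hom (alg_obj s) (alg_obj (gl X)),
    ver_kernel i (gl_trace X) /\ i ∘ alg_br s ≡ alg_br (gl X) ∘ hom_tens i i.

End Verlinde.

(* Main.v *)
(* Modulo negligible maps, a tilting module X is a sum of V_m with m <= p - 2: as
   Ext^1(Weyl, dual Weyl) = 0, every map X -> V_m lifts to Q_m -> V_m, where Q_m is V_m
   if m < p and V_(p-1) ⊗ V_1 ⊗ ... ⊗ V_1 if m >= p - 1, and in the latter case the
   identity of Q_m is negligible.  So a simple Lie algebra in Ver_p lives on some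
   V_n, n <= p - 2, where it is given by an equivariant map b : V_n ⊗ V_n -> V_n.
   Such maps form a space of dimension <= 1, zero if n is odd.  If n = 2 then b is
   proportional to the bracket of sl_2.  If n > 2 is even, use the invariant
   tensor C = sum_(a,b) E_ab W ⊗ E_ba, where the E_ab in End V_n come from sl_2 and W
   in V_n ⊗ V_n is the invariant form: [b (E_ab W) = 0] as there is no nonzero map
   from sl_2 to V_n, and the Jacobi identity contracted with C says that the Killing
   form of b, a multiple of the invariant form, vanishes after multiplication by
   dim V_n * n (n + 2) / 2, which is nonzero modulo p.  A vanishing Killing form
   makes b negligible, since the dual of V_n ⊗ V_n -> V_n is again proportional to b. *)
From HB Require Import structures.
Require Import Defs.
From mathcomp Require Import all_boot all_order all_algebra.
From mathcomp Require Import boolp ring zify.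
Import Defs.

Set Implicit Arguments.
Unset Strict Implicit.
Unset Printing Implicit Defensive.

Import GRing.Theory.
Local Open Scope ring_scope.

(** * Generators of SL_2 and homomorphisms *)

Section Localization.
Variables (A : comNzRingType) (c : A).

(** A representation is known only through its points over all commutative [k]-algebras, and [k] may
    be finite, so nothing can be tested on [k]-points. Naturality takes the place of the coordinate
    ring: a generic unipotent over [k[X]] specialises to every other one. Over a general algebra an
    element of SL_2 need not be a product of elementary matrices, but it becomes one once an entry
    of its bottom row is inverted, and that row is unimodular; hence the detour through
    localizations. The torus is a word in unipotents and [wmx], which is how weight projections are
    obtained. In Ver_p the axioms hold only up to negligible maps, whereas the Killing form argument
    computes with matrices. Antisymmetry becomes exact because equivariant brackets on [V_n] form at
    most a line. The Jacobi identity stays known only through traces against equivariant maps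
    [V -> V ⊗ V ⊗ V], so the contraction with the Casimir tensor has to be realised as such a map;
    [sltens] and [slcoact] are built for that. *)

Definition locp : {poly A} := c *: 'X - 1.
(** Its quotient models the localization of [A] at [c]. Membership is decided classically because
    ideal quotients are taken by boolean predicates. *)
Definition loc_ideal : {pred {poly A}} := fun q => `[< exists r, q = r * locp >].

Lemma loc_idealP q : reflect (exists r, q = r * locp) (q \in loc_ideal).
Proof. exact: asboolP. Qed.

(** Comparing coefficients in [z = r (c X - 1)] forces the [i]-th coefficient of [r] to be
    [- c^i z], and [r] has only finitely many nonzero coefficients. *)
Lemma loc_ideal_const z : z%:P \in loc_ideal -> exists N, c ^+ N * z = 0.
Proof.
case/loc_idealP=> r rE.
have E i : (r * locp)`_i = (if i is i'.+1 then r`_i' * c else 0) - r`_i.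
  by rewrite mulrBr mulr1 coefB -scalerAr coefZ coefMX; case: i => [|i] /=; rewrite ?mulr0 // mulrC.
have rn i : r`_i = - (c ^+ i * z).
  elim: i => [|i IH]; first by move: (E 0%N); rewrite -rE coefC /= sub0r mul1r => ->; rewrite opprK.
  by move: (E i.+1); rewrite -rE coefC /= IH => /esym /eqP; rewrite subr_eq0 => /eqP <-;
    rewrite exprSr mulNr mulrAC.
by exists (size r); apply/eqP; rewrite -oppr_eq0 -rn nth_default.
Qed.

Hypothesis c_nn : forall N, c ^+ N != 0.

Lemma loc_ideal_closed : idealr_closed loc_ideal.
Proof.
split=> [||a u v].
- by apply/loc_idealP; exists 0; rewrite mul0r.
- apply/negP => /loc_ideal_const [N]; rewrite mulr1; exact/eqP.
- move=> /loc_idealP[r ->] /loc_idealP[r' ->]; apply/loc_idealP.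
  by exists (a * r + r'); rewrite mulrDl mulrA.
Qed.
HB.instance Definition _ := isIdealr.Build {poly A} loc_ideal loc_ideal_closed.

Lemma loc_ring_exists : exists (B : comNzRingType) (e : {rmorphism A -> B}) (y : B),
  y * e c = 1 /\ forall z, e z = 0 -> exists N, c ^+ N * z = 0.
Proof.
pose Q : comNzRingType := {ideal_quot loc_ideal}.
pose pi : {rmorphism {poly A} -> Q} := \pi_Q%qT.
have key q : pi q = 0 <-> q \in loc_ideal.
  rewrite -[q in q \in _]subr0 Quotient.idealrBE.
  by rewrite -[X in _ = X <-> _](rmorph0 pi); split=> [/eqP|/eqP].
exists Q, (pi \o polyC : {rmorphism A -> Q}), (pi 'X); split=> /= [|z].
  rewrite -rmorphM; apply/eqP; rewrite -subr_eq0 -(rmorph1 pi) -rmorphB.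
  apply/eqP/key/loc_idealP; exists 1.
  by rewrite mul1r /locp mulrC mul_polyC.
by move/key; exact: loc_ideal_const.
Qed.
End Localization.

(* A[x]/(cx - 1) is a nonzero ring only if [c] is not nilpotent; otherwise the
   conclusion is trivial. *)
Lemma loc_annihilator (A : comNzRingType) (c z : A) :
  (forall (B : comNzRingType) (e : {rmorphism A -> B}) y, y * e c = 1 -> e z = 0) ->
  exists N, c ^+ N * z = 0.
Proof.
move=> H; have [[N cN]|nc] := EM (exists N, c ^+ N = 0).
  by exists N; rewrite cN mul0r.
have c_nn N : c ^+ N != 0 by apply/eqP => E; apply: nc; exists N.
have [B [e [y [ye inj]]]] := loc_ring_exists c_nn.
exact/inj/(H B e y).
Qed.

Section Matrices2.
Variable A : comNzRingType.
Implicit Types a b c d : A.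

Definition mx2 a b c d : 'M[A]_2 :=
  \matrix_(i, j) if i == 0 then (if j == 0 then a else b)
                 else (if j == 0 then c else d).

Lemma ord2P (i : 'I_2) : i = 0 \/ i = 1.
Proof. by case: i => [[|[|//]] lti]; [left|right]; apply: val_inj. Qed.

Lemma big_ord2 (R : nmodType) (F : 'I_2 -> R) : \sum_(i < 2) F i = F 0 + F 1.
Proof. by rewrite !big_ord_recl big_ord0 addr0; congr (F _ + F _); apply: val_inj. Qed.

Lemma mx2P (M N : 'M[A]_2) :
  M 0 0 = N 0 0 -> M 0 1 = N 0 1 -> M 1 0 = N 1 0 -> M 1 1 = N 1 1 -> M = N.
Proof.
by move=> ? ? ? ?; apply/matrixP=> i j; case: (ord2P i) => ->; case: (ord2P j) => ->.
Qed.

Lemma mx2_eta (M : 'M[A]_2) : M = mx2 (M 0 0) (M 0 1) (M 1 0) (M 1 1).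
Proof. by apply: mx2P; rewrite !mxE. Qed.

Lemma mx2M a b c d a' b' c' d' : mx2 a b c d *m mx2 a' b' c' d'
  = mx2 (a * a' + b * c') (a * b' + b * d') (c * a' + d * c') (c * b' + d * d').
Proof. by apply: mx2P; rewrite !mxE big_ord2 !mxE. Qed.

Lemma mx2_1 : 1%:M = mx2 1 0 0 1.
Proof. by apply: mx2P; rewrite !mxE. Qed.

Lemma det_mx2 a b c d : \det (mx2 a b c d) = a * d - b * c.
Proof.
rewrite (expand_det_row _ 0) big_ord2 /cofactor !det_mx11 !mxE /=.
by rewrite expr0 expr1 mul1r mulN1r mulrN.
Qed.

Lemma adj_mx2 a b c d : \adj (mx2 a b c d) = mx2 d (- b) (- c) a.
Proof.
apply: mx2P; rewrite !mxE /cofactor det_mx11 !mxE /=;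
  rewrite ?(expr0, expr1, mul1r, mulN1r, expr2, mulr1, mulrN, opprK) //.
Qed.

Definition wmx : 'M[A]_2 := mx2 0 (-1) 1 0.
Definition lmx a : 'M[A]_2 := mx2 1 0 a 1.
Definition umx a : 'M[A]_2 := mx2 1 a 0 1.
Definition tmx a b : 'M[A]_2 := mx2 a 0 0 b.

Lemma det_wmx : \det wmx = 1. Proof. by rewrite det_mx2; ring. Qed.
Lemma det_lmx a : \det (lmx a) = 1. Proof. by rewrite det_mx2; ring. Qed.
Lemma det_umx a : \det (umx a) = 1. Proof. by rewrite det_mx2; ring. Qed.
Lemma det_tmx a b : a * b = 1 -> \det (tmx a b) = 1.
Proof. by rewrite det_mx2 mulr0 subr0. Qed.

Lemma det_mulmx1 (g h : 'M[A]_2) : \det g = 1 -> \det h = 1 -> \det (g *m h) = 1.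
Proof. by move=> dg dh; rewrite det_mulmx dg dh mulr1. Qed.
End Matrices2.

Arguments wmx {A}.

Lemma map_mx2 (A B : comNzRingType) (e : {rmorphism A -> B}) (a b c d : A) :
  map_mx e (mx2 a b c d) = mx2 (e a) (e b) (e c) (e d).
Proof. by apply: mx2P; rewrite !mxE. Qed.

Lemma map_wmx (A B : comNzRingType) (e : {rmorphism A -> B}) : map_mx e wmx = wmx.
Proof. by rewrite map_mx2 rmorphN rmorph0 rmorph1. Qed.

Lemma map_lmx (A B : comNzRingType) (e : {rmorphism A -> B}) a :
  map_mx e (lmx a) = lmx (e a).
Proof. by rewrite map_mx2 rmorph0 rmorph1. Qed.

(** If [c z] and [d z] vanish, so does [z = (a c - b d) z]. Each of them is killed by one power
    fewer of [c], respectively [d], whence the induction on [M + N]. *)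
Lemma unimodular_annihilator (A : comNzRingType) (a b c d z : A) M N :
  a * c - b * d = 1 -> c ^+ M * z = 0 -> d ^+ N * z = 0 -> z = 0.
Proof.
move=> E; have [n le_n] := ubnP (M + N).
elim: n => // n IH in M N z le_n *.
case: M le_n => [|M] le_n; first by rewrite mul1r.
case: N le_n => [|N] le_n; first by rewrite mul1r.
move=> Hc Hd; have cz : c * z = 0.
  apply: (IH M N.+1); first by rewrite addSn in le_n.
    by rewrite mulrA -exprSr.
  by rewrite mulrCA Hd mulr0.
have dz : d * z = 0.
  apply: (IH M.+1 N); first by rewrite addnS in le_n.
    by rewrite mulrCA Hc mulr0.
  by rewrite mulrA -exprSr.
by rewrite -[LHS]mul1r -E mulrBl -!mulrA cz dz !mulr0 subr0.
Qed.

Section Generators.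
Variable k : fieldType.
Implicit Types X Y : sl2rep k.

Definition evalm (A : comNzRingType) (phi : {rmorphism k -> A}) (a : A) :
  {rmorphism {poly k} -> A} := horner_morph (fun x => mulrC a (phi x)).

Arguments evalm : simpl never.

Lemma evalmC (A : comNzRingType) (phi : {rmorphism k -> A}) a c :
  evalm phi a c%:P = phi c.
Proof. exact: horner_morphC. Qed.

Lemma evalmX (A : comNzRingType) (phi : {rmorphism k -> A}) a :
  evalm phi a 'X = a.
Proof. exact: horner_morphX. Qed.

Definition wact X : 'M[k]_(rdim X) := ract X idfun wmx.
(** The generic lower unipotent; by naturality its matrix determines the action of every [lmx a]. *)
Definition lact X : 'M[{poly k}]_(rdim X) := ract X polyC (lmx 'X).

Lemma ract_w X (A : comNzRingType) (phi : {rmorphism k -> A}) :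
  ract X phi wmx = map_mx phi (wact X).
Proof.
rewrite -(map_wmx phi) -(@ract_nat _ X _ _ idfun phi phi) ?map_wmx //.
exact: det_wmx.
Qed.

Lemma ract_l X (A : comNzRingType) (phi : {rmorphism k -> A}) a :
  ract X phi (lmx a) = map_mx (evalm phi a) (lact X).
Proof.
rewrite /lact -(@ract_nat _ X _ _ polyC phi (evalm phi a)) ?map_lmx ?evalmX //.
  by move=> c; rewrite evalmC.
exact: det_lmx.
Qed.

Section Hom.
Variables (X Y : sl2rep k) (M : 'M[k]_(rdim Y, rdim X)).
Hypothesis Mw : M *m wact X = wact Y *m M.
Hypothesis Ml : map_mx polyC M *m lact X = lact Y *m map_mx polyC M.

Let good (A : comNzRingType) (phi : {rmorphism k -> A}) (g : 'M[A]_2) :=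
  \det g = 1 /\ map_mx phi M *m ract X phi g = ract Y phi g *m map_mx phi M.

Let goodM (A : comNzRingType) (phi : {rmorphism k -> A}) (g h : 'M[A]_2) :
  good phi g -> good phi h -> good phi (g *m h).
Proof.
move=> [dg Hg] [dh Hh]; split; first exact: det_mulmx1.
by rewrite !ractM // mulmxA Hg -!mulmxA Hh.
Qed.

Let good_w (A : comNzRingType) (phi : {rmorphism k -> A}) : good phi wmx.
Proof. by split; [exact: det_wmx | rewrite !ract_w -!map_mxM Mw]. Qed.

Let good_l (A : comNzRingType) (phi : {rmorphism k -> A}) a : good phi (lmx a).
Proof.
split; first exact: det_lmx.
have E : map_mx phi M = map_mx (evalm phi a) (map_mx polyC M).
  by apply/matrixP=> i j; rewrite !mxE evalmC.
by rewrite !ract_l E -!map_mxM Ml.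
Qed.

Let good_u (A : comNzRingType) (phi : {rmorphism k -> A}) a : good phi (umx a).
Proof.
have -> : umx a = wmx *m lmx (- a) *m wmx *m wmx *m wmx.
  by rewrite !mx2M; congr mx2; ring.
by do 4![apply: goodM => //].
Qed.

(** With an invertible lower left entry, [g] lies in the big cell and factors as upper, lower, upper
    unipotent. *)
Let good_c (A : comNzRingType) (phi : {rmorphism k -> A}) (g : 'M[A]_2) y :
  \det g = 1 -> y * g 1 0 = 1 -> good phi g.
Proof.
rewrite [g]mx2_eta det_mx2 !mxE /=.
move: (g 0 0) (g 0 1) (g 1 0) (g 1 1) => a b c d dg yc.
have -> : mx2 a b c d = umx ((a - 1) * y) *m lmx c *m umx ((d - 1) * y).
  rewrite !mx2M; congr mx2.
  - by transitivity (1 + (a - 1) * (y * c)); [rewrite yc|]; ring.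
  - transitivity (b * (y * c)); first by rewrite yc mulr1.
    transitivity (y * (a * d - (a * d - b * c)) + 0 * (a - 1) * (d - 1) * y); first by ring.
    by rewrite dg -(subrr (y * c)) {2}yc; ring.
  - by ring.
  - by transitivity (1 + (d - 1) * (y * c)); [rewrite yc|]; ring.
by do 2![apply: goodM => //].
Qed.

(** Right multiplication by [wmx] moves [g 1 1] to the lower left corner, and the fourth power of
    [wmx] is 1. *)
Let good_d (A : comNzRingType) (phi : {rmorphism k -> A}) (g : 'M[A]_2) y :
  \det g = 1 -> y * g 1 1 = 1 -> good phi g.
Proof.
move=> dg yd; have -> : g = g *m wmx *m wmx *m wmx *m wmx.
  by rewrite -!mulmxA !mx2M -[g in LHS]mulmx1 mx2_1; congr (g *m mx2 _ _ _ _); ring.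
do 3![apply: goodM => //]; apply: (@good_c _ _ _ y); first by rewrite det_mulmx dg det_wmx mulr1.
by rewrite !mxE big_ord2 !mxE /= mulr0 mulr1 add0r.
Qed.

(** The defect [Z] vanishes after inverting either entry of the bottom row of [g], so powers of both
    entries kill it; as [\det g = 1], these entries generate the unit ideal. *)
Lemma hom_of_gen_subproof (A : comNzRingType) (phi : {rmorphism k -> A}) (g : 'M[A]_2) :
  \det g = 1 -> map_mx phi M *m ract X phi g = ract Y phi g *m map_mx phi M.
Proof.
move=> dg; apply/eqP; rewrite -subr_eq0; apply/eqP/matrixP=> i j; rewrite [RHS]mxE.
set Z := _ - _.
have loc (c : A) : (forall (B : comNzRingType) (e : {rmorphism A -> B}) y,
    y * e c = 1 -> good (e \o phi : {rmorphism k -> B}) (map_mx e g)) ->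
    exists N, c ^+ N * Z i j = 0.
  move=> H; apply: loc_annihilator => B e y /H [_] /eqP.
  rewrite -subr_eq0 !(@ract_nat _ _ _ _ phi (e \o phi) e) //.
  have -> : map_mx (e \o phi) M = map_mx e (map_mx phi M) by rewrite map_mx_comp.
  rewrite -!map_mxM -map_mxB -/Z => /eqP /matrixP /(_ i j).
  by rewrite !mxE.
have dg' (B : comNzRingType) (e : {rmorphism A -> B}) : \det (map_mx e g) = 1.
  by rewrite det_map_mx dg rmorph1.
have [|N1 H1] := loc (g 1 0).
  by move=> B e y ye; apply: (@good_c _ _ _ y) => //; rewrite mxE.
have [|N2 H2] := loc (g 1 1).
  by move=> B e y ye; apply: (@good_d _ _ _ y) => //; rewrite mxE.
have E : g 0 0 * g 1 1 - g 0 1 * g 1 0 = 1 by rewrite -det_mx2 -mx2_eta.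
exact: (unimodular_annihilator E H2 H1).
Qed.

Definition hom_of_gen : hom X Y := Hom hom_of_gen_subproof.
End Hom.
End Generators.

(** * Matrix entries of [V_n] on unipotents, torus and [wmx] *)

Section DualWeylEntries.
Variables (k : fieldType) (A : comNzRingType) (phi : {rmorphism k -> A}).
Implicit Types (n : nat) (a s : A).

Lemma coef_linX (a c : A) j i : ((a *: 'X + c%:P) ^+ j)`_i = a ^+ i * c ^+ (j - i) *+ 'C(j, i).
Proof.
rewrite addrC exprDn coef_sum.
under eq_bigr => l _.
  rewrite coefMn -rmorphXn coefCM exprZn coefZ coefXn.
  over.
have [lt_ij|lt_ji] := ltnP i j.+1.
  rewrite (bigD1 (Ordinal lt_ij)) //= eqxx mulr1 big1 ?addr0 1?mulrC // => l ne.
  by rewrite -val_eqE eq_sym /= in ne; rewrite (negbTE ne) !mulr0 mul0rn.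
rewrite bin_small // mulr0n big1 // => l _.
by rewrite gtn_eqF ?mulr0 ?mul0rn ?mulr0 // (leq_trans (ltn_ord l)).
Qed.

Lemma dualWeyl_l n a (i j : 'I_n.+1) :
  ract (dualWeyl k n) phi (lmx a) i j = a ^+ (j - i) *+ 'C(j, i).
Proof.
rewrite /= !mxE /substx /substy !mxE /= scale0r add0r expr1n mulr1.
by rewrite coef_linX expr1n mul1r.
Qed.

Lemma dualWeyl_w n (i j : 'I_n.+1) :
  ract (dualWeyl k n) phi wmx i j = (-1) ^+ i *+ (i == rev_ord j).
Proof.
rewrite /= !mxE /substx /substy !mxE /= scale0r add0r addr0 expr1n mul1r.
rewrite exprZn coefZ coefXn -val_eqE /= subSS.
by have [->|_] := eqVneq; rewrite ?mulr1 ?mulr0.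
Qed.

Lemma dualWeyl_t n s t (i j : 'I_n.+1) :
  ract (dualWeyl k n) phi (tmx s t) i j = (s ^+ i * t ^+ (n - i)) *+ (i == j).
Proof.
rewrite /= !mxE /substx /substy !mxE /= scale0r add0r addr0.
rewrite exprZn -scalerAl -rmorphXn /= mulrC coefZ coefCM coefXn -val_eqE /=.
by have [->|_] := eqVneq; rewrite ?mulr1 // !mulr0.
Qed.

Lemma dualWeyl_u n a (i j : 'I_n.+1) :
  ract (dualWeyl k n) phi (umx a) i j
    = if (i < j)%N then 0 else a ^+ (i - j) *+ 'C(n - j, i - j).
Proof.
rewrite /= !mxE /substx /substy !mxE /= scale1r addr0 coefXnM.
by case: ifP => // _; rewrite coef_linX expr1n mulr1.
Qed.
End DualWeylEntries.

(** * Weight projections for the diagonal torus *)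

Section Weights.
Variables (k : fieldType) (X : sl2rep k).
Notation N := (rdim X).

Lemma evalm_map (A B : comNzRingType) (phi : {rmorphism k -> A})
    (e : {rmorphism A -> B}) a (q : {poly k}) :
  e (evalm phi a q) = evalm (e \o phi) (e a) q.
Proof.
elim/poly_ind: q => [|q c IH]; first by rewrite !rmorph0.
by rewrite !rmorphD !rmorphM /= IH !evalmC !evalmX.
Qed.

Lemma evalm_comp (A : comNzRingType) (phi : {rmorphism k -> A}) a b (q : {poly k}) :
  evalm phi a (evalm polyC b q) = evalm phi (evalm phi a b) q.
Proof.
rewrite evalm_map.
elim/poly_ind: q => [|q c IH]; first by rewrite !rmorph0.
by rewrite !rmorphD !rmorphM /= IH !evalmC !evalmX /= evalmC.
Qed.

(** The lower bound [m] on [D] serves later, where [D - n] must not be truncated. *)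
Lemma size_bound m : exists D, (m <= D)%N /\ forall i j, (size (lact X i j) <= D.+1)%N.
Proof.
exists (m + \max_i \max_j size (lact X i j))%N; split; first exact: leq_addr.
move=> i j; apply: leqW; apply: leq_trans (leq_addl _ _).
by apply: leq_trans (leq_bigmax i); apply: (leq_bigmax j).
Qed.

(** As [t] is the inverse of [s], clearing denominators by [s ^+ D] reverses the coefficients. *)
Lemma evalm_rev (A : comNzRingType) (phi : {rmorphism k -> A}) (s t : A) D (q : {poly k}) :
  s * t = 1 -> (size q <= D.+1)%N ->
  s ^+ D * evalm phi (- t) q
    = evalm phi s (\poly_(i < D.+1) ((-1) ^+ (D - i) * q`_(D - i))).
Proof.
move=> st sq.
rewrite -[q in LHS](@coefK _ q) poly_def.
rewrite (_ : \sum_(i < size q) _ = \sum_(i < D.+1) q`_i *: 'X^i); last first.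
  rewrite -!poly_def; apply/polyP=> i; rewrite !coef_poly.
  case: ltnP => h; first by rewrite (leq_trans h sq).
  by rewrite nth_default //; case: ifP.
rewrite poly_def !rmorph_sum mulr_sumr (reindex_inj rev_ord_inj) /=.
apply: eq_bigr => i _; rewrite -!mul_polyC !rmorphM /= !evalmC !rmorphXn /= !evalmX subSS.
have iD : (i <= D)%N by rewrite -ltnS.
rewrite ?rmorphXn /= rmorphN1 -{1}(subnK iD) exprD exprNn.
transitivity ((-1) ^+ (D - i) * phi q`_(D - i) * s ^+ i * (s * t) ^+ (D - i)).
  by rewrite exprMn; ring.
by rewrite st expr1n mulr1.
Qed.

(** [tmx s t] is a word in [wmx], [lmx (- s)] and [lmx (- t)] containing [lmx (- t)] only once, so a
    single factor [s ^+ D] clears all negative powers of [s]. *)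
Lemma torus_poly m : exists D (Q : 'M[{poly k}]_N), (m <= D)%N /\
  forall (A : comNzRingType) (phi : {rmorphism k -> A}) (s t : A), s * t = 1 ->
    s ^+ D *: ract X phi (tmx s t) = map_mx (evalm phi s) Q.
Proof.
have [D [mD sD]] := size_bound m.
pose W := map_mx polyC (wact X).
pose Lm := map_mx (evalm polyC (- 'X)) (lact X).
pose Lr : 'M[{poly k}]_N := \matrix_(i, j) \poly_(l < D.+1) ((-1) ^+ (D - l) * (lact X i j)`_(D -
  l)).
exists D, (W *m Lm *m W *m W *m W *m Lr *m W *m Lm); split=> // A phi s t st.
have -> : tmx s t = wmx *m lmx (- s) *m wmx *m wmx *m wmx *m lmx (- t) *m wmx *m lmx (- s).
  rewrite !mx2M; congr mx2.
  - by transitivity (s + s - s * (s * t)); [rewrite st|]; ring.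
  - by transitivity (s * t - 1); [rewrite st|]; ring.
  - by transitivity (1 - s * t); [rewrite st|]; ring.
  - by ring.
rewrite !ractM ?(det_mulmx, det_wmx, det_lmx, mulr1) // !map_mxM !ract_w !ract_l.
have EW : map_mx (evalm phi s) W = map_mx phi (wact X).
  by apply/matrixP=> i j; rewrite !mxE evalmC.
have EL : map_mx (evalm phi s) Lm = map_mx (evalm phi (- s)) (lact X).
  by apply/matrixP=> i j; rewrite !mxE evalm_comp rmorphN /= evalmX.
have ER : map_mx (evalm phi s) Lr = s ^+ D *: map_mx (evalm phi (- t)) (lact X).
  by apply/matrixP=> i j; rewrite !mxE -(evalm_rev _ st).
by rewrite EW EL ER -!scalemxAr -!scalemxAl.
Qed.

(** This reads the coefficient of [X^i Y^j] in [q(X Y)], where [X] is the outer and [Y] the inner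
    variable. *)
Lemma evalm_coef2 (q : {poly k}) i j : ((evalm (polyC \o polyC : {rmorphism k -> _}) ('X * 'X%:P)
  q)`_i)`_j
   = q`_i *+ (i == j).
Proof.
rewrite -[q in LHS](@coefK _ q) poly_def rmorph_sum /= !coef_sum.
have F l : evalm (polyC \o polyC : {rmorphism k -> _}) ('X * 'X%:P) (q`_l *: 'X^l)
    = ((q`_l)%:P * 'X^l)%:P * 'X^l.
  by rewrite -mul_polyC rmorphM /= evalmC rmorphXn /= evalmX exprMn -rmorphXn polyCM mulrA mulrAC.
under eq_bigr => l _ do rewrite F coefCM coefXn.
have [lt_i|le_i] := ltnP i (size q).
  rewrite (bigD1 (Ordinal lt_i)) //= big1 ?addr0.
    by rewrite eqxx mulr1 coefCM coefXn eq_sym mulr_natr.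
  by move=> l ne; rewrite -val_eqE eq_sym /= in ne; rewrite (negbTE ne) mulr0 coef0.
rewrite (nth_default _ le_i) mul0rn big1 // => l _.
by rewrite (gtn_eqF (leq_trans (ltn_ord l) le_i)) mulr0 coef0.
Qed.

(** Multiplicativity of the torus action reads [Q(x) Q(y) = Q(x y)]; comparing coefficients, the
    coefficients of [Q] are pairwise orthogonal idempotents. *)
Lemma torus_idem D (Q : 'M[{poly k}]_N) :
  (forall (A : comNzRingType) (phi : {rmorphism k -> A}) (s t : A), s * t = 1 ->
    s ^+ D *: ract X phi (tmx s t) = map_mx (evalm phi s) Q) ->
  forall i, map_mx polyC (map_mx (coefp i) Q) *m Q
    = 'X^i *: map_mx polyC (map_mx (coefp i) Q).
Proof.
move=> HQ i.
pose R2 := {poly {poly k}}.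
pose psi : {rmorphism k -> R2} := polyC \o polyC.
have E : map_mx (evalm psi 'X) Q *m map_mx (evalm psi 'X%:P) Q
         = map_mx (evalm psi ('X * 'X%:P)) Q.
  (* Two independent invertible parameters are required; the identity holds in the fraction field
     and is pulled back along the injection of [R2]. *)
  pose F := {fraction R2}.
  pose tof : {rmorphism R2 -> F} := @tofrac R2.
  pose s : F := tof 'X; pose u : F := tof 'X%:P.
  have nz (a : R2) : a != 0 -> tof a * (tof a)^-1 = 1.
    by move=> ane; rewrite divff // tofrac_eq0.
  have sV : s * s^-1 = 1 by apply: nz; rewrite polyX_eq0.
  have uV : u * u^-1 = 1 by apply: nz; rewrite polyC_eq0 polyX_eq0.
  have suV : s * u * (s^-1 * u^-1) = 1 by rewrite mulrACA sV uV mulr1.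
  have := congr1 (fun M => (s * u) ^+ D *: M) (@ractM _ X _ (tof \o psi) (tmx s s^-1) (tmx u
    u^-1) (det_tmx sV) (det_tmx uV)).
  rewrite mx2M !(mulr0, mul0r, addr0, add0r) (HQ _ _ _ _ suV) exprMn -scalerA.
  rewrite scalemxAr scalemxAl (HQ _ _ _ _ sV) (HQ _ _ _ _ uV) => E.
  have tinj : injective tof by move=> x y /eqP; rewrite /tof tofrac_eq => /eqP.
  apply/matrixP=> a b; apply: tinj; move/matrixP/(_ a b): E; rewrite !mxE evalm_map rmorphM => ->.
  by rewrite rmorph_sum; apply: eq_bigr => l _; rewrite !mxE !rmorphM /= !evalm_map.
apply/matrixP=> a b; apply/polyP=> j.
move/matrixP/(_ a b): E => /(congr1 (fun q : R2 => (q`_i)`_j)).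
have evX (q : {poly k}) : evalm psi 'X q = map_poly polyC q.
  elim/poly_ind: q => [|q c IH]; first by rewrite !rmorph0.
  by rewrite !rmorphD !rmorphM /= IH evalmC evalmX map_polyX map_polyC.
have evC (q : {poly k}) : evalm psi 'X%:P q = q%:P.
  elim/poly_ind: q => [|q c IH]; first by rewrite !rmorph0.
  by rewrite !rmorphD !rmorphM /= IH evalmC evalmX.
rewrite !mxE evalm_coef2 !coef_sum => E.
rewrite coefMC coefXn mulrC [coefp i _]/= eq_sym mulr_natr -E; apply: eq_bigr => l _.
by rewrite !mxE evX evC coefMC coef_map /= !coefCM.
Qed.

(** The coefficient of index [i] projects onto weight [i - D]. *)
Lemma weight_projections m : exists D (Q : 'M[{poly k}]_N), [/\ (m <= D)%N,
  forall (A : comNzRingType) (phi : {rmorphism k -> A}) (s t : A), s * t = 1 ->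
    s ^+ D *: ract X phi (tmx s t) = map_mx (evalm phi s) Q &
  forall (A : comNzRingType) (phi : {rmorphism k -> A}) (s t : A) i, s * t = 1 ->
    s ^+ D *: (map_mx phi (map_mx (coefp i) Q) *m ract X phi (tmx s t))
      = s ^+ i *: map_mx phi (map_mx (coefp i) Q)].
Proof.
have [D [Q [mD HQ]]] := torus_poly m.
exists D, Q; split=> // A phi s t i st.
have Ephi (M : 'M[k]_N) : map_mx phi M = map_mx (evalm phi s) (map_mx polyC M).
  by apply/matrixP=> a b; rewrite !mxE evalmC.
rewrite scalemxAr HQ // !Ephi -map_mxM (torus_idem HQ).
by apply/matrixP=> a b; rewrite !mxE rmorphM rmorphXn /= evalmX.
Qed.
End Weights.

(** * Frobenius reciprocity and extensions *)

Section LowerCoefficients.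
Variables (k : fieldType).
Implicit Types X Y : sl2rep k.

(** The divided power [f^i / i!] of the lowering operator, which makes sense in every
    characteristic. *)
Definition lcoef X i : 'M[k]_(rdim X) := map_mx (coefp i) (lact X).

Lemma lcoefE X (A : comNzRingType) (phi : {rmorphism k -> A}) (a : A) D :
  (forall i j, (size (lact X i j) <= D)%N) ->
  ract X phi (lmx a) = \sum_(i < D) a ^+ i *: map_mx phi (lcoef X i).
Proof.
move=> HD; rewrite ract_l; apply/matrixP=> i j; rewrite summxE !mxE.
rewrite -[lact X i j in LHS](@coefK _) poly_def.
rewrite (_ : \sum_(l < size _) _ = \sum_(l < D) (lact X i j)`_l *: 'X^l).
  rewrite rmorph_sum; apply: eq_bigr => l _.
  by rewrite -mul_polyC rmorphM rmorphXn /= evalmC evalmX !mxE mulrC.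
rewrite -!poly_def; apply/polyP=> l; rewrite !coef_poly.
case: ltnP => h; first by rewrite (leq_trans h (HD _ _)).
by rewrite nth_default //; case: ifP.
Qed.

Lemma lcoef0 X : lcoef X 0 = 1%:M.
Proof.
have [D [_ sD]] := size_bound X 0; rewrite -(@ract1 _ X _ idfun).
have -> : 1%:M = lmx 0 :> 'M[k]_2 by rewrite mx2_1.
rewrite (lcoefE _ _ sD) big_ord_recl expr0 scale1r big1 ?addr0 => [|i _].
  by apply/matrixP=> a b; rewrite !mxE.
by rewrite /= expr0n scale0r.
Qed.

Lemma evalm_add_coef (q : {poly k}) i j :
  ((evalm (polyC \o polyC : {rmorphism k -> _}) ('X + 'X%:P) q)`_i)`_j
   = q`_(i + j) *+ 'C(i + j, i).
Proof.
rewrite -[q in LHS](@coefK _ q) poly_def rmorph_sum !coef_sum.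
have F l : ((evalm (polyC \o polyC : {rmorphism k -> _}) ('X + 'X%:P) (q`_l *: 'X^l))`_i)`_j
    = (q`_l *+ 'C(l, i)) *+ (l == i + j)%N.
  rewrite -mul_polyC rmorphM /= evalmC rmorphXn /= evalmX !coefCM -['X]scale1r coef_linX.
  rewrite expr1n mul1r coefMn coefXn mulrnAr mulr_natr.
  have [le_il|lt_li] := leqP i l; last by rewrite bin_small // !mulr0n mul0rn.
  rewrite [in RHS]mulrnAC; congr (_ *+ nat_of_bool _ *+ _).
  by apply/eqP/eqP => *; lia.
under eq_bigr => l _ do rewrite F.
have [lt_i|le_i] := ltnP (i + j) (size q).
  rewrite (bigD1 (Ordinal lt_i)) //= eqxx big1 ?addr0 // => l ne.
  by rewrite -val_eqE /= in ne; rewrite (negbTE ne) mulr0n.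
rewrite (nth_default _ le_i) mul0rn big1 // => l _.
by rewrite (ltn_eqF (leq_trans (ltn_ord l) le_i)) mulr0n.
Qed.

(** The product rule of divided powers is the expansion of [lmx X * lmx Y = lmx (X + Y)] in two
    variables. *)
Lemma lcoefM X i j : lcoef X i *m lcoef X j = lcoef X (i + j) *+ 'C(i + j, i).
Proof.
pose R2 := {poly {poly k}}; pose psi : {rmorphism k -> R2} := polyC \o polyC.
have := @ractM _ X _ psi (lmx 'X) (lmx 'X%:P) (det_lmx _) (det_lmx _).
have -> : lmx 'X *m lmx 'X%:P = lmx ('X + 'X%:P) :> 'M[R2]_2.
  by rewrite mx2M; congr mx2; ring.
rewrite !ract_l => E; apply/matrixP=> a b; move/matrixP/(_ a b): E.
move/(congr1 (fun q : R2 => (q`_i)`_j)); rewrite !mxE mulmxnE !mxE.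
rewrite evalm_add_coef => ->; rewrite !coef_sum; apply: eq_bigr => l _.
have evX (q : {poly k}) : evalm psi 'X q = map_poly polyC q.
  elim/poly_ind: q => [|q c IH]; first by rewrite !rmorph0.
  by rewrite !rmorphD !rmorphM /= IH evalmC evalmX map_polyX map_polyC.
have evC (q : {poly k}) : evalm psi 'X%:P q = q%:P.
  elim/poly_ind: q => [|q c IH]; first by rewrite !rmorph0.
  by rewrite !rmorphD !rmorphM /= IH evalmC evalmX.
by rewrite !mxE evX evC coefMC coef_map /= !coefCM.
Qed.

Lemma lcoef_comm X Y (M : 'M[k]_(rdim Y, rdim X)) :
  map_mx polyC M *m lact X = lact Y *m map_mx polyC M <->
  forall i, M *m lcoef X i = lcoef Y i *m M.
Proof.
have EL i a b : ((map_mx polyC M *m lact X) a b)`_i = (M *m lcoef X i) a b.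
  by rewrite !mxE coef_sum; apply: eq_bigr => l _; rewrite !mxE coefCM.
have ER i a b : ((lact Y *m map_mx polyC M) a b)`_i = (lcoef Y i *m M) a b.
  by rewrite !mxE coef_sum; apply: eq_bigr => l _; rewrite !mxE coefMC.
split=> [E i|E]; apply/matrixP=> a b; first by rewrite -EL -ER E.
by apply/polyP=> i; rewrite EL ER E.
Qed.

Lemma hom_lcoef X Y (f : hom X Y) i : f *m lcoef X i = lcoef Y i *m f.
Proof. by apply: (lcoef_comm f).1; rewrite hom_equiv // det_lmx. Qed.

Lemma dualWeyl_lcoef n i (a b : 'I_n.+1) :
  lcoef (dualWeyl k n) i a b = 'C(b, a)%:R *+ (b == a + i :> nat)%N.
Proof.
rewrite mxE [lact _ _ _]dualWeyl_l [coefp _ _]/= coefMn coefXn.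
have [le_ab|lt_ba] := leqP a b; last by rewrite bin_small ?mul0rn.
rewrite mulrnAC; congr (_ *+ nat_of_bool _); apply/eqP/eqP => ?; lia.
Qed.

Lemma dualWeyl_wact n (i j : 'I_n.+1) :
  wact (dualWeyl k n) i j = (-1) ^+ i *+ (i == rev_ord j).
Proof. exact: dualWeyl_w. Qed.

Lemma row_dualWeyl_wact n (i : 'I_n.+1) :
  row i (wact (dualWeyl k n)) = (-1) ^+ i *: delta_mx 0 (rev_ord i).
Proof.
apply/rowP=> j; rewrite mxE dualWeyl_wact !mxE -mulr_natr eqxx; congr (_ * (nat_of_bool _)%:R).
by apply/eqP/eqP => [->|->]; rewrite rev_ordK.
Qed.

Lemma row0_dualWeyl_lcoef n (i : 'I_n.+1) :
  row 0 (lcoef (dualWeyl k n) i) = delta_mx 0 i.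
Proof.
apply/rowP=> j; rewrite mxE dualWeyl_lcoef mxE bin0 -val_eqE /= add0n.
by [].
Qed.

(* A map into V_n is determined by its coefficient of [y^n], since [y^n] generates
   the dual of V_n under the lower unipotent group. *)
Lemma hom_row0 X n (f : hom X (dualWeyl k n)) :
  forall i : 'I_n.+1, row i f = row 0 f *m lcoef X i.
Proof.
move=> i; rewrite -row_mul (hom_lcoef f) row_mul row0_dualWeyl_lcoef.
by rewrite -rowE.
Qed.

Lemma hom_row0_inj X n (f g : hom X (dualWeyl k n)) :
  row 0 (hmx f) = row 0 (hmx g) -> hmx f = hmx g.
Proof.
by move=> E; apply/row_matrixP=> i; rewrite (hom_row0 f) (hom_row0 g) E.
Qed.
End LowerCoefficients.

Section Frobenius.
Variables (k : fieldType) (X : sl2rep k) (n : nat) (lam : 'rV[k]_(rdim X)).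
Variables (K : comNzRingType) (phi : {rmorphism k -> K}) (s t : K).
Hypothesis st : s * t = 1.
(* [s] is transcendental over k. *)
Hypothesis s_inj : injective (evalm phi s).
Hypothesis lam_u : map_mx phi lam *m ract X phi (umx (- s)) = map_mx phi lam.
Hypothesis lam_t :
  s ^+ n *: (map_mx phi lam *m ract X phi (tmx s t)) = map_mx phi lam.

Let lami i : 'rV[k]_(rdim X) := lam *m lcoef X i.
Let Lam : 'rV[{poly k}]_(rdim X) := map_mx polyC lam *m lact X.

Let LamE b i : (Lam 0 b)`_i = lami i 0 b.
Proof. by rewrite !mxE coef_sum; apply: eq_bigr => l _; rewrite !mxE coefCM. Qed.

Let map_lam (r : K) : map_mx phi lam *m ract X phi (lmx r) = map_mx (evalm phi r) Lam.
Proof.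
rewrite map_mxM -ract_l; congr (_ *m _).
by apply/matrixP=> i j; rewrite !mxE evalmC.
Qed.

(** In [lmx (- t) * wmx = umx (- s) * tmx s t * lmx s] the first two factors on the right are
    absorbed by the invariance and the weight of [lam]. *)
Let lam_rel : s ^+ n *: (map_mx (evalm phi (- t)) Lam *m map_mx phi (wact X))
  = map_mx (evalm phi s) Lam.
Proof.
rewrite -!map_lam -ract_w -mulmxA -ractM ?det_wmx ?det_lmx //.
have -> : lmx (- t) *m wmx = umx (- s) *m tmx s t *m lmx s.
  rewrite !mx2M; congr mx2.
  - by transitivity (s * (1 - s * t)); [rewrite st|]; ring.
  - by transitivity (- (s * t)); [rewrite st|]; ring.
  - by transitivity (s * t); [rewrite st|]; ring.
  - by ring.
rewrite !ractM ?det_mulmx ?det_umx ?det_lmx ?(det_tmx st) ?mulr1 //.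
by rewrite !mulmxA lam_u scalemxAl lam_t.
Qed.

(** Since [s] is transcendental, [lam_rel] can be compared coefficientwise. Its left side involves
    no power of [s] above [n], which makes the rows beyond [n] vanish; the others are exchanged by
    [wmx]. *)
Let lami_rel i b : lami i 0 b
  = if (i <= n)%N then (-1) ^+ (n - i) * (lami (n - i) *m wact X) 0 b else 0.
Proof.
have [D [nD sD]] := size_bound X n.
have sL c : (size (Lam 0%R c) <= D.+1)%N.
  apply/leq_sizeP=> j Dj; rewrite LamE mxE big1 // => l _.
  by rewrite !mxE [coefp _ _]/= (nth_default _ (leq_trans (sD l c) Dj)) mulr0.
pose rev (q : {poly k}) : {poly k} := \poly_(i < D.+1) ((-1) ^+ (D - i) * q`_(D - i)).
have E : 'X^n * (\sum_c rev (Lam 0 c) * (wact X c b)%:P) = 'X^D * Lam 0 b.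
  have mapL r c : map_mx (evalm phi r) Lam 0 c = evalm phi r (Lam 0 c) by rewrite mxE.
  apply: s_inj; rewrite !rmorphM /= !rmorphXn /= evalmX -mapL -lam_rel.
  rewrite [in RHS]mxE [in RHS]mxE [RHS]mulrCA; congr (_ * _).
  rewrite rmorph_sum mulr_sumr; apply: eq_bigr => c _.
  by rewrite mapL mulrA (evalm_rev _ st) // rmorphM /= evalmC [map_mx phi _ _ _]mxE.
(* Degree [D + i] selects [lami i] on the right and, through the reversal, [lami (n - i)] on the
   left. *)
have /(congr1 (fun q : {poly k} => q`_(D + i))) := E.
rewrite !coefXnM (_ : (D + i < n)%N = false); last by apply/negbTE; lia.
rewrite (_ : (D + i < D)%N = false) ?addKn ?LamE; last by apply/negbTE; lia.
move=> <-; rewrite coef_sum; case: leqP => le_in.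
  rewrite mxE mulr_sumr; apply: eq_bigr => c _; rewrite coefMC coef_poly.
  rewrite (_ : (_ < _)%N); last by lia.
  by rewrite (_ : (D - (D + i - n) = n - i)%N) ?LamE ?mulrA //; lia.
rewrite big1 // => c _; rewrite coefMC coef_poly (_ : (_ < _)%N = false) ?mul0r //.
by apply/negbTE; lia.
Qed.

(** By [hom_row0] the rows can only be the [lami i]. The relation [lami_rel] gives compatibility
    with [wmx]; with the product rule of divided powers, its vanishing part gives compatibility with
    the unipotent. *)
Lemma frobenius_reciprocity : exists M : hom X (dualWeyl k n), row 0 M = lam.
Proof.
pose M : 'M[k]_(n.+1, rdim X) := \matrix_(i < n.+1) lami i.
have Mi (i : 'I_n.+1) : row i M = lami i by rewrite rowK.
have Mw : M *m wact X = wact (dualWeyl k n) *m M.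
  apply/row_matrixP=> i; rewrite !row_mul Mi row_dualWeyl_wact -scalemxAl -rowE Mi.
  apply/rowP=> b; have le_in : (i <= n)%N by rewrite -ltnS.
  rewrite [RHS]mxE /= subSS lami_rel leq_subr subKn // mulrA -exprMn mulrNN mulr1.
  by rewrite expr1n mul1r.
have Ml : map_mx polyC M *m lact X = lact (dualWeyl k n) *m map_mx polyC M.
  apply/(lcoef_comm (Y := dualWeyl k n)) => j; apply/row_matrixP=> i; rewrite !row_mul Mi.
  rewrite -mulmxA lcoefM -scaler_nat -scalemxAr -/(lami _).
  have [le_n|lt_n] := leqP (i + j) n.
    pose l : 'I_n.+1 := Ordinal (n:=n.+1) (m:=i + j) le_n.
    have -> : row i (lcoef (dualWeyl k n) j) = 'C(i + j, i)%:R *: delta_mx 0 l.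
      apply/rowP=> c; rewrite mxE dualWeyl_lcoef !mxE /= -val_eqE /=.
      by have [->|_] := eqVneq; rewrite ?mulr1 // mulr0.
    by rewrite -scalemxAl -rowE Mi.
  have -> : row i (lcoef (dualWeyl k n) j) = 0.
    apply/rowP=> c; rewrite mxE dualWeyl_lcoef mxE (_ : (_ == _) = false) //.
    apply/negbTE/eqP => E; have : (c < n.+1)%N := ltn_ord c.
    by rewrite E ltnS leqNgt lt_n.
  rewrite mul0mx; apply/rowP=> b; rewrite mxE lami_rel leqNgt lt_n /= mulr0.
  by rewrite mxE.
by exists (@hom_of_gen k X (dualWeyl k n) M Mw Ml); rewrite /= Mi /lami /= lcoef0 mulmx1.
Qed.
End Frobenius.

(** * Ext^1 from Weyl to dual Weyl modules *)

Section Cocycles.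
Variable k : fieldType.
Implicit Types X Y Z : sl2rep k.

Definition cochain X Y :=
  forall A : comNzRingType, {rmorphism k -> A} -> 'M[A]_2 -> 'M[A]_(rdim Y, rdim X).

Definition cocycle X Y (c : cochain X Y) : Prop :=
  (forall (A : comNzRingType) (phi : {rmorphism k -> A}) (g h : 'M[A]_2),
     \det g = 1 -> \det h = 1 ->
     c A phi (g *m h) = c A phi g *m ract X phi h + ract Y phi g *m c A phi h) /\
  (forall (A B : comNzRingType) (phi : {rmorphism k -> A})
      (psi : {rmorphism k -> B}) (e : {rmorphism A -> B}) (g : 'M[A]_2),
    (forall x, e (phi x) = psi x) -> \det g = 1 ->
    c B psi (map_mx e g) = map_mx e (c A phi g)).

Definition coboundary X Y (c : cochain X Y) : Prop :=
  exists D : 'M[k]_(rdim Y, rdim X),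
    forall (A : comNzRingType) (phi : {rmorphism k -> A}) (g : 'M[A]_2), \det g = 1 ->
      c A phi g = ract Y phi g *m map_mx phi D - map_mx phi D *m ract X phi g.

(* Ext^1(X, Y) = 0, phrased with cocycles on the group functor. *)
Definition ext0 X Y : Prop := forall c : cochain X Y, cocycle c -> coboundary c.

Section ExtensionRep.
Variables (X Y : sl2rep k) (c : cochain X Y).
Hypothesis Hc : cocycle c.

(** The extension with submodule [Y] and quotient [X] attached to the cocycle. *)
Definition ext_act (A : comNzRingType) (phi : {rmorphism k -> A}) (g : 'M[A]_2) :=
  block_mx (ract Y phi g) (c phi g) 0 (ract X phi g).

Lemma cocycle1 (A : comNzRingType) (phi : {rmorphism k -> A}) : c phi 1%:M = 0.
Proof.
have := Hc.1 A phi 1%:M 1%:M (det1 _ _) (det1 _ _).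
by rewrite !mulmx1 !ract1 mulmx1 mul1mx => /(congr1 (fun M => M - c phi 1%:M)); rewrite subrr addrK.
Qed.

Lemma ext_act1 (A : comNzRingType) (phi : {rmorphism k -> A}) : ext_act phi 1%:M = 1%:M.
Proof. by rewrite /ext_act !ract1 cocycle1 -scalar_mx_block. Qed.

Lemma ext_actM (A : comNzRingType) (phi : {rmorphism k -> A}) (g h : 'M[A]_2) :
  \det g = 1 -> \det h = 1 -> ext_act phi (g *m h) = ext_act phi g *m ext_act phi h.
Proof.
move=> dg dh; rewrite /ext_act mulmx_block !ractM // Hc.1 //.
by rewrite !(mulmx0, mul0mx, addr0, add0r) [X in block_mx _ X]addrC.
Qed.

Lemma ext_act_nat (A B : comNzRingType) (phi : {rmorphism k -> A})
    (psi : {rmorphism k -> B}) (e : {rmorphism A -> B}) (g : 'M[A]_2) :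
  (forall x, e (phi x) = psi x) -> \det g = 1 ->
  ext_act psi (map_mx e g) = map_mx e (ext_act phi g).
Proof. by move=> He dg; rewrite /ext_act map_block_mx !(ract_nat _ He dg) (Hc.2 _ _ _ _ _ _ He
  dg) map_mx0. Qed.

Definition ext_rep : sl2rep k := Sl2Rep ext_act1 ext_actM ext_act_nat.
End ExtensionRep.
End Cocycles.

(** A torus parameter in [k(X)]: an identity between polynomials over [k] at this parameter is an
    identity of polynomials, even for finite [k]. *)
Lemma transcendental_unit (k : fieldType) :
  exists (K : comNzRingType) (phi : {rmorphism k -> K}) (s t : K),
    s * t = 1 /\ injective (evalm phi s).
Proof.
pose K : comNzRingType := {fraction {poly k}}.
pose tof : {rmorphism {poly k} -> K} := @tofrac {poly k}.
exists K, (tof \o polyC), (tof 'X), ((tof 'X)^-1 : {fraction {poly k}}); split.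
  by rewrite [LHS]divff // tofrac_eq0 polyX_eq0.
move=> p q; have E r : evalm (tof \o polyC) (tof 'X) r = tof r.
  by rewrite -evalm_map; congr (tof _); elim/poly_ind: r => [|r x IH];
    rewrite ?rmorph0 // rmorphD rmorphM /= IH evalmC evalmX.
by rewrite !E => /eqP; rewrite /tof tofrac_eq => /eqP.
Qed.

Lemma ract_u (k : fieldType) (X : sl2rep k) (A : comNzRingType) (phi : {rmorphism k -> A}) a :
  ract X phi (umx a) = map_mx (evalm phi a) (ract X polyC (umx 'X)).
Proof.
rewrite -(@ract_nat _ X _ _ polyC phi (evalm phi a)) ?det_umx //.
  by rewrite map_mx2 evalmX rmorph0 rmorph1.
by move=> x; rewrite evalmC.
Qed.

Lemma evalm_const (k : fieldType) (A : comNzRingType) (phi : {rmorphism k -> A}) x (p : {poly k}) :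
  evalm phi (phi x) p = phi p.[x].
Proof.
elim/poly_ind: p => [|r y IH]; first by rewrite horner0 !rmorph0.
by rewrite hornerMXaddC !rmorphD !rmorphM /= IH evalmC evalmX.
Qed.

Section ExtVanishing.
Variables (k : fieldType) (n j : nat).
Hypothesis le_jn : (j <= n)%N.
Notation V := (dualWeyl k n).
Notation D_ := (dual (dualWeyl k j)).
Variable c : cochain D_ V.
Hypothesis Hc : cocycle c.
Let E := ext_rep Hc.

Let mu0 : 'rV[k]_(n.+1 + j.+1) := row_mx (delta_mx 0 0) 0.

Lemma dual_dualWeyl_t (A : comNzRingType) (phi : {rmorphism k -> A}) (s t : A) (a b : 'I_j.+1) :
  ract D_ phi (tmx s t) a b = t ^+ a * s ^+ (j - a) *+ (a == b).
Proof.
rewrite /= /dual_act adj_mx2 oppr0 mxE [LHS]dualWeyl_t eq_sym.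
by have [->|] := eqVneq.
Qed.

Let row0_t (A : comNzRingType) (phi : {rmorphism k -> A}) (s t : A) :
  (delta_mx 0 0 : 'rV_n.+1) *m ract V phi (tmx s t) = t ^+ n *: delta_mx 0 0.
Proof.
rewrite -rowE; apply/rowP=> b; rewrite mxE dualWeyl_t !mxE /= expr0 mul1r subn0 eq_sym.
by rewrite -mulr_natr.
Qed.

Let row0_u (A : comNzRingType) (phi : {rmorphism k -> A}) (a : A) :
  (delta_mx 0 0 : 'rV_n.+1) *m ract V phi (umx a) = delta_mx 0 0.
Proof.
rewrite -rowE; apply/rowP=> b; rewrite mxE dualWeyl_u !mxE /= eq_sym sub0n bin0 expr0 mulr1n.
by rewrite -val_eqE /= lt0n eq_sym; case: (_ == _).
Qed.

(** The coefficient of [y^n] extends from [V] to [E] by a weight projection. Its defect under [umx]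
    is a row [x] of polynomials on [D_], and the torus forces [X^(n + j - l) x_l(X^2) = X^l x_l(1)].
    Together with [x_l(0) = 0] and [l <= j <= n] this gives [x_l = 0]. *)
Lemma extremal_functional (K : comNzRingType) (phi : {rmorphism k -> K}) (s t : K) :
  s * t = 1 -> injective (evalm phi s) ->
  exists d : 'rV[k]_j.+1, let lam : 'rV[k]_(rdim E) := row_mx (delta_mx 0 0) d in
    map_mx phi lam *m ract E phi (umx (- s)) = map_mx phi lam /\
    s ^+ n *: (map_mx phi lam *m ract E phi (tmx s t)) = map_mx phi lam.
Proof.
move=> st inj; have [D [Q [nD HQ HP]]] := weight_projections E n.
(* Index [D - n] stands for weight [- n], that of the coefficient of [y^n]. *)
pose lam : 'rV[k]_(rdim E) := (mu0 : 'rV_(rdim E)) *m map_mx (coefp (D - n)) Q.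
have st' i : s ^+ i * t ^+ i = 1 by rewrite -exprMn st expr1n.
have lamE : lam = row_mx (delta_mx 0 0) (rsubmx (lam : 'rV_(n.+1 + j.+1))).
  rewrite -[LHS]hsubmxK; congr row_mx; apply/rowP=> b.
  have E1 : ((map_mx polyC mu0 : 'rV_(rdim E)) *m Q) 0 (lshift j.+1 b) = 'X^(D - n) * ((b ==
    0)%:R)%:P.
    apply: inj; transitivity ((map_mx phi mu0 *m map_mx (evalm phi s) Q) 0 (lshift j.+1 b)).
      rewrite !mxE rmorph_sum; apply: eq_bigr => l _.
      by rewrite !mxE rmorphM /= evalmC.
    rewrite -(HQ _ _ _ _ st) -scalemxAr /= /ext_act map_row_mx.
    rewrite mul_row_block map_delta_mx map_mx0 !mul0mx !addr0.
    rewrite mxE row_mxEl row0_t !mxE /= rmorphM rmorphXn /= evalmX evalmC rmorph_nat.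
    by rewrite mulrA -{1}(subnK nD) exprD -[_ * t ^+ n]mulrA st' mulr1.
  move/(congr1 (fun q : {poly k} => q`_(D - n))): E1.
  rewrite coefMC coefXn eqxx mul1r !mxE /= => <-.
  rewrite coef_sum; apply: eq_bigr => l _; by rewrite !mxE coefCM.
have lam_t : s ^+ n *: (map_mx phi lam *m ract E phi (tmx s t)) = map_mx phi lam.
  have := HP K phi s t (D - n)%N st => /(congr1 (fun M => t ^+ (D - n) *: (map_mx phi (mu0 :
    'rV_(rdim E)) *m M))).
  rewrite -!scalemxAr !scalerA mulmxA -map_mxM -/lam mulrC -{1}(subnK nD) exprD.
  by rewrite mulrAC st' mul1r mulrC st' scale1r.
exists (rsubmx (lam : 'rV_(n.+1 + j.+1))); rewrite /= -lamE; split=> //.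
pose q : 'rV[{poly k}]_(rdim E) := map_mx polyC lam *m ract E polyC (umx 'X) - map_mx polyC lam.
have qE (r : K) : map_mx (evalm phi r) q = map_mx phi lam *m ract E phi (umx r) - map_mx phi lam.
  have lamr : map_mx (evalm phi r) (map_mx polyC lam) = map_mx phi lam.
    by apply/rowP=> l; rewrite !mxE evalmC.
  by rewrite map_mxB map_mxM lamr -ract_u.
pose x : 'rV[{poly k}]_j.+1 := rsubmx (q : 'rV_(n.+1 + j.+1)).
have qx : q = row_mx 0 x.
  rewrite -[LHS](@hsubmxK _ _ n.+1 j.+1); congr row_mx.
  rewrite /q lamE map_row_mx mul_row_block !mulmx0 addr0 opp_row_mx add_row_mx row_mxKl.
  by rewrite map_delta_mx row0_u subrr.
have dtst : \det (tmx s t) = 1 by rewrite det_tmx.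
have rel : s ^+ n *: (map_mx (evalm phi (s ^+ 2)) q *m ract E phi (tmx s t)) = map_mx (evalm phi
  1) q.
  rewrite !qE mulmxBl scalerBr lam_t -mulmxA -ractM ?det_umx //.
  have -> : umx (s ^+ 2) *m tmx s t = tmx s t *m umx 1.
    by rewrite !mx2M; congr mx2; rewrite ?expr2; [ring|transitivity (s * (s * t));
      [ring|rewrite st; ring]|ring|ring].
  by rewrite ractM ?det_umx // mulmxA scalemxAl lam_t.
have xl l : x 0 l = 0.
  have xrel : 'X^(n + (j - l)) * evalm polyC ('X ^+ 2) (x 0 l) = 'X^l * (x 0 l).[1]%:P.
    apply: inj; rewrite !rmorphM /= !rmorphXn /= evalm_comp rmorphXn /= evalmX evalmC.
    rewrite -(evalm_const phi 1) rmorph1.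
    move/rowP/(_ (rshift n.+1 l)): rel.
    rewrite qx !map_row_mx [map_mx _ 0]map_mx0 mul_row_block mul0mx !mulmx0 mul0mx !addr0 add0r.
    rewrite mxE !row_mxEr [RHS]mxE mxE (bigD1 l) //= big1 ?addr0; last first.
      by move=> b nb; rewrite dual_dualWeyl_t (negbTE nb) mulr0.
    rewrite dual_dualWeyl_t eqxx mulr1n mxE exprD => <-.
    by transitivity (s ^+ n * s ^+ (j - l) * evalm phi (s ^+ 2) (x 0 l) * (s ^+ l * t ^+ l));
      [rewrite st' mulr1 | ring].
  have comp2 (p : {poly k}) : evalm polyC ('X ^+ 2) p = p \Po 'X^2 by [].
  have c1 : (x 0 l).[1] = 0.
    have p0 : (x 0 l).[0] = 0.
      apply: (fmorph_inj phi); rewrite rmorph0 -evalm_const rmorph0.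
      have := qE 0; rewrite (_ : umx 0 = 1%:M) ?mx2_1 // -mx2_1 ract1 mulmx1 subrr qx map_row_mx.
      by move/rowP/(_ (rshift n.+1 l)); rewrite row_mxEr !mxE.
    have le_l : (l <= n + (j - l))%N by rewrite (leq_trans _ (leq_addr _ _)) // (leq_trans _
      le_jn) // -ltnS.
    move: xrel; rewrite -{1}(subnKC le_l) exprD -mulrA.
    move/(mulfI (expf_neq0 _ (negbT (polyX_eq0 k))))/(congr1 (horner^~ 0)).
    by rewrite hornerM comp2 horner_comp ['X^2.[0]]hornerXn expr2 mul0r p0 mulr0 hornerC.
  move: xrel; rewrite c1 mulr0 comp2 => /eqP; rewrite mulf_eq0 expf_eq0 polyX_eq0 andbF /=.
  rewrite comp_poly_eq0 ?size_polyXn // => /eqP.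
  by [].
have q0 : q = 0.
  have x0 : x = 0 by apply/rowP=> l; rewrite xl mxE.
  by rewrite qx x0 row_mx0.
by apply/eqP; rewrite -subr_eq0 -qE q0 map_mx0.
Qed.

(** Frobenius reciprocity turns the extremal functional into a map [E -> V]. On the submodule [V] it
    has the row 0 of the identity, hence is the identity, and the extension splits; the other block
    [M2] trivialises [c]. *)
Lemma ext0_dualWeyl_le : coboundary c.
Proof.
have [K [phi [s [t [st inj]]]]] := transcendental_unit k.
have [d [/= lam_u lam_t]] := extremal_functional st inj.
have [M M0] := frobenius_reciprocity st inj (lam_u : map_mx phi (_ : 'rV_(rdim E)) *m ract E phi
  _ = _) lam_t.
pose M1 : 'M[k]_n.+1 := lsubmx (hmx M : 'M_(n.+1, n.+1 + j.+1)).
pose M2 : 'M[k]_(n.+1, j.+1) := rsubmx (hmx M : 'M_(n.+1, n.+1 + j.+1)).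
have ME : hmx M = row_mx M1 M2 by rewrite hsubmxK.
have EM (A : comNzRingType) (psi : {rmorphism k -> A}) (g : 'M[A]_2) (dg : \det g = 1) : row_mx
  (map_mx psi M1 *m ract V psi g) (map_mx psi M1 *m c psi g + map_mx psi M2 *m ract D_ psi g)
   = row_mx (ract V psi g *m map_mx psi M1) (ract V psi g *m map_mx psi M2).
  rewrite -mul_mx_row -map_row_mx -ME -(@hom_equiv _ _ _ M A psi g dg) ME map_row_mx.
  by rewrite /= /ext_act mul_row_block mulmx0 addr0.
have h1 : forall (A : comNzRingType) (psi : {rmorphism k -> A}) (g : 'M[A]_2), \det g = 1 ->
    map_mx psi M1 *m ract V psi g = ract V psi g *m map_mx psi M1.
  by move=> A psi g dg; have /eq_row_mx[] := EM A psi g dg.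
have M1E : M1 = 1%:M.
  apply: (hom_row0_inj (f := @Hom k V V M1 h1) (g := hom_id V)) => /=.
  rewrite row1; apply/rowP=> b.
  by move/rowP/(_ (lshift j.+1 b)): M0; rewrite row_mxEl !mxE.
exists M2 => A psi g dg; have /eq_row_mx[_] := EM A psi g dg.
by rewrite M1E map_mx1 mul1mx => <-; rewrite addrK.
Qed.
End ExtVanishing.

Lemma adj2K (A : comNzRingType) (g : 'M[A]_2) : \adj (\adj g) = g.
Proof. by rewrite [g]mx2_eta !adj_mx2 !opprK. Qed.

(** Transposing cocycles exchanges the roles of [j] and [n], which reduces everything to
    [j <= n]. *)
Lemma ext0_dualWeyl (k : fieldType) (n j : nat) : ext0 (dual (dualWeyl k j)) (dualWeyl k n).
Proof.
move=> c Hc; have [le_jn|/ltnW le_nj] := leqP j n; first exact: ext0_dualWeyl_le le_jn _ Hc.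
pose c' : cochain (dual (dualWeyl k n)) (dualWeyl k j) :=
  fun A phi g => (c A phi (\adj g))^T.
have Hc' : cocycle c'.
  split=> [A phi g h dg dh|A B phi psi e g He dg].
    rewrite /c' adjM1 // Hc.1 ?det_adj1 // linearD /= !trmx_mul addrC; congr (_ + _).
    by rewrite /= /dual_act trmxK adj2K.
  by rewrite /c' -map_mx_adj (Hc.2 _ _ _ _ _ _ He) ?det_adj1 // map_trmx.
have [D HD] := ext0_dualWeyl_le le_nj Hc'.
exists (- D^T) => A phi g dg; have := HD A phi (\adj g) (det_adj1 dg).
rewrite /c' adj2K => /(congr1 trmx); rewrite trmxK => ->.
rewrite linearB /= !trmx_mul /dual_act adj2K trmxK map_mxN mulmxN mulNmx opprK addrC.
by rewrite -map_trmx.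
Qed.

(** * Exact sequences and lifting of homomorphisms *)

Section ExtClosure.
Variable k : fieldType.
Implicit Types X Y Z : sl2rep k.

(** The splittings [r] and [s] are linear, not equivariant; they turn diagram chases with cocycles
    into matrix identities. *)
Definition split_exact X Y Z (i : hom X Y) (q : hom Y Z)
    (r : 'M_(rdim X, rdim Y)) (s : 'M_(rdim Y, rdim Z)) : Prop :=
  [/\ q *m i = 0, r *m i = 1%:M, q *m s = 1%:M & i *m r + s *m q = 1%:M].

Lemma short_exact_split X Y Z (i : hom X Y) (q : hom Y Z) :
  short_exact i q -> exists r s, split_exact i q r s.
Proof.
case=> /row_fullP[B Bi] /row_freeP[s qs] /andP[ik ki].
have qi : q *m i = 0.
  by apply: trmx_inj; rewrite trmx_mul trmx0; apply/sub_kermxP.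
have /submxP[R RE] : ((1%:M - s *m q)^T <= i^T)%MS.
  apply: submx_trans ki; apply/sub_kermxP.
  by rewrite -trmx_mul mulmxBr mulmx1 mulmxA qs mul1mx subrr trmx0.
have irE : i *m R^T = 1%:M - s *m q.
  by apply: trmx_inj; rewrite trmx_mul trmxK RE.
exists R^T, s; split=> //; last by rewrite irE subrK.
by rewrite -[LHS]mul1mx -Bi -mulmxA [i *m _]mulmxA irE mulmxBl mul1mx -mulmxA qi mulmx0 subr0.
Qed.

Lemma split_exact_map X Y Z (i : hom X Y) (q : hom Y Z) r s
    (A : comNzRingType) (phi : {rmorphism k -> A}) :
  split_exact i q r s ->
  [/\ map_mx phi q *m map_mx phi i = 0, map_mx phi r *m map_mx phi i = 1%:M,
      map_mx phi q *m map_mx phi s = 1%:M &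
      map_mx phi i *m map_mx phi r + map_mx phi s *m map_mx phi q = 1%:M].
Proof.
by case=> a b c d; rewrite -!map_mxM -map_mxD a b c d map_mx0 !map_mx1.
Qed.

Lemma cocycle_coboundary X Y (D : 'M[k]_(rdim Y, rdim X)) :
  cocycle (fun A phi g => ract Y phi g *m map_mx phi D - map_mx phi D *m ract X phi g
           : 'M[A]_(rdim Y, rdim X)).
Proof.
split=> [A phi g h dg dh|A B phi psi e g He dg].
  by rewrite !ractM // mulmxBl mulmxBr !mulmxA [RHS]addrC addrA subrK.
rewrite map_mxB !map_mxM !(ract_nat _ He dg).
have -> // : map_mx psi D = map_mx e (map_mx phi D).
by apply/matrixP=> a b; rewrite !mxE He.
Qed.

Lemma cocycleB X Y (c c' : cochain X Y) : cocycle c -> cocycle c' ->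
  cocycle (fun A phi g => c A phi g - c' A phi g : 'M[A]_(rdim Y, rdim X)).
Proof.
move=> [cM cN] [cM' cN']; split=> [A phi g h dg dh|A B phi psi e g He dg].
  by rewrite cM // cM' // mulmxBl mulmxBr opprD addrACA.
by rewrite (cN _ _ _ _ _ _ He dg) (cN' _ _ _ _ _ _ He dg) map_mxB.
Qed.

Lemma map_mx_nat (A B : comNzRingType) (phi : {rmorphism k -> A})
    (psi : {rmorphism k -> B}) (e : {rmorphism A -> B}) m n (M : 'M[k]_(m, n)) :
  (forall x, e (phi x) = psi x) -> map_mx psi M = map_mx e (map_mx phi M).
Proof. by move=> He; apply/matrixP=> a b; rewrite !mxE He. Qed.

Lemma cocycle_post X Y Z (c : cochain X Y) (q : hom Y Z) : cocycle c ->
  cocycle (fun A phi g => map_mx phi q *m c A phi g : 'M[A]_(rdim Z, rdim X)).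
Proof.
move=> [cM cN]; split=> [A phi g h dg dh|A B phi psi e g He dg].
  by rewrite cM // mulmxDr !mulmxA hom_equiv.
by rewrite (cN _ _ _ _ _ _ He dg) map_mxM (map_mx_nat _ He).
Qed.

Lemma cocycle_pre X Y Z (c : cochain Y Z) (i : hom X Y) : cocycle c ->
  cocycle (fun A phi g => c A phi g *m map_mx phi i : 'M[A]_(rdim Z, rdim X)).
Proof.
move=> [cM cN]; split=> [A phi g h dg dh|A B phi psi e g He dg].
  by rewrite cM // mulmxDl -!mulmxA hom_equiv.
by rewrite (cN _ _ _ _ _ _ He dg) map_mxM (map_mx_nat _ He).
Qed.

Lemma cocycle_lift_post X Y Z (c : cochain X Z) (i : hom Y Z)
    (r : 'M_(rdim Y, rdim Z)) : r *m i = 1%:M -> cocycle c ->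
  (forall (A : comNzRingType) (phi : {rmorphism k -> A}) (g : 'M[A]_2), \det g = 1 ->
    map_mx phi i *m (map_mx phi r *m c A phi g) = c A phi g) ->
  cocycle (fun A phi g => map_mx phi r *m c A phi g : 'M[A]_(rdim Y, rdim X)).
Proof.
move=> ri [cM cN] ic; split=> [A phi g h dg dh|A B phi psi e g He dg].
  rewrite cM // mulmxDr !mulmxA; congr (_ + _).
  rewrite -[in LHS](ic A phi h dh) !mulmxA -[_ *m ract Z phi g *m map_mx phi i]mulmxA.
  by rewrite -hom_equiv // !mulmxA -map_mxM ri map_mx1 mul1mx.
by rewrite (cN _ _ _ _ _ _ He dg) map_mxM (map_mx_nat _ He).
Qed.

Lemma cocycle_lift_pre X Y Z (c : cochain X Z) (q : hom X Y)
    (s : 'M_(rdim X, rdim Y)) : q *m s = 1%:M -> cocycle c ->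
  (forall (A : comNzRingType) (phi : {rmorphism k -> A}) (g : 'M[A]_2), \det g = 1 ->
    c A phi g *m map_mx phi s *m map_mx phi q = c A phi g) ->
  cocycle (fun A phi g => c A phi g *m map_mx phi s : 'M[A]_(rdim Z, rdim Y)).
Proof.
move=> qs [cM cN] cq; split=> [A phi g h dg dh|A B phi psi e g He dg].
  rewrite cM // mulmxDl -!mulmxA; congr (_ + _).
  rewrite -[in LHS](cq A phi g dg) -!mulmxA [map_mx phi q *m (_ *m _)]mulmxA.
  by rewrite hom_equiv // -!mulmxA -map_mxM qs map_mx1 mulmx1.
by rewrite (cN _ _ _ _ _ _ He dg) map_mxM (map_mx_nat _ He).
Qed.

(** The image of the cocycle in [Y2] is a coboundary; subtracting the coboundary of a lift through
    [s] leaves a cocycle with values in [Y1]. *)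
Lemma ext0_extr X Y1 Y Y2 (i : hom Y1 Y) (q : hom Y Y2) r s :
  split_exact i q r s -> ext0 X Y1 -> ext0 X Y2 -> ext0 X Y.
Proof.
move=> se e1 e2 c Hc; have [D2 HD2] := e2 _ (cocycle_post q Hc).
have [_ ri _ _] := se.
pose c1 : cochain X Y := fun A phi g =>
  c A phi g - (ract Y phi g *m map_mx phi (s *m D2) - map_mx phi (s *m D2) *m ract X phi g).
have Hc1 : cocycle c1 := cocycleB Hc (cocycle_coboundary (s *m D2)).
have ic1 (A : comNzRingType) (phi : {rmorphism k -> A}) (g : 'M[A]_2) : \det g = 1 ->
    map_mx phi i *m (map_mx phi r *m c1 A phi g) = c1 A phi g.
  move=> dg; have [qi' _ qs' e1'] := split_exact_map phi se.
  have qc1 : map_mx phi q *m c1 A phi g = 0.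
    rewrite /c1 mulmxBr HD2 // mulmxBr !map_mxM !mulmxA hom_equiv //.
    by rewrite -[ract Y2 _ _ *m _ *m _]mulmxA qs' mulmx1 mul1mx subrr.
  by rewrite -[RHS]mul1mx -e1' mulmxDl -!mulmxA qc1 mulmx0 addr0.
have [D1 HD1] := e1 _ (cocycle_lift_post ri Hc1 ic1).
exists (s *m D2 + i *m D1) => A phi g dg.
have := ic1 A phi g dg; rewrite HD1 // /c1 => /eqP; rewrite eq_sym subr_eq => /eqP ->.
rewrite mulmxBr map_mxD [in RHS]mulmxDr [in RHS]mulmxDl [in RHS]opprD [RHS]addrACA [LHS]addrC;
  congr (_ + _).
by rewrite [map_mx phi (i *m D1)]map_mxM !mulmxA hom_equiv.
Qed.

Lemma ext0_extl X1 X X2 Y (i : hom X1 X) (q : hom X X2) r s :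
  split_exact i q r s -> ext0 X1 Y -> ext0 X2 Y -> ext0 X Y.
Proof.
move=> se e1 e2 c Hc; have [D1 HD1] := e1 _ (cocycle_pre i Hc).
have [_ ri qs _] := se.
pose c1 : cochain X Y := fun A phi g =>
  c A phi g - (ract Y phi g *m map_mx phi (D1 *m r) - map_mx phi (D1 *m r) *m ract X phi g).
have Hc1 : cocycle c1 := cocycleB Hc (cocycle_coboundary (D1 *m r)).
have ic1 (A : comNzRingType) (phi : {rmorphism k -> A}) (g : 'M[A]_2) : \det g = 1 ->
    c1 A phi g *m map_mx phi s *m map_mx phi q = c1 A phi g.
  move=> dg; have [qi' ri' qs' e1'] := split_exact_map phi se.
  have c1i : c1 A phi g *m map_mx phi i = 0.
    rewrite /c1 mulmxBl HD1 // mulmxBl !map_mxM -!mulmxA -hom_equiv //.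
    by rewrite [map_mx phi r *m (_ *m _)]mulmxA ri' mul1mx mulmx1 subrr.
  by rewrite -[RHS]mulmx1 -e1' mulmxDr !mulmxA c1i mul0mx add0r.
have [D2 HD2] := e2 _ (cocycle_lift_pre qs Hc1 ic1).
exists (D1 *m r + D2 *m q) => A phi g dg.
have := ic1 A phi g dg; rewrite HD2 // /c1 => /eqP; rewrite eq_sym subr_eq => /eqP ->.
rewrite mulmxBl map_mxD [in RHS]mulmxDr [in RHS]mulmxDl [in RHS]opprD [RHS]addrACA [LHS]addrC;
  congr (_ + _).
by rewrite [map_mx phi (D2 *m q)]map_mxM -!mulmxA hom_equiv.
Qed.

Lemma ext0_retract X X' Y (a : hom X X') (b : hom X' X) :
  b *m a = 1%:M -> ext0 X' Y -> ext0 X Y.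
Proof.
move=> ba e c Hc; have [D HD] := e _ (cocycle_pre b Hc).
exists (D *m a) => A phi g dg; have ba' : map_mx phi b *m map_mx phi a = 1%:M.
  by rewrite -map_mxM ba map_mx1.
rewrite -[LHS]mulmx1 -ba' mulmxA HD // mulmxBl map_mxM -!mulmxA; congr (_ - _).
by rewrite hom_equiv.
Qed.

Lemma ext0_retract_r X Y Y' (a : hom Y Y') (b : hom Y' Y) :
  b *m a = 1%:M -> ext0 X Y' -> ext0 X Y.
Proof.
move=> ba e c Hc; have [D HD] := e _ (cocycle_post a Hc).
exists (b *m D) => A phi g dg; have ba' : map_mx phi b *m map_mx phi a = 1%:M.
  by rewrite -map_mxM ba map_mx1.
rewrite -[LHS]mul1mx -ba' -mulmxA HD // mulmxBr map_mxM !mulmxA; congr (_ - _).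
by rewrite hom_equiv.
Qed.

Lemma hom_inv_subproof X Y (f : hom X Y) (N : 'M[k]_(rdim X, rdim Y)) :
  f *m N = 1%:M -> N *m f = 1%:M ->
  forall (A : comNzRingType) (phi : {rmorphism k -> A}) (g : 'M[A]_2), \det g = 1 ->
  map_mx phi N *m ract Y phi g = ract X phi g *m map_mx phi N.
Proof.
move=> fN Nf A phi g dg.
rewrite -[LHS]mulmx1 -(map_mx1 phi) -fN map_mxM -!mulmxA [ract Y phi g *m _]mulmxA.
by rewrite -hom_equiv // !mulmxA -map_mxM Nf map_mx1 mul1mx.
Qed.
Definition hom_inv X Y (f : hom X Y) N fN Nf : hom Y X :=
  Hom (@hom_inv_subproof X Y f N fN Nf).

(** The linear lift [s *m f] fails to be equivariant by a cocycle with values in [Y1]; a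
    trivialisation of that cocycle corrects the lift. *)
Lemma lift_hom X Y1 Y Y2 (i : hom Y1 Y) (q : hom Y Y2) r s :
  split_exact i q r s -> ext0 X Y1 -> forall f : hom X Y2,
  exists F : hom X Y, q *m F = f.
Proof.
move=> se e f; have [qi ri qs irsq] := se.
pose c1 : cochain X Y := fun A phi g =>
  ract Y phi g *m map_mx phi (s *m f) - map_mx phi (s *m f) *m ract X phi g.
have Hc1 : cocycle c1 := cocycle_coboundary (s *m f).
have ic1 (A : comNzRingType) (phi : {rmorphism k -> A}) (g : 'M[A]_2) : \det g = 1 ->
    map_mx phi i *m (map_mx phi r *m c1 A phi g) = c1 A phi g.
  move=> dg; have [qi' _ qs' e1'] := split_exact_map phi se.
  have qc1 : map_mx phi q *m c1 A phi g = 0.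
    rewrite /c1 mulmxBr !map_mxM !mulmxA hom_equiv //.
    by rewrite -[ract Y2 _ _ *m _ *m _]mulmxA qs' mulmx1 mul1mx hom_equiv // subrr.
  by rewrite -[RHS]mul1mx -e1' mulmxDl -!mulmxA qc1 mulmx0 addr0.
have [D HD] := e _ (cocycle_lift_post ri Hc1 ic1).
have FP (A : comNzRingType) (phi : {rmorphism k -> A}) (g : 'M[A]_2) : \det g = 1 ->
    map_mx phi (s *m f - i *m D) *m ract X phi g = ract Y phi g *m map_mx phi (s *m f - i *m D).
  move=> dg; have := ic1 A phi g dg; rewrite HD // /c1 map_mxB mulmxBl mulmxBr.
  rewrite mulmxBr [map_mx phi (i *m D)]map_mxM !mulmxA hom_equiv //.
  move/eqP; rewrite eq_sym subr_eq => /eqP ->.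
  by rewrite [RHS]addrAC [X in _ = X + _]addrAC subrr sub0r addrC.
exists (Hom FP); rewrite /= mulmxBr !mulmxA qs mul1mx qi mul0mx subr0 //.
Qed.
End ExtClosure.

Notation "i ⊗ j" := (mxtens_index (i, j)) (at level 20).

Lemma sum_tens (R : nmodType) m n (F : 'I_(m * n) -> R) :
  \sum_r F r = \sum_i \sum_j F (i ⊗ j).
Proof.
rewrite (reindex (@mxtens_index m n)) /=; last first.
  by exists (@mxtens_unindex _ _) => ? _; rewrite (mxtens_indexK, mxtens_unindexK).
by rewrite pair_bigA; apply: eq_bigr => -[].
Qed.

Lemma sum_delta (R : pzRingType) N (F : nat -> R) x :
  \sum_(j < N) F j * (j == x :> nat)%:R = F x *+ (x < N)%N.
Proof.
case: ltnP => lt_x.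
  rewrite (bigD1 (Ordinal lt_x)) //= eqxx mulr1 big1 ?addr0 // => j ne.
  by rewrite -val_eqE /= in ne; rewrite (negbTE ne) mulr0.
rewrite big1 // => j _; rewrite (_ : (_ == _) = false) ?mulr0 //.
by rewrite (ltn_eqF (leq_trans (ltn_ord j) lt_x)).
Qed.

Lemma sum_delta_ord (R : pzRingType) N (F : 'I_N -> R) x :
  \sum_(j < N) F j * (j == x)%:R = F x.
Proof.
rewrite (bigD1 x) //= eqxx mulr1 big1 ?addr0 // => j ne.
by rewrite (negbTE ne) mulr0.
Qed.

Lemma tens1mx_mulE (R : comNzRingType) m n q p (h : 'M[R]_(n, q)) (N : 'M[R]_(m * q, p)) y a x :
  ((1%:M *t h) *m N) (y ⊗ a) x = \sum_b h a b * N (y ⊗ b) x.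
Proof.
rewrite mxE sum_tens (bigD1 y) //= [X in _ + X]big1 ?addr0 => [|z nz].
  by apply: eq_bigr => b _; rewrite tensmxE mxE eqxx mul1r.
by rewrite big1 // => b _; rewrite tensmxE mxE eq_sym (negbTE nz) !mul0r.
Qed.

Lemma tensmx1_mulE (R : comNzRingType) m n q p (Q : 'M[R]_(m, q)) (N : 'M[R]_(q * n, p)) y a x :
  ((Q *t 1%:M) *m N) (y ⊗ a) x = \sum_z Q y z * N (z ⊗ a) x.
Proof.
rewrite mxE sum_tens; apply: eq_bigr => z _.
rewrite (bigD1 a) //= big1 ?addr0 => [|b nb].
  by rewrite tensmxE mxE eqxx mulr1.
by rewrite tensmxE mxE eq_sym (negbTE nb) mulr0 mul0r.
Qed.

(** * Tensoring with the natural representation and the Koszul sequence *)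

Section Sharp.
Variable A : comNzRingType.
Implicit Types m n : nat.

Definition symp : 'M[A]_2 := mx2 0 1 (-1) 0.

Lemma sympK : symp *m symp = - 1%:M.
Proof. by rewrite mx2M mx2_1; apply: mx2P; rewrite !mxE /=; ring. Qed.

Lemma symp_adj (g : 'M[A]_2) : g *m symp = symp *m (\adj g)^T.
Proof.
rewrite [g]mx2_eta adj_mx2 [(mx2 _ _ _ _)^T]mx2_eta !mxE /= !mx2M.
by congr mx2; ring.
Qed.

Definition cslice m n (M : 'M[A]_(m, n * 2)) y : 'M[A]_(n, 2) :=
  \matrix_(x, b) M y (x ⊗ b).
Definition rslice m n (M : 'M[A]_(m * 2, n)) y : 'M[A]_(n, 2) :=
  \matrix_(x, a) M (y ⊗ a) x.

Lemma csliceP m n (M M' : 'M[A]_(m, n * 2)) :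
  (forall y, cslice M y = cslice M' y) -> M = M'.
Proof.
move=> E; apply/matrixP=> y r; case: (mxtens_indexP r) => x b.
by move/matrixP/(_ x b): (E y); rewrite !mxE.
Qed.

Lemma rsliceP m n (M M' : 'M[A]_(m * 2, n)) :
  (forall y, rslice M y = rslice M' y) -> M = M'.
Proof.
move=> E; apply/matrixP=> r x; case: (mxtens_indexP r) => y a.
by move/matrixP/(_ x a): (E y); rewrite !mxE.
Qed.

(** The adjunction [Hom(X ⊗ V, Y) = Hom(X, Y ⊗ V)] for the natural representation [V], self-dual
    through [symp], on the level of matrices. *)
Definition sharp m n (M : 'M[A]_(m, n * 2)) : 'M[A]_(m * 2, n) :=
  \matrix_(r, x) (cslice M (mxtens_unindex r).1 *m symp) x (mxtens_unindex r).2.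
Definition flat m n (M : 'M[A]_(m * 2, n)) : 'M[A]_(m, n * 2) :=
  \matrix_(y, r) (rslice M y *m (- symp)) (mxtens_unindex r).1 (mxtens_unindex r).2.

Lemma rslice_sharp m n (M : 'M[A]_(m, n * 2)) y :
  rslice (sharp M) y = cslice M y *m symp.
Proof. by apply/matrixP=> x a; rewrite mxE [LHS]mxE mxtens_indexK. Qed.

Lemma cslice_flat m n (M : 'M[A]_(m * 2, n)) y :
  cslice (flat M) y = rslice M y *m (- symp).
Proof. by apply/matrixP=> x a; rewrite mxE [LHS]mxE mxtens_indexK. Qed.

Lemma sharpK m n : cancel (@sharp m n) (@flat m n).
Proof.
move=> M; apply: csliceP => y.
by rewrite cslice_flat rslice_sharp -mulmxA mulmxN sympK opprK mulmx1.
Qed.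

Lemma flatK m n : cancel (@flat m n) (@sharp m n).
Proof.
move=> M; apply: rsliceP => y.
by rewrite rslice_sharp cslice_flat -mulmxA mulNmx sympK opprK mulmx1.
Qed.

Lemma sharpMr m n p (M : 'M[A]_(m, n * 2)) (P : 'M[A]_(n, p)) (g : 'M[A]_2) :
  sharp (M *m (P *t g)) = (1%:M *t \adj g) *m sharp M *m P.
Proof.
apply: rsliceP => y; rewrite rslice_sharp.
have -> : cslice (M *m (P *t g)) y = P^T *m cslice M y *m g.
  apply/matrixP=> x b; rewrite !mxE sum_tens exchange_big /=; apply: eq_bigr => b' _.
  rewrite mxE mulr_suml; apply: eq_bigr => x' _.
  by rewrite tensmxE !mxE; ring.
have -> : rslice ((1%:M *t \adj g) *m sharp M *m P) y
    = P^T *m rslice (sharp M) y *m (\adj g)^T.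
  apply/matrixP=> x a; rewrite mxE mxE [RHS]mxE.
  under eq_bigr => x' _ do rewrite tens1mx_mulE big_distrl.
  rewrite exchange_big /=; apply: eq_bigr => a' _; rewrite [in RHS]mxE mulr_suml.
  by apply: eq_bigr => x' _; rewrite !mxE; ring.
by rewrite rslice_sharp -!mulmxA symp_adj.
Qed.

Lemma sharpMl m n p (Q : 'M[A]_(p, m)) (M : 'M[A]_(m, n * 2)) :
  sharp (Q *m M) = (Q *t 1%:M) *m sharp M.
Proof.
apply: rsliceP => y; rewrite rslice_sharp; apply/matrixP=> x a.
rewrite [RHS]mxE tensmx1_mulE mxE.
under eq_bigr => b _ do rewrite !mxE big_distrl.
rewrite exchange_big; apply: eq_bigr => y' _.
rewrite [sharp M _ _]mxE mxtens_indexK mxE mulr_sumr /=.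
by apply: eq_bigr => b _; rewrite !mxE mulrA.
Qed.

Lemma sharpD m n (M N : 'M[A]_(m, n * 2)) : sharp (M + N) = sharp M + sharp N.
Proof.
apply/matrixP=> r x; rewrite !mxE -big_split; apply: eq_bigr => b _.
by rewrite !mxE mulrDl.
Qed.

Lemma sharpB m n (M N : 'M[A]_(m, n * 2)) : sharp (M - N) = sharp M - sharp N.
Proof.
apply/matrixP=> r x; rewrite !mxE -sumrB; apply: eq_bigr => b _.
by rewrite !mxE mulrBl.
Qed.
End Sharp.

Lemma map_sharp (A B : comNzRingType) (e : {rmorphism A -> B}) m n (M : 'M[A]_(m, n * 2)) :
  map_mx e (sharp M) = sharp (map_mx e M).
Proof.
apply/matrixP=> r x; rewrite !mxE rmorph_sum; apply: eq_bigr => b _.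
rewrite rmorphM !mxE; congr (_ * _).
by case: (_ == 0); case: (_ == 0); rewrite ?rmorphN ?rmorph0 ?rmorph1.
Qed.

Section NaturalRep.
Variable k : fieldType.
Implicit Types X Y Z : sl2rep k.

Definition natrep : sl2rep k :=
  @Sl2Rep k 2 (fun A phi g => g) (fun _ _ => erefl) (fun _ _ _ _ _ _ => erefl)
    (fun _ _ _ _ _ _ _ _ => erefl).

Notation "X ⊗V" := (tens X natrep) (at level 20, format "X ⊗V").

Lemma tens11 (A : comNzRingType) m n p q (P : 'M[A]_(m, n)) (g : 'M[A]_(p, q)) :
  (1%:M *t g) *m (P *t 1%:M) = P *t g.
Proof. by rewrite tensmx_mul mul1mx mulmx1. Qed.

Lemma sharp_hom_subproof X Y (f : hom (X ⊗V) Y)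
    (A : comNzRingType) (phi : {rmorphism k -> A}) (g : 'M[A]_2) : \det g = 1 ->
  map_mx phi (sharp (hmx f : 'M_(rdim Y, rdim X * 2))) *m ract X phi g
    = ract (Y ⊗V) phi g *m map_mx phi (sharp (hmx f : 'M_(rdim Y, rdim X * 2))).
Proof.
move=> dg; rewrite map_sharp /=.
have := congr1 (fun M => (1%:M *t g) *m @sharp A _ _ M) (hom_equiv f phi dg).
rewrite /= /tens_act [sharp (_ *m (_ *t _))]sharpMr [sharp (_ *m map_mx _ _)]sharpMl.
rewrite !mulmxA tens11 => <-; congr (_ *m _).
by rewrite tensmx_mul mul1mx mul_mx_adj dg tens1mx1 mul1mx.
Qed.
Definition sharp_hom X Y (f : hom (X ⊗V) Y) : hom X (Y ⊗V) :=
  @Hom k X (Y ⊗V) _ (sharp_hom_subproof f).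

Lemma flat_hom_subproof X Y (f : hom X (Y ⊗V))
    (A : comNzRingType) (phi : {rmorphism k -> A}) (g : 'M[A]_2) : \det g = 1 ->
  map_mx phi (flat (hmx f : 'M_(rdim Y * 2, rdim X))) *m ract (X ⊗V) phi g
    = ract Y phi g *m map_mx phi (flat (hmx f : 'M_(rdim Y * 2, rdim X))).
Proof.
move=> dg; apply: (can_inj (@sharpK A _ _)); rewrite /= /tens_act sharpMr sharpMl.
rewrite -map_sharp flatK -mulmxA (hom_equiv f phi dg) mulmxA; congr (_ *m _).
by rewrite tensmx_mul mul1mx mul_adj_mx dg.
Qed.
Definition flat_hom X Y (f : hom X (Y ⊗V)) : hom (X ⊗V) Y :=
  @Hom k (X ⊗V) Y _ (flat_hom_subproof f).

(** Under [sharp] the factor [h] acting on the source reappears as [\adj h] on the target; the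
    factor [1 ⊗ g] in [c'] compensates for it and restores the cocycle rule. *)
Lemma ext0_tensV X Y : ext0 X (Y ⊗V) -> ext0 (X ⊗V) Y.
Proof.
move=> e c [cM cN].
pose c' : cochain X (Y ⊗V) := fun A phi g => (1%:M *t g) *m @sharp A _ _ (c A phi g).
have [|D HD] := e c'.
  split=> [A phi g h dg dh|A B phi psi f g Hf dg]; rewrite /c'.
    rewrite cM // sharpD mulmxDr sharpMr sharpMl !mulmxA.
    by rewrite /= /tens_act !tensmx_mul !mul1mx !mulmx1 -[g *m h *m _]mulmxA mul_mx_adj dh mulmx1.
  by rewrite (cN _ _ _ _ _ _ Hf dg) map_mxM map_mxT map_mx1 map_sharp.
exists (flat (D : 'M_(rdim Y * 2, rdim X))) => A phi g dg.
apply: (can_inj (@sharpK A _ _)); rewrite sharpB sharpMl /= /tens_act sharpMr.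
rewrite -map_sharp flatK; have := HD A phi g dg => /(congr1 (mulmx (1%:M *t \adj g))).
rewrite /c' mulmxA tensmx_mul mul1mx mul_adj_mx dg tens1mx1 mul1mx => ->.
by rewrite mulmxBr !mulmxA /= /tens_act tensmx_mul mul1mx mul_adj_mx dg.
Qed.

(** Index 0 of the natural representation is [x], which raises the exponent by one, and index 1 is
    [y], which is invisible after dehomogenising. *)
Definition mult_mx n : 'M[k]_(n.+2, n.+1 * 2) :=
  \matrix_(l, r) ((l == (mxtens_unindex r).1 + ((mxtens_unindex r).2 == 0%R) :> nat)%N)%:R.

Lemma mult_subproof n (A : comNzRingType) (phi : {rmorphism k -> A}) (g : 'M[A]_2) :
  \det g = 1 ->
  map_mx phi (mult_mx n) *m ract (dualWeyl k n ⊗V) phi g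
    = ract (dualWeyl k n.+1) phi g *m map_mx phi (mult_mx n).
Proof.
move=> _; apply/matrixP=> l r; case: (mxtens_indexP r) => j a.
have jn : (j <= n)%N by rewrite -ltnS.
pose P := substx g ^+ j * substy g ^+ (n - j).
have sP : (size P <= n.+1)%N by have := size_subst g j (n - j); rewrite subnKC.
have EX : (P * 'X)`_l = \sum_(i < n.+1) P`_i * (l == i.+1 :> nat)%:R.
  rewrite coefMX; case: (nat_of_ord l) (ltn_ord l) => [|l'] lt_l.
    by rewrite big1 // => i _; rewrite mulr0.
  under eq_bigr => i _ do rewrite eqSS eq_sym.
  by rewrite (sum_delta _ (fun i => P`_i)) -ltnS lt_l.
have E1 : P`_l = \sum_(i < n.+1) P`_i * (l == i :> nat)%:R.
  under eq_bigr => i _ do rewrite eq_sym.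
  rewrite (sum_delta _ (fun i => P`_i)); case: ltnP => // le_l.
  by rewrite nth_default // (leq_trans sP).
transitivity ((P * (g 0 a *: 'X + (g 1 a)%:P))`_l).
  rewrite mxE sum_tens mulrDr -scalerAr coefD coefZ coefMC EX E1 mulr_sumr mulr_suml.
  rewrite -big_split /=; apply: eq_bigr => i _; rewrite big_ord2 !tensmxE !mxE !mxtens_indexK /=.
  by rewrite !rmorph_nat addn1 addn0 -/P; ring.
have lt_ja : (j + (a == 0%R) < n.+2)%N by rewrite ltnS -[n.+1]addn1 leq_add // leq_b1.
pose c : 'I_n.+2 := Ordinal lt_ja.
rewrite mxE; under eq_bigr => i _ do rewrite [map_mx _ _ _ _]mxE [mult_mx _ _ _]mxE mxtens_indexK
  rmorph_nat -[(j + _)%N]/(val c) val_eqE.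
rewrite sum_delta_ord !mxE /=.
case: (ord2P a) => ->; rewrite /= ?addn1 ?addn0.
  by rewrite exprSr subSS mulrAC.
by rewrite subSn // [in RHS]exprSr mulrA.
Qed.
Definition mult n : hom (dualWeyl k n ⊗V) (dualWeyl k n.+1) :=
  @Hom k (dualWeyl k n ⊗V) (dualWeyl k n.+1) (mult_mx n) (@mult_subproof n).

Lemma mult_mxE n (l : 'I_n.+2) (j : 'I_n.+1) :
  (mult_mx n l (j ⊗ 0) = (l == j.+1 :> nat)%:R) * (mult_mx n l (j ⊗ 1) = (l == j :> nat)%:R).
Proof. by rewrite !mxE !mxtens_indexK /= addn1 addn0. Qed.

Lemma sharp_mult_mxE n (y : 'I_n.+2) (x : 'I_n.+1) :
  (sharp (mult_mx n) (y ⊗ 0) x = - (y == x :> nat)%:R) *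
  (sharp (mult_mx n) (y ⊗ 1) x = (y == x.+1 :> nat)%:R).
Proof.
rewrite !mxE !big_ord2 !mxtens_indexK !mxE !mxtens_indexK /= addn1 addn0.
by rewrite !mulr0 add0r addr0 mulr1 mulrN1.
Qed.

(** The Koszul sequence [0 -> V_n -> V_(n+1) ⊗ V -> V_(n+2) -> 0], whose first map is
    [v |-> x v ⊗ y - y v ⊗ x]. The section [s] divides a monomial by [y], except [x^(n+2)], which it
    divides by [x]. *)
Lemma koszul_exact n : exists r s, split_exact (sharp_hom (mult n)) (mult n.+1) r s.
Proof.
pose r : 'M[k]_(n.+1, n.+2 * 2) := \matrix_(l, c)
  (if (mxtens_unindex c).2 == 0 then - (l == (mxtens_unindex c).1 :> nat)%:R else 0).
pose s : 'M[k]_(n.+2 * 2, n.+3) := \matrix_(c, l)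
  (if (mxtens_unindex c).2 == 0 then ((mxtens_unindex c).1 == n.+1 :> nat)%:R * (l == n.+2 :>
    nat)%:R
   else (l == (mxtens_unindex c).1 :> nat)%:R).
have rE l j : (r l (j ⊗ 0) = - (l == j :> nat)%:R) * (r l (j ⊗ 1) = 0).
  by rewrite !mxE !mxtens_indexK.
have sE l j : (s (j ⊗ 0) l = (j == n.+1 :> nat)%:R * (l == n.+2 :> nat)%:R) * (s (j ⊗ 1) l = (l
  == j :> nat)%:R).
  by rewrite !mxE !mxtens_indexK.
exists r, s; split=> /=.
- apply/matrixP=> l x; rewrite mxE sum_tens.
  under eq_bigr => j _ do rewrite big_ord2 !(mult_mxE l j) !(sharp_mult_mxE j x) mulrN.
  rewrite big_split sumrN /= (sum_delta _ (fun j => (l == j.+1 :> nat)%:R)).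
  rewrite (sum_delta _ (fun j => (l == j :> nat)%:R)).
  have x1 : (x.+1 < n.+2)%N := ltn_ord x.
  by rewrite x1 (ltnW x1) mxE addNr.
- apply/matrixP=> l x; rewrite mxE sum_tens.
  under eq_bigr => j _ do rewrite big_ord2 !(rE l j) !(sharp_mult_mxE j x) mulrNN mul0r addr0.
  rewrite (sum_delta _ (fun j => (l == j :> nat)%:R)) (ltnW (ltn_ord x : (x.+1 < n.+2)%N)).
  by rewrite mxE.
- apply/matrixP=> l x; rewrite mxE sum_tens.
  have E (j : 'I_n.+2) : \sum_(a < 2) mult_mx n.+1 l (j ⊗ a) * s (j ⊗ a) x
      = (l == j.+1 :> nat)%:R * (x == n.+2 :> nat)%:R * (j == n.+1 :> nat)%:R
        + (x == j :> nat)%:R * (j == l :> nat)%:R.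
    by rewrite big_ord2 !(mult_mxE l j) !(sE x j) [(j == l :> nat)]eq_sym; ring.
  under eq_bigr => j _ do rewrite E.
  rewrite big_split /= (sum_delta _ (fun j => (l == j.+1 :> nat)%:R * (x == n.+2 :> nat)%:R)).
  rewrite (sum_delta _ (fun j => (x == j :> nat)%:R)) ltnSn mxE -val_eqE /=.
  have [->|nl] := eqVneq (nat_of_ord l) n.+2.
    by rewrite ltnn mulr0n addr0 mul1r mulr1n eq_sym.
  rewrite mul0r add0r eq_sym (_ : (l < n.+2)%N) //.
  by rewrite ltn_neqAle nl -ltnS ltn_ord.
apply/matrixP=> c c'; case: (mxtens_indexP c) => j a; case: (mxtens_indexP c') => j' a'.
rewrite !mxE (can_eq (@mxtens_indexK _ _)) xpair_eqE (_ : (j == j') = (j == j' :> nat)) //.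
have lt_j3 (i : 'I_n.+2) : (i < n.+3)%N := ltnW (ltn_ord i : (i.+1 < n.+3)%N).
case: (ord2P a) => ->; case: (ord2P a') => ->; rewrite ?eqxx ?andbT ?andbF.
- under eq_bigr => x _ do rewrite (sharp_mult_mxE j x) (rE x j') mulrNN [(j == x :> nat)]eq_sym
  mulrC.
  under [X in _ + X]eq_bigr => l _ do rewrite (sE l j) (mult_mxE l j') mulrAC.
  rewrite (sum_delta _ (fun x => (x == j' :> nat)%:R)) (sum_delta _ (fun l => (j == n.+1 :>
    nat)%:R * (l == j'.+1 :> nat)%:R)).
  rewrite ltnSn eqSS; have [->|nj] := eqVneq (nat_of_ord j) n.+1.
    by rewrite ltnn mulr0n add0r mul1r.
  by rewrite mul0r addr0 ltn_neqAle nj -ltnS ltn_ord.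
- under eq_bigr => x _ do rewrite (rE x j') mulr0.
  under [X in _ + X]eq_bigr => l _ do rewrite (sE l j) (mult_mxE l j') mulrAC.
  rewrite big1 // add0r (sum_delta _ (fun l => (j == n.+1 :> nat)%:R * (l == j' :> nat)%:R)).
  by rewrite (gtn_eqF (ltn_ord j')) mulr0 mul0rn.
- under eq_bigr => x _ do rewrite (sharp_mult_mxE j x) (rE x j') mulrN.
  under [X in _ + X]eq_bigr => l _ do rewrite (sE l j) (mult_mxE l j') mulrC.
  rewrite sumrN (sum_delta _ (fun x => (j == x.+1 :> nat)%:R)) (sum_delta _ (fun l => (l == j'.+1
    :> nat)%:R)).
  rewrite lt_j3; have [lt_j|le_j] := ltnP j' n.+1; first by rewrite addNr.
  by rewrite mulr0n oppr0 add0r (ltn_eqF (leq_trans (ltn_ord j) _)).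
- under eq_bigr => x _ do rewrite (rE x j') mulr0.
  under [X in _ + X]eq_bigr => l _ do rewrite (sE l j) (mult_mxE l j') mulrC.
  by rewrite big1 // add0r (sum_delta _ (fun l => (l == j' :> nat)%:R)) lt_j3.
Qed.

(** For positive [n] the Koszul sequence presents [V_n ⊗ V] as an extension of dual Weyl modules;
    [V_0 ⊗ V] is [V_1]. *)
Lemma ext0_mult X n : (forall m, ext0 X (dualWeyl k m)) -> ext0 X (dualWeyl k n ⊗V).
Proof.
move=> e; case: n => [|n]; last first.
  by have [r [s se]] := koszul_exact n; exact: ext0_extr se (e _) (e _).
pose N : 'M[k]_(1 * 2, 2) := (mult_mx 0)^T.
have fN : mult_mx 0 *m N = 1%:M.
  by apply: mx2P; rewrite mxE sum_tens big_ord1 big_ord2 !mxE !mxtens_indexK /=; ring.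
apply: (ext0_retract_r (a := mult 0) (b := @hom_inv k _ _ (mult 0) N fN (mulmx1C fN))) (e 1%N).
exact: mulmx1C.
Qed.

Lemma acyclic_tensV X : (forall m, ext0 X (dualWeyl k m)) ->
  forall m, ext0 (X ⊗V) (dualWeyl k m).
Proof. by move=> e m; apply/ext0_tensV/ext0_mult. Qed.

Lemma ext0_filtered X Y : (forall m, ext0 X (dualWeyl k m)) ->
  filtered (dualWeyl k) Y -> ext0 X Y.
Proof.
move=> e; elim=> {Y} [Y Y0 c _|Y Z n i q _ IH se].
  exists 0 => A phi g _; apply/matrixP=> a; exfalso.
  by move: a; rewrite Y0 => -[].
by have [r [s sp]] := short_exact_split se; exact: ext0_extr sp IH (e n).
Qed.

Lemma acyclic_filtered X : filtered (fun n => dual (dualWeyl k n)) X ->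
  forall m, ext0 X (dualWeyl k m).
Proof.
elim=> {X} [X X0 m c _|X Z n i q _ IH se m].
  exists 0 => A phi g _; apply/matrixP=> a b; exfalso.
  by move: b; rewrite X0 => -[].
have [r [s sp]] := short_exact_split se.
apply: (ext0_extl sp (IH m)); exact: ext0_dualWeyl.
Qed.

(* Lifting along V_m ⊗ V -> V_(m+1), then along Q ⊗ V -> V_m ⊗ V by adjunction. *)
Lemma lift_tensV Q m (pi : hom Q (dualWeyl k m.+1)) :
  (forall X, (forall j, ext0 X (dualWeyl k j)) -> forall f : hom X (dualWeyl k m.+1),
     exists F : hom X Q, pi *m F = f) ->
  forall X, (forall j, ext0 X (dualWeyl k j)) -> forall f : hom X (dualWeyl k m.+2),
    exists F : hom X (Q ⊗V),
      hom_comp (mult m.+1) (@hom_tens k _ _ natrep natrep pi (hom_id natrep)) *m F = f.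
Proof.
move=> lQ X e f; have [r [s se]] := koszul_exact m.
have [f1 f1E] := lift_hom se (e m) f.
have [F FE] := lQ _ (acyclic_tensV e) (flat_hom f1).
exists (sharp_hom F); rewrite /= -[RHS]f1E -mulmxA; congr (_ *m _).
by rewrite -sharpMl FE /= flatK.
Qed.
End NaturalRep.

(** * Traces, weights and self-duality of V_n *)

Section PartialTraceMx.
Variables (A : comNzRingType) (m n w : nat).

Definition ptr_mx m n (h : 'M[A]_(m * w, n * w)) : 'M[A]_(m, n) :=
  \matrix_(a, b) \sum_c h (a ⊗ c) (b ⊗ c).

Lemma mul_tensmx1E l (h : 'M[A]_(l, m * w)) (P : 'M[A]_(m, n)) r b c :
  (h *m (P *t (1%:M : 'M_w))) r (b ⊗ c) = \sum_a h r (a ⊗ c) * P a b.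
Proof.
rewrite mxE sum_tens; apply: eq_bigr => a _.
rewrite (bigD1 c) //= big1 ?addr0 => [|d nd]; rewrite tensmxE mxE.
  by rewrite eqxx mulr1.
by rewrite (negbTE nd) !mulr0.
Qed.

Lemma mul_tens1mxE l (h : 'M[A]_(l, m * w)) (B : 'M[A]_(w, n)) r b c :
  (h *m ((1%:M : 'M_m) *t B)) r (b ⊗ c) = \sum_d h r (b ⊗ d) * B d c.
Proof.
rewrite mxE sum_tens (bigD1 b) //= [X in _ + X]big1 ?addr0 => [|a na].
  by apply: eq_bigr => d _; rewrite tensmxE mxE eqxx mul1r.
by rewrite big1 // => d _; rewrite tensmxE mxE (negbTE na) mul0r mulr0.
Qed.

End PartialTraceMx.

Section PartialTraceLemmas.
Variables (A : comNzRingType).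

Lemma ptr_mxMr m n l w (h : 'M[A]_(l * w, m * w)) (P : 'M[A]_(m, n)) :
  ptr_mx (h *m (P *t 1%:M)) = ptr_mx h *m P.
Proof.
apply/matrixP=> a b; rewrite !mxE; under eq_bigr => c _ do rewrite mul_tensmx1E.
by rewrite exchange_big; apply: eq_bigr => x _; rewrite mxE mulr_suml.
Qed.

Lemma ptr_mxMl m n l w (h : 'M[A]_(m * w, n * w)) (P : 'M[A]_(l, m)) :
  ptr_mx ((P *t 1%:M) *m h) = P *m ptr_mx h.
Proof.
apply/matrixP=> a b; rewrite !mxE; under eq_bigr => c _ do rewrite tensmx1_mulE.
by rewrite exchange_big; apply: eq_bigr => x _; rewrite mxE mulr_sumr.
Qed.

Lemma ptr_mx_cyc m n w (h : 'M[A]_(m * w, n * w)) (B : 'M[A]_w) :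
  ptr_mx ((1%:M *t B) *m h) = ptr_mx (h *m (1%:M *t B)).
Proof.
apply/matrixP=> a b; rewrite !mxE.
under eq_bigr => c _ do rewrite tens1mx_mulE.
under [RHS]eq_bigr => c _ do rewrite mul_tens1mxE.
by rewrite exchange_big; apply: eq_bigr => c _; apply: eq_bigr => d _; rewrite mulrC.
Qed.

Lemma tr_ptr_mx m w (h : 'M[A]_(m * w)) : \tr (ptr_mx h) = \tr h.
Proof. by rewrite /mxtrace sum_tens; apply: eq_bigr => a _; rewrite mxE. Qed.
End PartialTraceLemmas.

Section PartialTrace.
Variable k : fieldType.
Implicit Types X Y W : sl2rep k.

(** The action on [W] is moved around the partial trace by [ptr_mx_cyc] and cancels against its
    inverse. *)
Lemma ptr_hom_subproof X Y W (h : hom (tens Y W) (tens X W))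
    (A : comNzRingType) (phi : {rmorphism k -> A}) (g : 'M[A]_2) : \det g = 1 ->
  let M := ptr_mx (hmx h : 'M_(rdim X * rdim W, rdim Y * rdim W)) in
  map_mx phi M *m ract Y phi g = ract X phi g *m map_mx phi M.
Proof.
move=> dg M.
have EM : map_mx phi M = ptr_mx (map_mx phi (hmx h : 'M_(rdim X * rdim W, rdim Y * rdim W))).
  by apply/matrixP=> a b; rewrite !mxE rmorph_sum; apply: eq_bigr => c _; rewrite mxE.
set B := ract W phi (\adj g).
have BW : ract W phi g *m B = 1%:M by rewrite -ractM ?det_adj1 // mul_mx_adj dg ract1.
have WB : B *m ract W phi g = 1%:M by rewrite -ractM ?det_adj1 // mul_adj_mx dg ract1.
rewrite EM -ptr_mxMr.
have -> : ract Y phi g *t 1%:M = (ract Y phi g *t ract W phi g) *m (1%:M *t B).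
  by rewrite tensmx_mul mulmx1 BW.
rewrite mulmxA (hom_equiv h phi dg) /= /tens_act.
have -> : ract X phi g *t ract W phi g = (ract X phi g *t 1%:M) *m (1%:M *t ract W phi g).
  by rewrite tensmx_mul mulmx1 mul1mx.
rewrite -!mulmxA ptr_mxMl ptr_mx_cyc -mulmxA tensmx_mul mulmx1 WB tens1mx1 mulmx1.
by [].
Qed.
Definition ptr_hom X Y W (h : hom (tens Y W) (tens X W)) : hom Y X :=
  @Hom k Y X _ (ptr_hom_subproof h).

Lemma scale_hom_subproof X Y (c : k) (f : hom X Y)
    (A : comNzRingType) (phi : {rmorphism k -> A}) (g : 'M[A]_2) : \det g = 1 ->
  map_mx phi (c *: hmx f) *m ract X phi g = ract Y phi g *m map_mx phi (c *: hmx f).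
Proof. by move=> dg; rewrite map_mxZ -scalemxAl hom_equiv // scalemxAr. Qed.
Definition hom_scale X Y c (f : hom X Y) : hom X Y := Hom (scale_hom_subproof c f).
End PartialTrace.

Section Weights.
Variable k : fieldType.
Implicit Types X Y : sl2rep k.

(** The [i]-th basis vector has weight [a i - b i]; keeping both exponents avoids negative
    numbers. *)
Definition torus_diag X (a b : 'I_(rdim X) -> nat) : Prop :=
  forall (A : comNzRingType) (phi : {rmorphism k -> A}) (s t : A) i j,
    ract X phi (tmx s t) i j = (s ^+ a i * t ^+ b i) *+ (i == j).

Lemma hom_weight X Y a b c d : @torus_diag X a b -> @torus_diag Y c d ->
  forall (f : hom X Y) i j, hmx f i j != 0 -> (c i + b j = a j + d i)%N.
Proof.
move=> HX HY f i j nz; have [K [phi [s [t [st inj]]]]] := transcendental_unit k.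
have := hom_equiv f phi (det_tmx st) => /matrixP/(_ i j); rewrite !mxE.
rewrite (bigD1 j) //= [X in _ + X]big1 ?addr0 => [|l nl]; last first.
  by rewrite HX (negbTE nl) mulr0.
rewrite [RHS](bigD1 i) //= [X in _ = _ + X]big1 ?addr0 => [|l nl]; last first.
  by rewrite HY eq_sym (negbTE nl) mul0r.
rewrite HX HY !eqxx !mulr1n mxE => E.
have : evalm phi s (hmx f i j *: 'X^(a j + d i)) = evalm phi s (hmx f i j *: 'X^(c i + b j)).
  rewrite -!mul_polyC !rmorphM /= !evalmC !rmorphXn /= !evalmX.
  transitivity (phi (f i j) * (s ^+ a j * t ^+ b j) * (s ^+ b j * s ^+ d i)).
    by rewrite exprD -mulrA; congr (_ * _); transitivity (s ^+ a j * s ^+ d i * (s * t) ^+ b j);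
      [rewrite st expr1n mulr1 | rewrite exprMn; ring].
  rewrite E; transitivity (phi (f i j) * (s ^+ c i * s ^+ b j * (s * t) ^+ d i)).
    by rewrite exprMn; ring.
  by rewrite st expr1n mulr1 exprD.
move/inj/(congr1 (fun q : {poly k} => q`_(c i + b j))); rewrite !coefZ !coefXn eqxx mulr1.
by case: eqP => [//|_]; rewrite mulr0 => /esym/eqP; rewrite (negbTE nz).
Qed.

Lemma torus_dualWeyl n : @torus_diag (dualWeyl k n) (fun i => i) (fun i => (n - i)%N).
Proof. by move=> A phi s t i j; rewrite dualWeyl_t. Qed.

Lemma torus_tens X Y a b c d : @torus_diag X a b -> @torus_diag Y c d ->
  @torus_diag (tens X Y) (fun r => a (mxtens_unindex r).1 + c (mxtens_unindex r).2)%N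
    (fun r => b (mxtens_unindex r).1 + d (mxtens_unindex r).2)%N.
Proof.
move=> HX HY A phi s t r r'; case: (mxtens_indexP r) => i j; case: (mxtens_indexP r') => i' j'.
rewrite [LHS]tensmxE !mxtens_indexK HX HY (can_eq (@mxtens_indexK _ _)) xpair_eqE /=.
by case: (i == i'); case: (j == j'); rewrite ?mulr1n ?mulr0n ?mulr0 ?mul0r // !exprD; ring.
Qed.

(** Row 0 determines the map, and weight [- n] occurs in [V_n] only on [y^n], so row 0 has a single
    possible nonzero entry. *)
Lemma end_dualWeyl n (f : hom (dualWeyl k n) (dualWeyl k n)) : exists c, hmx f = c%:M.
Proof.
exists (hmx f 0 0); have -> : (hmx f 0 0)%:M = hom_scale (hmx f 0 0) (hom_id (dualWeyl k n)).
  by rewrite /= scalemx1.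
apply: hom_row0_inj; apply/rowP=> j; rewrite !mxE.
have [->|nj] := eqVneq j 0; first by rewrite mulr1.
rewrite mulr0; apply/eqP; apply: contraNT nj => /(hom_weight (@torus_dualWeyl n) (@torus_dualWeyl
  n)).
by rewrite -val_eqE /=; have := ltn_ord j; rewrite /= => ? ?; apply/eqP; lia.
Qed.
End Weights.

Section SelfDual.
Variables (k : fieldType) (n : nat).
Notation V := (dualWeyl k n).

(* The invariant tensor (x ⊗ y - y ⊗ x)^n of V_n ⊗ V_n. *)
Definition form_mx : 'M[k]_n.+1 :=
  \matrix_(i, j) ((-1) ^+ i * 'C(n, i)%:R * (j == rev_ord i)%:R).

Lemma dualWeyl_wV (A : comNzRingType) (phi : {rmorphism k -> A}) (i j : 'I_n.+1) :
  ract V phi (\adj wmx) i j = (-1) ^+ j * (j == rev_ord i)%:R.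
Proof.
rewrite adj_mx2 /= !mxE /substx /substy !mxE /= scale0r add0r addr0 opprK.
rewrite -rmorphXn /= coefCM scale1r coefXn; congr (_ * (nat_of_bool _)%:R).
by rewrite -val_eqE /=; apply/eqP/eqP; have := ltn_ord i; have := ltn_ord j; lia.
Qed.

Lemma bin_mul_symm i l : (i + l <= n)%N -> ('C(n, i) * 'C(n - i, l) = 'C(n, l) * 'C(n - l, i))%N.
Proof.
move=> h; have h1 : (0 < i`! * l`! * (n - i - l)`!)%N by rewrite !muln_gt0 !fact_gt0.
have e a b : (a + b <= n)%N -> ('C(n, a) * 'C(n - a, b) * (a`! * b`! * (n - a - b)`!) = n`!)%N.
  move=> ab; have h2 : (a <= n)%N by lia.
  have h3 : (b <= n - a)%N by lia.
  by rewrite -(bin_fact h2) -(bin_fact h3); lia.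
apply/eqP; rewrite -(eqn_pmul2r h1) e //; apply/eqP.
by rewrite -(@e l i) 1?addnC // -!subnDA [(l + i)%N]addnC; lia.
Qed.

Lemma form_l : map_mx polyC form_mx *m lact (dual V) = lact V *m map_mx polyC form_mx.
Proof.
apply/matrixP=> i l; rewrite !mxE.
have EL j : lact (dual V) j l = (- 'X) ^+ (j - l) *+ 'C(j, l).
  by rewrite /lact /= /dual_act mxE adj_mx2 oppr0 -/(lmx _) [LHS]dualWeyl_l.
have ER j : lact V i j = 'X ^+ (j - i) *+ 'C(j, i).
  by rewrite /lact dualWeyl_l.
under eq_bigr => j _ do rewrite EL mxE mxE rmorphM rmorph_nat mulrAC.
rewrite sum_delta_ord.
under eq_bigr => j _ do rewrite ER mxE mxE [l == _]eq_sym (can2_eq rev_ordK rev_ordK) rmorphM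
  rmorph_nat mulrA.
rewrite sum_delta_ord /=.
have li : (l <= n)%N by have := ltn_ord l; rewrite ltnS.
have ii : (i <= n)%N by rewrite -ltnS.
rewrite !subSS (bin_sub li) !rmorphM !rmorphXn /= !rmorphN1 !rmorph_nat.
rewrite -[_ *+ 'C(n - i, l)]mulr_natr -[_ *+ 'C(n - l, i)]mulr_natr.
have [le_n|gt_n] := leqP (i + l) n; last first.
  by rewrite !(@bin_small (n - _)) ?mulr0 ?mul0r //; lia.
have En : (n - i - l = n - l - i)%N by lia.
rewrite En [(- 'X) ^+ _]exprNn.
rewrite (_ : (-1) ^+ (n - l) = (-1) ^+ i * (-1) ^+ (n - l - i) :> {poly k}); last first.
  by rewrite -exprD subnKC //; lia.
transitivity ((-1) ^+ i * (-1) ^+ (n - l - i) * 'X ^+ (n - l - i) * ('C(n, i) * 'C(n - i, l))%:R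
  : {poly k}).
  by rewrite natrM; ring.
by rewrite bin_mul_symm // natrM; ring.
Qed.

Lemma form_w : form_mx *m wact (dual V) = wact V *m form_mx.
Proof.
apply/matrixP=> i l; rewrite !mxE.
have EL j : wact (dual V) j l = (-1) ^+ j * (j == rev_ord l)%:R.
  by rewrite /wact /= /dual_act mxE [LHS]dualWeyl_wV.
have ER j : wact V i j = (-1) ^+ i * (j == rev_ord i)%:R.
  by rewrite dualWeyl_wact -mulr_natr [i == _]eq_sym (can2_eq rev_ordK rev_ordK).
under eq_bigr => j _ do rewrite EL mxE mulrAC.
rewrite sum_delta_ord.
under eq_bigr => j _ do rewrite ER mulrAC.
rewrite sum_delta_ord mxE rev_ordK /= subSS bin_sub -1?ltnS // (inj_eq rev_ord_inj).
by rewrite eq_sym; ring.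
Qed.

Definition form : hom (dual V) V := @hom_of_gen k (dual V) V form_mx form_w form_l.

Hypothesis bin_nz : forall i, (i <= n)%N -> 'C(n, i)%:R != 0 :> k.

Definition form_inv_mx : 'M[k]_n.+1 :=
  \matrix_(i, j) ((-1) ^+ j * ('C(n, j)%:R)^-1 * (j == rev_ord i)%:R).

Lemma form_mxV : form_mx *m form_inv_mx = 1%:M.
Proof.
apply/matrixP=> i l; rewrite !mxE.
under eq_bigr => j _ do rewrite mxE mulrAC.
rewrite sum_delta_ord mxE rev_ordK.
have [->|_] := eqVneq l i; rewrite ?mulr0 //.
rewrite !mulr1; transitivity (((-1) * (-1)) ^+ i * ('C(n, i)%:R / 'C(n, i)%:R) : k).
  by rewrite exprMn; ring.
by rewrite mulrNN mulr1 expr1n mul1r divff // bin_nz // -ltnS.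
Qed.

Definition form_inv : hom V (dual V) :=
  @hom_inv k (dual V) V form form_inv_mx form_mxV (mulmx1C form_mxV).
End SelfDual.

Lemma bin_pchar_neq0 (k : fieldType) p n i : p \in [pchar k] -> (n < p)%N -> (i <= n)%N ->
  'C(n, i)%:R != 0 :> k.
Proof.
move=> ch lt_np le_in; have p_pr := pcharf_prime ch.
apply/negP=> /eqP E; have : (n`!)%:R = 0 :> k by rewrite -(bin_fact le_in) natrM E mul0r.
rewrite fact_prod natr_prod => /eqP; rewrite prodf_seq_eq0 => /hasP[j].
rewrite mem_index_iota => /andP[j_gt0 le_j] /=; rewrite -(dvdn_pcharf ch).
by move/(dvdn_leq j_gt0); rewrite leqNgt (leq_ltn_trans _ lt_np).
Qed.

(** * Simple objects *)

Section VerCalculus.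
Variable k : fieldType.
Implicit Types X Y Z W : sl2rep k.

Lemma ver_eqP X Y (f g : hom X Y) :
  ver_eq f g <-> forall h : hom Y X, \tr (hmx h *m hmx f) = \tr (hmx h *m hmx g).
Proof.
by split=> E h; have := E h; rewrite /= mulmxBr linearB /= => /eqP;
  [rewrite subr_eq0 => /eqP | move=> /eqP ->; rewrite subrr].
Qed.

Lemma ver_eq_hmx X Y (f g : hom X Y) : hmx f = hmx g -> ver_eq f g.
Proof. by move=> E; apply/ver_eqP => h; rewrite E. Qed.

Lemma ver_eq_sym X Y (f g : hom X Y) : ver_eq f g -> ver_eq g f.
Proof. by move=> /ver_eqP E; apply/ver_eqP => h. Qed.

Lemma ver_eq_trans X Y (f g h : hom X Y) : ver_eq f g -> ver_eq g h -> ver_eq f h.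
Proof. by move=> /ver_eqP E /ver_eqP E'; apply/ver_eqP => u; rewrite E. Qed.

Lemma ver_eq_compl X Y Z (u : hom Y Z) (f g : hom X Y) :
  ver_eq f g -> ver_eq (hom_comp u f) (hom_comp u g).
Proof.
move=> /ver_eqP E; apply/ver_eqP => h; have := E (hom_comp h u).
by rewrite /= !mulmxA.
Qed.

Lemma ver_eq_compr X Y Z (u : hom X Y) (f g : hom Y Z) :
  ver_eq f g -> ver_eq (hom_comp f u) (hom_comp g u).
Proof.
move=> /ver_eqP E; apply/ver_eqP => h; have := E (hom_comp u h).
by rewrite /= -!mulmxA ![\tr (hmx u *m _)]mxtrace_mulC !mulmxA.
Qed.

(** Testing [f ⊗ 1] against [h] amounts to testing [f] against the partial trace of [h]; so
    negligible maps form a tensor ideal. *)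
Lemma ver_eq_tensl X Y W (f g : hom X Y) :
  ver_eq f g -> ver_eq (hom_tens f (hom_id W)) (hom_tens g (hom_id W)).
Proof.
move=> /ver_eqP E; apply/ver_eqP => h; have := E (ptr_hom h).
by rewrite /= -!ptr_mxMr !tr_ptr_mx.
Qed.

Lemma mul_reindexE m n l (s : 'I_m -> 'I_n) (M : 'M[k]_(l, n)) r c :
  (M *m reindex_mx k s) r c = M r (s c).
Proof. by rewrite mxE; under eq_bigr => i _ do rewrite mxE; rewrite sum_delta_ord. Qed.

Lemma reindex_mulE m n l (s : 'I_m -> 'I_n) t (M : 'M[k]_(m, l)) r c :
  cancel s t -> cancel t s -> (reindex_mx k s *m M) r c = M (t r) c.
Proof.
move=> st ts; rewrite mxE.
under eq_bigr => i _ do rewrite mxE eq_sym (can2_eq st ts) mulrC.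
by rewrite sum_delta_ord.
Qed.

Lemma swap_ixE m n (i : 'I_m) (j : 'I_n) : swap_ix (i ⊗ j) = j ⊗ i.
Proof. by rewrite /swap_ix mxtens_indexK. Qed.

Lemma braid_tens m m' n n' (A : 'M[k]_(m, n)) (B : 'M[k]_(m', n')) :
  reindex_mx k (@swap_ix m m') *m (A *t B) = (B *t A) *m reindex_mx k (@swap_ix n n').
Proof.
apply/matrixP=> r c; case: (mxtens_indexP r) => i i'; case: (mxtens_indexP c) => j j'.
rewrite (reindex_mulE _ _ _ (@swap_ixK _ _) (@swap_ixK _ _)) mul_reindexE !swap_ixE.
by rewrite !tensmxE mulrC.
Qed.

Lemma braid_inv m n : reindex_mx k (@swap_ix m n) *m reindex_mx k (@swap_ix n m) = 1%:M.
Proof.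
apply/matrixP=> r c; rewrite mul_reindexE !mxE.
by rewrite swap_ixK.
Qed.

Lemma ver_eq_tensr X Y W (f g : hom X Y) :
  ver_eq f g -> ver_eq (hom_tens (hom_id W) f) (hom_tens (hom_id W) g).
Proof.
move=> E.
have B (u : hom X Y) : hmx (hom_tens (hom_id W) u)
    = hmx (hom_comp (hom_comp (braid Y W) (hom_tens u (hom_id W))) (braid W X)).
  by rewrite /= braid_tens -mulmxA braid_inv mulmx1.
apply: (ver_eq_trans (ver_eq_hmx (B f))); apply: (ver_eq_trans _ (ver_eq_sym (ver_eq_hmx (B g)))).
exact/ver_eq_compr/ver_eq_compl/ver_eq_tensl.
Qed.

Lemma ver_eq_tens X Y X' Y' (f g : hom X Y) (f' g' : hom X' Y') :
  ver_eq f g -> ver_eq f' g' -> ver_eq (hom_tens f f') (hom_tens g g').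
Proof.
move=> E E'.
have B (u : hom X Y) (v : hom X' Y') : hmx (hom_tens u v)
    = hmx (hom_comp (hom_tens u (hom_id Y')) (hom_tens (hom_id X) v)).
  by rewrite /= tensmx_mul mul1mx mulmx1.
apply: (ver_eq_trans (ver_eq_hmx (B f f'))); apply: (ver_eq_trans _ (ver_eq_sym (ver_eq_hmx (B g
  g')))).
apply: (ver_eq_trans (ver_eq_compr _ (ver_eq_tensl E))).
exact/ver_eq_compl/ver_eq_tensr.
Qed.

End VerCalculus.

Section ZeroRep.
Variable k : fieldType.
Definition zrep : sl2rep k :=
  @Sl2Rep k 0 (fun A phi g => 0) (fun _ _ => esym (flatmx0 _)) (fun _ _ _ _ _ _ => esym (flatmx0 _))
    (fun _ _ _ _ _ _ _ _ => esym (flatmx0 _)).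
End ZeroRep.

(** * Approximations of [V_m] and direct summands of tilting modules *)

Section Covers.
Variables (k : fieldType) (p : nat).
Hypothesis p_char : p \in [pchar k].
Implicit Types X Y Q : sl2rep k.

Definition acyclic X : Prop := forall j, ext0 X (dualWeyl k j).

(** A right approximation of [V_m] by acyclic modules. *)
Definition covers m Q : Prop := exists pi : hom Q (dualWeyl k m),
  acyclic Q /\ forall X, acyclic X -> forall f : hom X (dualWeyl k m),
    exists F : hom X Q, pi *m F = f.

Lemma acyclic_dualWeyl n : (n < p)%N -> acyclic (dualWeyl k n).
Proof.
move=> lt_n j; have bnz i : (i <= n)%N -> 'C(n, i)%:R != 0 :> k := bin_pchar_neq0 p_char lt_n.
apply: (ext0_retract (a := form_inv bnz) (b := form k n) (form_mxV bnz)).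
exact: ext0_dualWeyl.
Qed.

Lemma covers_small m : (m < p)%N -> covers m (dualWeyl k m).
Proof.
move=> lt_m; exists (hom_id _); split=> [|X _ f]; first exact: acyclic_dualWeyl.
by exists f; rewrite mul1mx.
Qed.

(** Endomorphisms of [V_(p-1)] are scalars and its dimension [p] is 0 in [k]. Tensoring with the
    natural representation keeps all traces zero, since a trace on [Q ⊗ V] is that of a partial
    trace on [Q]. *)
Lemma covers_large d : exists Q, covers (d + p.-1) Q /\ forall f : hom Q Q, \tr (hmx f) = 0.
Proof.
have p_gt1 := prime_gt1 (pcharf_prime p_char).
case E : p.-1 => [|q]; first by move: E p_gt1; case: (p) => [|[]].
have pE : p = q.+2 by move: E p_gt1; case: (p) => //= ? ->.
elim: d => [|d [Q [[pi [aQ lQ]] nQ]]].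
  exists (dualWeyl k q.+1); split; first by apply: covers_small; rewrite pE.
  move=> f; have [c ->] := end_dualWeyl f; rewrite mxtrace_scalar.
  have p0 : q.+2%:R = 0 :> k by rewrite -pE (pcharf0 p_char).
  by rewrite -mulr_natr [X in _ * X]p0 mulr0.
exists (tens Q (natrep k)); split; last first.
  by move=> f; rewrite -(nQ (ptr_hom f)) /= tr_ptr_mx.
rewrite addSn addnS in pi lQ *.
exists (hom_comp (mult k (d + q).+1) (@hom_tens k _ _ (natrep k) (natrep k) pi (hom_id (natrep
  k)))).
split; first exact: acyclic_tensV.
by move=> X aX f; apply: lift_tensV lQ X aX f.
Qed.

Lemma hom_factor X Y Z n (i : hom Y Z) (q : hom Z n) r s (g : hom X Z) :
  split_exact i q r s -> q *m g = 0 -> exists g' : hom X Y, i *m g' = g.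
Proof.
move=> se qg; have [_ ri _ irsq] := se.
have irg : i *m (r *m g) = g.
  by rewrite mulmxA -[RHS]mul1mx -irsq mulmxDl -[s *m q *m g]mulmxA qg mulmx0 addr0.
have H (A : comNzRingType) (phi : {rmorphism k -> A}) (a : 'M[A]_2) : \det a = 1 ->
    map_mx phi (r *m g) *m ract X phi a = ract Y phi a *m map_mx phi (r *m g).
  move=> da; have [_ ri' _ _] := split_exact_map phi se.
  rewrite map_mxM -mulmxA hom_equiv // -{1}irg [map_mx phi (i *m _)]map_mxM.
  by rewrite [ract Z _ _ *m _]mulmxA -hom_equiv // !mulmxA ri' mul1mx map_mxM mulmxA.
by exists (Hom H).
Qed.

(** Induction along the filtration. The composite of [f] with the top quotient [V_m] factors through
    a cover [Q], and the map [Q -> V_m] lifts to the filtered module because [Q] is acyclic.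
    Subtracting leaves a map into the smaller submodule, and what passes through [Q] has trace 0, by
    assumption or because all traces on [Q] vanish. *)
Lemma trace_span X Y : acyclic X -> filtered (dualWeyl k) Y ->
  forall (f : hom X Y) (h : hom Y X),
  (forall m, (m <= p - 2)%N -> forall (u : hom X (dualWeyl k m)) (v : hom (dualWeyl k m) Y),
     \tr (hmx h *m (hmx v *m hmx u)) = 0) ->
  \tr (hmx h *m hmx f) = 0.
Proof.
move=> aX; elim=> {Y} [Y Y0 f h _|Y Z m i q fY IH se f h Hs].
  rewrite mxtrace_mulC /mxtrace big1 // => a; exfalso.
  by move: a; rewrite Y0 => -[].
have [r [s sp]] := short_exact_split se; have [qi ri qs irsq] := sp.
have [Q [[pi [aQ lQ]] HQ]] : exists Q, covers m Q /\
    (forall (u : hom X Q) (v : hom Q Z), \tr (hmx h *m (hmx v *m hmx u)) = 0).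
  have [le_m|lt_m] := leqP m (p - 2).
    exists (dualWeyl k m); split; last by move=> u v; apply: Hs.
    by apply: covers_small; have := prime_gt1 (pcharf_prime p_char); lia.
  have [Q [cQ nQ]] := covers_large (m - p.-1).
  rewrite subnK in cQ; last by lia.
  exists Q; split=> // u v.
  by rewrite mulmxA mxtrace_mulC mulmxA -(nQ (hom_comp (hom_comp u h) v)).
have [phi phiE] := lQ _ aX (hom_comp q f).
have [psi psiE] := lift_hom sp (ext0_filtered aQ fY) pi.
have [f' f'E] : exists f' : hom X Y, i *m f' = hom_sub f (hom_comp psi phi).
  by apply: hom_factor sp _; rewrite /= mulmxBr mulmxA psiE phiE subrr.
have fE : hmx f = psi *m phi + i *m f' by rewrite f'E /= addrC subrK.
rewrite fE mulmxDr linearD /= HQ add0r mulmxA.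
apply: (IH f' (hom_comp h i)) => m' le_m' u v /=.
by rewrite -[RHS](Hs m' le_m' u (hom_comp i v)) /= !mulmxA.
Qed.

(** If all composites [V_n -> X -> V_n] vanished, [trace_span] would make the identity of [X]
    negligible. A nonzero composite is a nonzero scalar and can be normalised to 1. *)
Lemma split_dualWeyl X : tilting X -> ~ ver_zero X -> exists n, (n <= p - 2)%N /\
  exists (i : hom (dualWeyl k n) X) (r : hom X (dualWeyl k n)), hmx r *m hmx i = 1%:M.
Proof.
move=> [fX fX'] nz.
have [[n [le_n [u [v nuv]]]]|no] := EM (exists n, (n <= p - 2)%N /\
    exists (u : hom X (dualWeyl k n)) (v : hom (dualWeyl k n) X), hmx u *m hmx v <> 0).
  exists n; split=> //; have [c cE] := end_dualWeyl (hom_comp u v).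
  exists v, (hom_scale c^-1 u); rewrite /= -scalemxAl [hmx u *m _]cE scale_scalar_mx mulVf //.
  by apply/eqP => c0; apply: nuv; rewrite [LHS]cE c0 raddf0.
case: nz; apply/ver_eqP => h; rewrite mulmx0 linear0.
apply: (trace_span (acyclic_filtered fX') fX) => m le_m u v.
rewrite mulmxA mxtrace_mulC mulmxA.
suff -> : hmx u *m hmx h *m hmx v = 0 by rewrite linear0.
by apply/eqP/negPn/negP => /eqP ne; apply: no; exists m; split=> //; exists (hom_comp u h), v.
Qed.

Lemma filtered_iso (M : nat -> sl2rep k) X n (f : hom X (M n)) N :
  f *m N = 1%:M -> N *m f = 1%:M -> filtered M X.
Proof.
move=> fN Nf.
have i0 (A : comNzRingType) (phi : {rmorphism k -> A}) (g : 'M[A]_2) : \det g = 1 ->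
    map_mx phi (0 : 'M[k]_(rdim X, 0)) *m ract (zrep k) phi g = ract X phi g *m map_mx phi 0.
  by move=> _; apply/matrixP=> ? [].
apply: (@filtered_cons _ _ (zrep k) X n (@Hom k (zrep k) X 0 i0) f); first exact: filtered_nil.
split=> /=; first by apply/row_fullP; exists 0; apply/matrixP=> -[].
  by apply/row_freeP; exists N.
rewrite (flatmx0 (_^T)) sub0mx /=.
suff /eqP -> : kermx (f^T) == 0 by rewrite sub0mx.
by rewrite kermx_eq0; apply/row_freeP; exists N^T; rewrite -trmx_mul Nf trmx1.
Qed.

Lemma tilting_dualWeyl n : (n < p)%N -> tilting (dualWeyl k n).
Proof.
move=> lt_n; have bnz i : (i <= n)%N -> 'C(n, i)%:R != 0 :> k := bin_pchar_neq0 p_char lt_n.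
split; first by apply: (@filtered_iso _ _ n (hom_id _) 1%:M); rewrite mulmx1.
apply: (@filtered_iso (fun n => dual (dualWeyl k n)) _ n (form_inv bnz) (form_mx k n)).
  exact: mulmx1C (form_mxV bnz).
exact: form_mxV.
Qed.

Lemma dualWeyl_nonzero n : (n < p.-1)%N -> ~ ver_zero (dualWeyl k n).
Proof.
move=> lt_n /ver_eqP/(_ (hom_id _)) /eqP; rewrite mulmx0 mulmx1 mxtrace1 linear0.
rewrite -(dvdn_pcharf p_char) => /dvdn_leq; rewrite /= => /(_ isT).
by move: lt_n; have := prime_gt1 (pcharf_prime p_char); case: (p) => //= q _ h; rewrite ltnNge h.
Qed.

Lemma simple_dualWeyl X : tilting X -> ver_length1 X -> exists n, (n <= p - 2)%N /\
  exists (i : hom (dualWeyl k n) X) (r : hom X (dualWeyl k n)),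
    hmx r *m hmx i = 1%:M /\ ver_eq (hom_comp i r) (hom_id X).
Proof.
move=> tX [nz sX]; have [n [le_n [i [r ri]]]] := split_dualWeyl tX nz.
have p_gt1 := prime_gt1 (pcharf_prime p_char).
exists n; split=> //; exists i, r; split=> //.
have [||/dualWeyl_nonzero|[h [_ ih]]] := sX _ _ i; first by apply: tilting_dualWeyl; lia.
- move=> Z tZ u v E.
  have R (w : hom Z (dualWeyl k n)) : ver_eq w (hom_comp r (hom_comp i w)).
    by apply: ver_eq_hmx; rewrite /= mulmxA ri mul1mx.
  apply: (ver_eq_trans (R u)); apply: (ver_eq_trans _ (ver_eq_sym (R v))).
  exact: ver_eq_compl.
- by case; lia.
(* In Ver_p, [i r] equals [i r (i h)], which is [i h] because [r i = 1], and [i h] is the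
   identity. *)
apply: (ver_eq_trans _ ih); apply: (ver_eq_trans (g := hom_comp (hom_comp i r) (hom_comp i h))).
  apply: (ver_eq_trans (g := hom_comp (hom_comp i r) (hom_id X))).
    by apply: ver_eq_hmx; rewrite /= mulmx1.
  exact/ver_eq_compl/ver_eq_sym.
by apply: ver_eq_hmx; rewrite /= !mulmxA -[i *m r *m i]mulmxA ri mulmx1.
Qed.
End Covers.

(** * The operators x_a d/dx_b *)

Section Polarization.
Variables (k : fieldType) (m : nat).
Notation V := (dualWeyl k m.+1).
Notation V' := (dualWeyl k m).
Notation nat2 := (natrep k).

(* v |-> d_x v ⊗ x + d_y v ⊗ y *)
Definition polar_mx : 'M[k]_(m.+1 * 2, m.+2) :=
  \matrix_(r, j) if (mxtens_unindex r).2 == 0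
    then j%:R * (j == (mxtens_unindex r).1.+1 :> nat)%:R
    else (m.+1 - j)%:R * (j == (mxtens_unindex r).1 :> nat)%:R.

Lemma polar_mxE (l : 'I_m.+1) (j : 'I_m.+2) :
  (polar_mx (l ⊗ 0) j = j%:R * (j == l.+1 :> nat)%:R) *
  (polar_mx (l ⊗ 1) j = (m.+1 - j)%:R * (j == l :> nat)%:R).
Proof. by rewrite !mxE !mxtens_indexK. Qed.

Lemma polar_subproof (A : comNzRingType) (phi : {rmorphism k -> A}) (g : 'M[A]_2) :
  \det g = 1 ->
  map_mx phi polar_mx *m ract V phi g = ract (tens V' nat2) phi g *m map_mx phi polar_mx.
Proof.
move=> _; apply/matrixP=> r j; case: (mxtens_indexP r) => l a.
have jm : (j <= m.+1)%N by rewrite -ltnS.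
pose P := substx g ^+ j * substy g ^+ (m.+1 - j).
pose P0 := substx g ^+ j.-1 * substy g ^+ (m.+1 - j) *+ j.
pose P1 := substx g ^+ j * substy g ^+ (m - j) *+ (m.+1 - j).
have dP : P^`() = g 0 0 *: P0 + g 0 1 *: P1.
  rewrite /P derivM !deriv_exp !derivD !derivC !derivZ !derivX !addr0 !alg_polyC.
  by rewrite (_ : (m.+1 - j).-1 = (m - j)%N) ?/P0 ?/P1 -?mul_polyC; [ring | lia].
(* Euler's relation. After setting [y = 1] only the derivative in [x] is visible; the one in [y] is
   recovered as [(m + 1) P - x P'], which [EX] computes. *)
have EP : P *+ m.+1 = P0 * substx g + P1 * substy g.
  have E0 : P0 * substx g = P *+ j.
    rewrite mulrnAl /P /P0; case: (nat_of_ord j) => [|j'] //=.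
    by rewrite exprSr; congr (_ *+ _); rewrite mulrAC.
  have E1 : P1 * substy g = P *+ (m.+1 - j).
    rewrite mulrnAl /P /P1; have [lt_jm|le_mj] := leqP j m.
      by rewrite subSn // exprSr; congr (_ *+ _); rewrite mulrA.
    by rewrite (_ : (m.+1 - j)%N = 0%N) ?mulr0n //; lia.
  by rewrite E0 E1 -mulrnDr subnKC.
have EX : P *+ m.+1 - P^`() * 'X = g 1 0 *: P0 + g 1 1 *: P1.
  by rewrite EP dP /substx /substy -!mul_polyC; ring.
have S0 : \sum_(i < m.+1) ract V' phi g l i * map_mx phi polar_mx (i ⊗ 0) j = P0`_l.
  have [j0|j_gt0] := posnP j.
    rewrite big1 => [|i _]; first by rewrite /P0 j0 mulr0n coef0.
    by rewrite [map_mx _ _ _ _]mxE polar_mxE j0 mul0r rmorph0 mulr0.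
  have lt_j : (j.-1 < m.+1)%N by lia.
  transitivity (\sum_(i < m.+1) ract V' phi g l i * j%:R * (i == Ordinal lt_j)%:R).
    apply: eq_bigr => i _; rewrite [map_mx _ _ _ _]mxE polar_mxE rmorphM !rmorph_nat mulrA;
      congr (_ * (nat_of_bool _)%:R).
    by rewrite -val_eqE /=; apply/eqP/eqP => [->|->] //; rewrite prednK.
  rewrite sum_delta_ord /= mxE /P0 coefMn mulr_natr /=.
  by rewrite (_ : (m - j.-1 = m.+1 - j)%N) //; lia.
have S1 : \sum_(i < m.+1) ract V' phi g l i * map_mx phi polar_mx (i ⊗ 1) j = P1`_l.
  have [lt_j|le_j] := ltnP j m.+1.
    transitivity (\sum_(i < m.+1) ract V' phi g l i * (m.+1 - j)%:R * (i == Ordinal lt_j)%:R).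
      apply: eq_bigr => i _; rewrite [map_mx _ _ _ _]mxE polar_mxE rmorphM !rmorph_nat mulrA;
        congr (_ * (nat_of_bool _)%:R).
      by rewrite -val_eqE /= eq_sym.
    by rewrite sum_delta_ord /= mxE /P1 coefMn mulr_natr.
  rewrite /P1 (_ : (m.+1 - j)%N = 0%N) ?mulr0n ?coef0; last by lia.
  rewrite big1 // => i _; rewrite [map_mx _ _ _ _]mxE polar_mxE (_ : (m.+1 - j)%N = 0%N) ?mul0r
    ?rmorph0 ?mulr0 //; lia.
have R : (ract (tens V' nat2) phi g *m map_mx phi polar_mx) (l ⊗ a) j = g a 0 * P0`_l + g a 1 *
  P1`_l.
  rewrite -S0 -S1 !mulr_sumr -big_split mxE sum_tens; apply: eq_bigr => i _.
  by rewrite big_ord2 /= /tens_act !tensmxE; ring.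
rewrite R; have rhoE i : ract V phi g i j = P`_i by rewrite mxE.
case: (ord2P a) => ->.
  rewrite mxE; under eq_bigr => i _ do rewrite [map_mx _ _ _ _]mxE polar_mxE rhoE rmorphM
    !rmorph_nat mulrAC.
  rewrite (sum_delta _ (fun i => i%:R * P`_i)) ltnS ltn_ord mulr1n mulr_natl -coef_deriv dP.
  by rewrite coefD !coefZ.
rewrite mxE; under eq_bigr => i _ do rewrite [map_mx _ _ _ _]mxE polar_mxE rhoE rmorphM
  !rmorph_nat mulrAC.
rewrite (sum_delta _ (fun i => (m.+1 - i)%:R * P`_i)) (ltnW (ltn_ord l : (l.+1 < m.+2)%N)) mulr1n.
have := congr1 (fun q : {poly A} => q`_l) EX; rewrite [in RHS]coefD !coefZ => <-.
rewrite coefB coefMn coefMX natrB; last by rewrite ltnW // ltnS -ltnS.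
case: (nat_of_ord l) => [|l'] /=; first by rewrite !subr0 mulr_natl.
by rewrite coef_deriv mulrBl !mulr_natl.
Qed.

Definition polar : hom V (tens V' nat2) := @Hom k V (tens V' nat2) polar_mx polar_subproof.
End Polarization.

Lemma ract_tensE (k : fieldType) (X Y : sl2rep k) (A : comNzRingType) (phi : {rmorphism k -> A})
    (g : 'M[A]_2) i j i' j' :
  ract (tens X Y) phi g (i ⊗ j) (i' ⊗ j') = ract X phi g i i' * ract Y phi g j j'.
Proof. exact: tensmxE. Qed.

Lemma ract_dualE (k : fieldType) (X : sl2rep k) (A : comNzRingType) (phi : {rmorphism k -> A})
    (g : 'M[A]_2) i j :
  ract (dual X) phi g i j = ract X phi (\adj g) j i.
Proof. by rewrite /= /dual_act mxE. Qed.

Section GlOperators.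
Variables (k : fieldType) (m h : nat).
Notation V := (dualWeyl k m.+1).
Notation V' := (dualWeyl k m).
Notation nat2 := (natrep k).

Definition mulop (a : 'I_2) : 'M[k]_(m.+2, m.+1) := \matrix_(l, j) mult_mx k m l (j ⊗ a).
Definition derop (b : 'I_2) : 'M[k]_(m.+1, m.+2) := \matrix_(l, j) polar_mx k m (l ⊗ b) j.

(* [glop a b] is x_a d/dx_b, [slop] its traceless part when m + 1 = 2 h. *)
Definition glop a b : 'M[k]_m.+2 := mulop a *m derop b.
Definition slop a b : 'M[k]_m.+2 := glop a b - (h%:R * (a == b)%:R)%:M.

Lemma glopE (i j : 'I_m.+2) :
  (glop 0 0 i j = j%:R * (i == j :> nat)%:R) *
  (glop 0 1 i j = (m.+1 - j)%:R * (i == j.+1 :> nat)%:R) *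
  (glop 1 0 i j = j%:R * (j == i.+1 :> nat)%:R) *
  (glop 1 1 i j = (m.+1 - j)%:R * (i == j :> nat)%:R).
Proof.
have lt_i : (i < m.+2)%N := ltn_ord i; have lt_j : (j < m.+2)%N := ltn_ord j.
do !split; rewrite mxE; under eq_bigr => l _ do rewrite !mxE !mxtens_indexK /= ?addn1 ?addn0.
- have [j0|j_gt0] := posnP j; first by rewrite j0 ?mulr0n ?mul0r big1 => [|l _];
  rewrite ?mul0r ?mulr0.
  transitivity (\sum_(l < m.+1) (i == l.+1 :> nat)%:R * j%:R * (l == j.-1 :> nat)%:R : k).
    apply: eq_bigr => l _; rewrite mulrA; congr (_ * (nat_of_bool _)%:R).
    by apply/eqP/eqP => [->|->] //; rewrite prednK.
  rewrite (sum_delta _ (fun l => (i == l.+1 :> nat)%:R * j%:R)) prednK //.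
  by rewrite (_ : (j <= m.+1)%N) // mulrC.
- under eq_bigr => l _ do rewrite mulrA [(_ == _ :> nat)]eq_sym [j == _ :> nat]eq_sym.
  rewrite (sum_delta _ (fun l => (l.+1 == i :> nat)%:R * (m.+1 - j)%:R)) mulrC eq_sym.
  have [//|le_j] := ltnP j m.+1; rewrite (_ : (m.+1 - j)%N = 0%N) ?mulr0n ?mul0r //; lia.
- have [j0|j_gt0] := posnP j; first by rewrite j0 ?mulr0n ?mul0r big1 => [|l _];
  rewrite ?mul0r ?mulr0.
  under eq_bigr => l _ do rewrite mulrA [j == _ :> nat]eq_sym.
  transitivity (\sum_(l < m.+1) (i == l :> nat)%:R * j%:R * (l == j.-1 :> nat)%:R : k).
    apply: eq_bigr => l _; congr (_ * (nat_of_bool _)%:R).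
    by apply/eqP/eqP => [<-|->] //; rewrite prednK.
  rewrite (sum_delta _ (fun l => (i == l :> nat)%:R * j%:R)) prednK //.
  rewrite (_ : (j <= m.+1)%N) // mulrC; congr (_ * (nat_of_bool _)%:R).
  by apply/eqP/eqP => [->|->] //; rewrite prednK.
- under eq_bigr => l _ do rewrite mulrA [j == _ :> nat]eq_sym.
  rewrite (sum_delta _ (fun l => (i == l :> nat)%:R * (m.+1 - j)%:R)) mulrC.
  have [//|le_j] := ltnP j m.+1; rewrite (_ : (m.+1 - j)%N = 0%N) ?mulr0n ?mul0r //; lia.
Qed.

Lemma slopE a c i j : slop a c i j = glop a c i j - h%:R * (a == c)%:R * (i == j)%:R.
Proof.
by rewrite /slop; move: (glop a c) => G; rewrite !mxE -[_ *+ (i == j)]mulr_natr.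
Qed.

Section Equivariance.
Variables (A : comNzRingType) (phi : {rmorphism k -> A}) (g : 'M[A]_2).
Hypothesis dg : \det g = 1.
Notation rho := (ract V phi g).
Notation rho' := (ract V' phi g).

Lemma mulop_equiv a : rho *m map_mx phi (mulop a)
  = \sum_c g c a *: (map_mx phi (mulop c) *m rho').
Proof.
apply/matrixP=> l j; have /matrixP/(_ l (j ⊗ a)) E := hom_equiv (mult k m) phi dg.
transitivity ((rho *m map_mx phi (mult_mx k m)) l (j ⊗ a)).
  by rewrite mxE [RHS]mxE; apply: eq_bigr => i _; rewrite ![map_mx phi _ _ _]mxE [mulop _ _ _]mxE.
rewrite -[LHS]E summxE mxE sum_tens exchange_big; apply: eq_bigr => c _.
rewrite mxE [X in _ = _ * X]mxE mulr_sumr; apply: eq_bigr => i _.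
by rewrite [ract _ _ _ _ _]tensmxE ![map_mx phi _ _ _]mxE [mulop _ _ _]mxE; ring.
Qed.

Lemma derop_equiv b : map_mx phi (derop b) *m rho
  = \sum_d g b d *: (rho' *m map_mx phi (derop d)).
Proof.
apply/matrixP=> l j; have /matrixP/(_ (l ⊗ b) j) E := hom_equiv (polar k m) phi dg.
transitivity ((map_mx phi (polar_mx k m) *m rho) (l ⊗ b) j).
  by rewrite mxE [RHS]mxE; apply: eq_bigr => i _; rewrite ![map_mx phi _ _ _]mxE [derop _ _ _]mxE.
rewrite [LHS]E summxE mxE sum_tens exchange_big; apply: eq_bigr => c _.
rewrite mxE [X in _ = _ * X]mxE mulr_sumr; apply: eq_bigr => i _.
by rewrite [ract _ _ _ _ _]tensmxE ![map_mx phi _ _ _]mxE [derop _ _ _]mxE; ring.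
Qed.

(** The operator [x_a d/dx_b] transforms like [e_a ⊗ e^b] in the natural representation tensored
    with its dual. *)
Lemma glop_equiv a b : rho *m map_mx phi (glop a b)
  = \sum_c \sum_d (g c a * \adj g b d) *: (map_mx phi (glop c d) *m rho).
Proof.
rewrite map_mxM mulmxA mulop_equiv mulmx_suml; apply: eq_bigr => c _.
have D : rho' *m map_mx phi (derop b) = \sum_d \adj g b d *: (map_mx phi (derop d) *m rho).
  have /matrixP Id := mul_adj_mx g; rewrite dg in Id.
  under eq_bigr => d _ do rewrite derop_equiv scaler_sumr.
  rewrite exchange_big /=.
  transitivity (\sum_e (b == e)%:R *: (rho' *m map_mx phi (derop e))).
    rewrite (bigD1 b) //= eqxx scale1r big1 ?addr0 // => e ne.
    by rewrite eq_sym (negbTE ne) scale0r.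
  apply: eq_bigr => e _; have := Id b e; rewrite !mxE => <-.
  by rewrite scaler_suml; apply: eq_bigr => d _; rewrite scalerA.
rewrite -scalemxAl -mulmxA D mulmx_sumr scaler_sumr; apply: eq_bigr => d _.
by rewrite -scalemxAr scalerA map_mxM !mulmxA.
Qed.

Lemma slop_equiv a b : rho *m map_mx phi (slop a b)
  = \sum_c \sum_d (g c a * \adj g b d) *: (map_mx phi (slop c d) *m rho).
Proof.
have /matrixP/(_ b a) := mul_adj_mx g; rewrite dg !mxE eq_sym => Id.
have EC (c d : 'I_2) : map_mx phi ((h%:R * (c == d)%:R)%:M : 'M_m.+2) = (h%:R * (c == d)%:R)%:M.
  by rewrite map_scalar_mx rmorphM !rmorph_nat.
transitivity (\sum_c \sum_d (g c a * \adj g b d) *: (map_mx phi (glop c d) *m rho)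
   - \sum_c \sum_d (g c a * \adj g b d) *: ((h%:R * (c == d)%:R)%:M *m rho)).
  rewrite map_mxB mulmxBr glop_equiv EC; congr (_ - _).
  rewrite mul_mx_scalar -Id mulr_sumr scaler_suml; apply: eq_bigr => c _.
  rewrite (bigD1 c) //= big1 ?addr0 => [|d nd].
    by rewrite eqxx mulr1 mul_scalar_mx scalerA; congr (_ *: _); ring.
  by rewrite eq_sym (negbTE nd) mulr0 mul_scalar_mx scale0r scaler0.
rewrite -sumrB; apply: eq_bigr => c _; rewrite -sumrB; apply: eq_bigr => d _.
by rewrite -scalerBr map_mxB EC mulmxBl.
Qed.
End Equivariance.

Notation N := (m.+2).
Notation W := (form_mx k m.+1).

(* The columns are the tensors (slop a b ⊗ 1)(form). *)
Definition sltens_mx : 'M[k]_(N * N, 2 * 2) := \matrix_(r, c)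
  (slop (mxtens_unindex c).1 (mxtens_unindex c).2 *m W) (mxtens_unindex r).1 (mxtens_unindex r).2.

Lemma sltens_mxE i j a b : sltens_mx (i ⊗ j) (a ⊗ b) = (slop a b *m W) i j.
Proof. by rewrite mxE !mxtens_indexK. Qed.

Lemma sltens_subproof (A : comNzRingType) (phi : {rmorphism k -> A}) (g : 'M[A]_2) :
  \det g = 1 -> map_mx phi sltens_mx *m ract (tens nat2 (dual nat2)) phi g
                = ract (tens V V) phi g *m map_mx phi sltens_mx.
Proof.
move=> dg; set rho := ract V phi g.
(* Equivariance of [form] restated as invariance of the tensor [W]. *)
have invW : rho *m map_mx phi W *m rho^T = map_mx phi W.
  have := hom_equiv (form k m.+1) phi dg; rewrite /= /dual_act => <-.
  rewrite -mulmxA -trmx_mul [rho *m _](_ : _ = 1%:M) ?trmx1 ?mulmx1 //.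
  by rewrite -[LHS](@ractM _ V) ?det_adj1 // mul_mx_adj dg ract1.
apply/matrixP=> r c; case: (mxtens_indexP r) => i j; case: (mxtens_indexP c) => a b.
transitivity ((rho *m map_mx phi (slop a b) *m (map_mx phi W *m rho^T)) i j).
  rewrite (slop_equiv phi dg) mulmx_suml summxE mxE sum_tens; apply: eq_bigr => c' _.
  rewrite mulmx_suml summxE; apply: eq_bigr => d' _.
  rewrite -scalemxAl -mulmxA [rho *m _]mulmxA invW -map_mxM [RHS]mxE [map_mx _ _ _ _]mxE.
  by rewrite sltens_mxE (ract_tensE (X := nat2) (Y := dual nat2)) (ract_dualE (X := nat2)) [X in
    _ = _ * X]mxE mulrC.
rewrite mulmxA -[_ *m _ *m map_mx phi W]mulmxA -map_mxM mxE [RHS]mxE sum_tens exchange_big.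
apply: eq_bigr => j' _; rewrite mxE mulr_suml; apply: eq_bigr => i' _.
by rewrite (ract_tensE (X := V) (Y := V)) ![map_mx phi _ _ _]mxE sltens_mxE [rho^T _ _]mxE; ring.
Qed.
Definition sltens : hom (tens nat2 (dual nat2)) (tens V V) :=
  @Hom k (tens nat2 (dual nat2)) (tens V V) _ sltens_subproof.

(** The coaction [v |-> sum e_c ⊗ e^d ⊗ E_dc v]. The indices are exchanged so that composing with
    [sltens] pairs [E_cd] with [E_dc], as in the Casimir element. *)
Definition slcoact_mx : 'M[k]_(2 * 2 * N, N) := \matrix_(r, l)
  let: (cd, q) := mxtens_unindex r in
  slop (mxtens_unindex cd).2 (mxtens_unindex cd).1 q l.

Lemma slcoact_mxE c d q l : slcoact_mx ((c ⊗ d) ⊗ q) l = slop d c q l.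
Proof. by rewrite mxE !mxtens_indexK. Qed.

Lemma slcoact_subproof (A : comNzRingType) (phi : {rmorphism k -> A}) (g : 'M[A]_2) :
  \det g = 1 -> map_mx phi slcoact_mx *m ract V phi g
                = ract (tens (tens nat2 (dual nat2)) V) phi g *m map_mx phi slcoact_mx.
Proof.
move=> dg; set rho := ract V phi g.
apply/matrixP=> r l; case: (mxtens_indexP r) => cd q; case: (mxtens_indexP cd) => c d.
have gadj := mul_mx_adj g; rewrite dg in gadj.
pose Y e f := (map_mx phi (slop e f) *m rho) q l.
transitivity (Y d c).
  rewrite mxE [RHS]mxE; apply: eq_bigr => i _.
  by rewrite ![map_mx phi _ _ _]mxE slcoact_mxE.
have EY e f : \sum_q' rho q q' * map_mx phi (slop e f) q' l
    = \sum_c' \sum_d' g c' e * \adj g f d' * Y c' d'.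
  transitivity ((rho *m map_mx phi (slop e f)) q l); first by rewrite mxE.
  rewrite (slop_equiv phi dg) summxE; apply: eq_bigr => c' _.
  by rewrite summxE; apply: eq_bigr => d' _; rewrite mxE.
have -> : (ract (tens (tens nat2 (dual nat2)) V) phi g *m map_mx phi slcoact_mx) ((c ⊗ d) ⊗ q) l
    = \sum_c' \sum_d' g c c' * \adj g d' d * (\sum_e \sum_f g e d' * \adj g c' f * Y e f).
  rewrite mxE sum_tens sum_tens; apply: eq_bigr => c' _; apply: eq_bigr => d' _.
  rewrite -EY mulr_sumr; apply: eq_bigr => q' _.
  rewrite (ract_tensE (X := tens nat2 (dual nat2)) (Y := V)) (ract_tensE (X := nat2) (Y := dual
    nat2)).
  by rewrite (ract_dualE (X := nat2)) ![map_mx phi _ _ _]mxE slcoact_mxE -!mulrA.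
transitivity (\sum_e \sum_f (g *m \adj g) c f * (g *m \adj g) e d * Y e f).
  rewrite gadj; under eq_bigr => e _ do (under eq_bigr => f _ do rewrite !mxE).
  rewrite (bigD1 d) //= [X in _ + X]big1 ?addr0 => [|e ne]; last first.
    by rewrite big1 // => f _; rewrite (negbTE ne) mulr0 mul0r.
  rewrite (bigD1 c) //= big1 ?addr0 ?eqxx ?mulr1 ?mul1r // => f nf.
  by rewrite eq_sym (negbTE nf) !mul0r.
by rewrite !big_ord2 ![(_ *m _) _ _]mxE !big_ord2; ring.
Qed.
Definition slcoact : hom V (tens (tens nat2 (dual nat2)) V) :=
  @Hom k V (tens (tens nat2 (dual nat2)) V) _ slcoact_subproof.
End GlOperators.
Global Opaque slop.

(** * Brackets on V_n *)

Section LieOperators.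
Variable k : fieldType.
Implicit Types X Y : sl2rep k.

(** The raising operator, as the linear term of the generic upper unipotent. *)
Definition eop X : 'M[k]_(rdim X) := map_mx (coefp 1) (ract X polyC (umx 'X)).
Definition fop X : 'M[k]_(rdim X) := lcoef X 1.

Lemma hom_eop X Y (f : hom X Y) : f *m eop X = eop Y *m f.
Proof.
apply/matrixP=> i j; have /matrixP/(_ i j) := hom_equiv f polyC (det_umx 'X).
move/(congr1 (coefp 1)) => /=; rewrite !mxE !coef_sum => E.
transitivity (\sum_l (map_mx polyC f i l * ract X polyC (umx 'X) l j)`_1).
  by apply: eq_bigr => l _; rewrite !mxE coefCM.
by rewrite E; apply: eq_bigr => l _; rewrite !mxE coefMC.
Qed.

Lemma hom_fop X Y (f : hom X Y) : f *m fop X = fop Y *m f.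
Proof. exact: hom_lcoef. Qed.

(** The Leibniz rule behind the action of a Lie algebra element on a tensor product. *)
Lemma coefp1_tens m n (P : 'M[{poly k}]_m) (Q : 'M[{poly k}]_n) :
  map_mx (coefp 0) P = 1%:M -> map_mx (coefp 0) Q = 1%:M ->
  map_mx (coefp 1) (P *t Q) = map_mx (coefp 1) P *t 1%:M + 1%:M *t map_mx (coefp 1) Q.
Proof.
move=> <- <-; apply/matrixP=> r c; case: (mxtens_indexP r) => i i'; case: (mxtens_indexP c) => j j'.
rewrite !mxE !mxtens_indexK /= coefM !big_ord_recl big_ord0 /= addr0 addrC.
by [].
Qed.

Lemma coef0_umx X : map_mx (coefp 0) (ract X polyC (umx 'X)) = 1%:M.
Proof.
have := ract_u X idfun 0; rewrite (_ : umx 0 = 1%:M) ?mx2_1 // -mx2_1 ract1 => ->.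
apply/matrixP=> i j; rewrite !mxE -[X in evalm _ X]/(idfun 0) evalm_const /=.
by rewrite horner_coef0.
Qed.

Lemma eop_tens X Y : eop (tens X Y) = eop X *t 1%:M + 1%:M *t eop Y.
Proof. exact: coefp1_tens (coef0_umx X) (coef0_umx Y). Qed.

Lemma fop_tens X Y : fop (tens X Y) = fop X *t 1%:M + 1%:M *t fop Y.
Proof. exact: coefp1_tens (lcoef0 X) (lcoef0 Y). Qed.

Lemma eop_dualWeyl n (i j : 'I_n.+1) :
  eop (dualWeyl k n) i j = (n - j)%:R * (i == j.+1 :> nat)%:R.
Proof.
rewrite mxE [ract _ _ _ _ _]dualWeyl_u /=.
have [lt_ij|le_ji] := ltnP i j; first by rewrite coef0 (ltn_eqF (ltn_trans lt_ij _)) ?mulr0.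
rewrite coefMn coefXn mulr_natr.
have [->|ne] := eqVneq (nat_of_ord i) j.+1; first by rewrite subSnn bin1 mulr1n.
by rewrite (_ : (1 == i - j)%N = false) ?mul0rn ?mulr0n //; apply/negbTE/eqP; lia.
Qed.

Lemma fop_dualWeyl n (i j : 'I_n.+1) :
  fop (dualWeyl k n) i j = j%:R * (j == i.+1 :> nat)%:R.
Proof.
rewrite [LHS]dualWeyl_lcoef addn1 mulr_natr.
by have [->|_] := eqVneq (nat_of_ord j) i.+1; rewrite ?binSn ?mulr0n.
Qed.

Opaque eop fop.

Lemma tr_fop_eop n : \tr (fop (dualWeyl k n) *m eop (dualWeyl k n))
  = \sum_(j < n.+1) (n - j)%:R * j.+1%:R.
Proof.
apply: eq_bigr => j _; rewrite mxE.
transitivity (\sum_(i < n.+1) (i%:R * (i == j.+1 :> nat)%:R * (n - j)%:R) * (i == j.+1 :> nat)%:R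
  : k).
  apply: eq_bigr => i _; rewrite -[RHS]mulrA.
  exact: (congr2 *%R (fop_dualWeyl j i) (eop_dualWeyl i j)).
rewrite (sum_delta _ (fun i => i%:R * (i == j.+1 :> nat)%:R * (n - j)%:R)) eqxx mulr1 mulrC.
have [//|le_j] := ltnP j.+1 n.+1.
by rewrite (_ : n - j = 0)%N ?mulr0n ?mul0r //; apply/eqP; rewrite subn_eq0.
Qed.
End LieOperators.
Global Opaque eop fop.

Lemma br_weight (k : fieldType) n (b : hom (tens (dualWeyl k n) (dualWeyl k n)) (dualWeyl k n))
    (l i j : 'I_n.+1) : hmx b l (i ⊗ j) != 0 -> (2 * (i + j) = n + 2 * l)%N.
Proof.
move/(hom_weight (torus_tens (@torus_dualWeyl k n) (@torus_dualWeyl k n)) (@torus_dualWeyl k n)).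
rewrite !mxtens_indexK /=.
have := ltn_ord i; have := ltn_ord j; have := ltn_ord l; rewrite /= !ltnS => *; lia.
Qed.

Section Brackets.
Variables (k : fieldType) (p n : nat).
Hypothesis p_char : p \in [pchar k].
Hypothesis lt_np : (n < p)%N.
Notation V := (dualWeyl k n).
Implicit Type b : hom (tens V V) V.

Lemma natr_lt_neq0 i : (0 < i < p)%N -> i%:R != 0 :> k.
Proof.
case/andP=> i_gt0 lt_i; rewrite -(dvdn_pcharf p_char); apply/negP => /(dvdn_leq i_gt0).
by rewrite leqNgt lt_i.
Qed.

(** No vector is raised to [y^n], so row 0 of [b] annihilates the image of the raising operator on
    [V ⊗ V]. *)
Lemma br_row0_rel b (i j : 'I_n.+1) (hi : (i.+1 < n.+1)%N) (hj : (j.+1 < n.+1)%N) :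
  (n - i)%:R * hmx b 0 (Ordinal hi ⊗ j) + (n - j)%:R * hmx b 0 (i ⊗ Ordinal hj) = 0.
Proof.
have /matrixP/(_ 0 (i ⊗ j)) := hom_eop b.
rewrite [RHS]mxE big1 => [|l _]; last first.
  by rewrite eop_dualWeyl /= mulr0 mul0r.
rewrite eop_tens mulmxDr mxE mul_tensmx1E mul_tens1mxE => <-.
congr (_ + _).
  transitivity (\sum_a hmx b 0 (a ⊗ j) * (n - i)%:R * (a == Ordinal hi)%:R).
    by rewrite sum_delta_ord mulrC.
  by apply: eq_bigr => a _; rewrite eop_dualWeyl mulrA.
transitivity (\sum_a hmx b 0 (i ⊗ a) * (n - j)%:R * (a == Ordinal hj)%:R).
  by rewrite sum_delta_ord mulrC.
by apply: eq_bigr => a _; rewrite eop_dualWeyl mulrA.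
Qed.

(** Weights leave in row 0 only the entries with [2 (i + j) = n]. By [br_row0_rel] the entry at
    [(i + 1, j)] follows from the one at [(i, j + 1)], as [n - i] is invertible modulo [p]. For odd
    [n] the assumption is vacuous and [b] is 0. *)
Lemma br_zero b : (forall j : 'I_n.+1, (2 * j = n)%N -> hmx b 0 (0 ⊗ j) = 0) -> hmx b = 0.
Proof.
move=> b0.
have H i (hi : (i < n.+1)%N) j : hmx b 0 (Ordinal hi ⊗ j) = 0.
  elim: i hi j => [|i IH] hi j.
    have [/eqP E|/eqP nE] := boolP (2 * j == n)%N.
      by rewrite -(b0 j E); congr (hmx b 0 (_ ⊗ _)); apply: val_inj.
    by apply/eqP; apply: contra_notT nE => /br_weight /=; rewrite add0n muln0 addn0.
  apply/eqP; apply: contraT => nz; have E : (2 * (i.+1 + j) = n + 2 * 0)%N := br_weight nz.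
  have hj : (j.+1 < n.+1)%N by lia.
  have hi' : (i < n.+1)%N by apply: ltnW.
  have := @br_row0_rel b (Ordinal hi') j hi hj; rewrite IH mulr0 addr0 => /eqP.
  have ni : (0 < n - i < p)%N by lia.
  by rewrite mulf_eq0 (negbTE nz) orbF (negbTE (natr_lt_neq0 ni)).
apply: (hom_row0_inj (f := b) (g := hom_zero _ _)).
apply/rowP=> r; case: (mxtens_indexP r) => i j; rewrite !mxE.
by case: i => i hi; apply: H.
Qed.

Lemma br_unique b b' : hmx b <> 0 -> exists nu, hmx b' = nu *: hmx b.
Proof.
move=> nz; have [[j [jn bj]]|no] := EM (exists j : 'I_n.+1, (2 * j = n)%N /\ hmx b 0 (0 ⊗ j) != 0).
  pose nu := hmx b' 0 (0 ⊗ j) / hmx b 0 (0 ⊗ j); exists nu.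
  apply/eqP; rewrite -subr_eq0; apply/eqP.
  apply: (@br_zero (hom_sub b' (hom_scale nu b))) => j' jn'.
  have -> : j' = j by apply: val_inj => /=; lia.
  by rewrite !mxE /nu mulfVK // subrr.
case: nz; apply: br_zero => j jn; apply/eqP/negPn/negP => bj.
by apply: no; exists j.
Qed.
End Brackets.

Section Contraction.
Variable k : fieldType.
Implicit Types X Y Z : sl2rep k.

Definition contr X Y : hom (tens (dual X) (tens X Y)) Y :=
  hom_comp (hom_comp (lunit Y) (hom_tens (ev X) (hom_id Y))) (assoc_inv (dual X) X Y).

Lemma contrE X Y l (i a : 'I_(rdim X)) (q : 'I_(rdim Y)) :
  hmx (contr X Y) l (i ⊗ (a ⊗ q)) = (i == a)%:R * (l == q)%:R.
Proof.
rewrite /contr /= mul_reindexE assoc_inv_ixE.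
rewrite (reindex_mulE _ _ _ (@lunit_ixK _) (@lunit_inv_ixK _)) /lunit_inv_ix tensmxE !mxE.
by rewrite mxtens_indexK.
Qed.

Lemma cycE X l (M : 'M[k]_(l, rdim X * rdim X * rdim X)) r i j q :
  (M *m hmx (cyc X)) r ((i ⊗ j) ⊗ q) = M r ((q ⊗ i) ⊗ j).
Proof.
by rewrite /cyc /= mulmxA mul_reindexE swap_ixE mul_reindexE assoc_inv_ixE.
Qed.

Lemma jacobiE X (b : hom (tens X X) X) l i j q :
  hmx (hom_comp (hom_comp b (hom_tens b (hom_id X)))
        (hom_add (hom_add (hom_id _) (cyc X)) (hom_comp (cyc X) (cyc X)))) l ((i ⊗ j) ⊗ q)
  = \sum_r (hmx b r (i ⊗ j) * hmx b l (r ⊗ q) + hmx b r (q ⊗ i) * hmx b l (r ⊗ j)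
            + hmx b r (j ⊗ q) * hmx b l (r ⊗ i)).
Proof.
have bb x y z : (hmx b *m (hmx b *t 1%:M)) l ((x ⊗ y) ⊗ z) = \sum_r hmx b r (x ⊗ y) * hmx b l (r
  ⊗ z).
  by rewrite mul_tensmx1E; apply: eq_bigr => r _; rewrite mulrC.
transitivity ((hmx b *m (hmx b *t 1%:M) *m
  (1%:M + hmx (cyc X) + hmx (cyc X) *m hmx (cyc X))) l ((i ⊗ j) ⊗ q)) => //.
have gen s t (M : 'M[k]_(s, t)) (C : 'M_t) : M *m (1%:M + C + C *m C) = M + M *m C + M *m C *m C.
  by rewrite !mulmxDr mulmx1 mulmxA.
rewrite !big_split -!bb gen mxE [X in X + _]mxE.
congr (_ + _ + _); first exact: cycE.
exact: etrans (cycE _ _ _ _ _) (cycE _ _ _ _ _).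
Qed.
End Contraction.

(** * The Killing form of a bracket on [V_(2h)] *)

Section KillingForm.
Variables (k : fieldType) (p m h : nat).
Hypothesis p_char : p \in [pchar k].
Hypothesis nh : m.+1 = (h + h)%N.
Hypothesis h_gt1 : (1 < h)%N.
Hypothesis lt_np : (m.+2 < p)%N.
Notation N := m.+2.
Notation V := (dualWeyl k m.+1).
Notation W := (form_mx k m.+1).
Notation sl := (slop k m h).
Variable b : hom (tens V V) V.

Definition ad (i : 'I_N) : 'M[k]_N := \matrix_(l, q) hmx b l (i ⊗ q).

(** The Leibniz rule in the form [[z, ad v] = ad (z v)] on basis vectors. *)
Definition derivation (z : 'M[k]_N) : Prop :=
  forall i, z *m ad i - ad i *m z = \sum_l z l i *: ad l.

Lemma derivationN z : derivation z -> derivation (- z).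
Proof.
move=> D i; rewrite mulNmx mulmxN -opprD D -sumrN; apply: eq_bigr => l _.
by rewrite mxE scaleNr.
Qed.

Lemma derivation_hom z : hmx b *m (z *t 1%:M + 1%:M *t z) = z *m hmx b -> derivation z.
Proof.
move=> E i; apply/matrixP=> l q; have /matrixP/(_ l (i ⊗ q)) := E.
rewrite mulmxDr mxE mul_tensmx1E mul_tens1mxE !mxE summxE => E1.
have -> : \sum_j z l j * ad i j q = \sum_j z l j * hmx b j (i ⊗ q).
  by apply: eq_bigr => j _; rewrite mxE.
rewrite -E1; have -> : \sum_j ad i l j * z j q = \sum_j hmx b l (i ⊗ j) * z j q.
  by apply: eq_bigr => j _; rewrite mxE.
by rewrite addrK; apply: eq_bigr => j _; rewrite !mxE mulrC.
Qed.

Lemma slop00 i j : sl 0 0 i j = (j%:R - h%:R) * (i == j)%:R.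
Proof. by rewrite slopE glopE eqxx mulr1 -mulrBl. Qed.

Lemma slop11 : sl 1 1 = - sl 0 0.
Proof.
apply/matrixP=> i j; rewrite [RHS]mxE slop00 slopE glopE eqxx mulr1 -mulrBl -mulNr.
have jn : (j <= m.+1)%N by rewrite -ltnS.
have nE : m.+1%:R = h%:R + h%:R :> k by rewrite nh natrD.
by congr (_ * _); rewrite natrB // nE; ring.
Qed.

Lemma slop01 : sl 0 1 = eop V.
Proof.
apply/matrixP=> i j; rewrite slopE glopE /= mulr0 mul0r subr0.
by rewrite [RHS]eop_dualWeyl.
Qed.

Lemma slop10 : sl 1 0 = fop V.
Proof.
apply/matrixP=> i j; rewrite slopE glopE /= mulr0 mul0r subr0.
by rewrite [RHS]fop_dualWeyl.
Qed.

(** For the off-diagonal operators, which are [eop] and [fop], this is the equivariance of [b]; for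
    the diagonal ones it is conservation of weight, [m.+1] being [2 h]. *)
Lemma slop_derivation a c : derivation (sl a c).
Proof.
have D00 : derivation (sl 0 0).
  move=> i; apply/matrixP=> l q; rewrite !mxE summxE.
  under eq_bigr => j _ do rewrite slop00 mulrAC eq_sym.
  rewrite sum_delta_ord.
  under [X in _ - X]eq_bigr => j _ do rewrite slop00 mulrA.
  rewrite sum_delta_ord.
  under eq_bigr => j _ do rewrite mxE slop00 mulrAC.
  rewrite sum_delta_ord !mxE.
  have [->|nz] := eqVneq (hmx b l (i ⊗ q)) 0; first by rewrite !(mulr0, mul0r) subrr.
  have E := br_weight nz; rewrite [_ * (q%:R - _)]mulrC -mulrBl; congr (_ * _).
  have : (i + q)%:R = (h + l)%:R :> k by congr _%:R; move: E nh; lia.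
  by rewrite !natrD => E1; rewrite -[i%:R](addrK q%:R) E1; ring.
case: (ord2P a) => ->; case: (ord2P c) => ->; rewrite ?slop11 ?slop01 ?slop10 //.
- by apply: derivation_hom; have := hom_eop b; rewrite eop_tens.
- by apply: derivation_hom; have := hom_fop b; rewrite fop_tens.
- exact: derivationN.
Qed.

Definition killing : 'M[k]_N := \matrix_(i, j) \tr (ad i *m ad j).

Lemma killing_inv z : derivation z -> z^T *m killing = - (killing *m z).
Proof.
move=> D; apply/eqP; rewrite -subr_eq0 opprK; apply/eqP/matrixP=> i j.
rewrite mxE [in RHS]mxE.
have -> : (z^T *m killing) i j = \tr ((z *m ad i - ad i *m z) *m ad j).
  rewrite D mulmx_suml raddf_sum mxE; apply: eq_bigr => l _.
  by rewrite !mxE /= -scalemxAl mxtraceZ.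
have -> : (killing *m z) i j = \tr (ad i *m (z *m ad j - ad j *m z)).
  rewrite D mulmx_sumr raddf_sum mxE; apply: eq_bigr => l _.
  by rewrite !mxE /= -scalemxAr mxtraceZ mulrC.
rewrite mulmxBl mulmxBr !raddfB /= !mulmxA addrA subrK.
by rewrite [\tr (z *m _ *m _)]mxtrace_mulC !mulmxA -[ad i *m ad j *m z]mulmxA [\tr (ad i *m (ad j
  *m z))]mxtrace_mulC -!mulmxA mxtrace_mulC -!mulmxA subrr.
Qed.

(** Equivariance of [b] gives that [ad (g v)] is the conjugate of [ad v] by [g], and traces are
    invariant under conjugation. *)
Lemma killing_subproof (A : comNzRingType) (phi : {rmorphism k -> A}) (g : 'M[A]_2) :
  \det g = 1 ->
  map_mx phi killing *m ract V phi g = ract (dual V) phi g *m map_mx phi killing.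
Proof.
move=> dg; set rho := ract V phi g; pose rho' := ract V phi (\adj g).
have rr : rho *m rho' = 1%:M by rewrite /rho /rho' -ractM ?det_adj1 // mul_mx_adj dg ract1.
pose adA i : 'M[A]_N := map_mx phi (ad i).
have adj i : \sum_l rho l i *: adA l = rho *m adA i *m rho'.
  rewrite -[LHS]mulmx1 -rr mulmxA; congr (_ *m _).
  apply/matrixP=> l q; have /matrixP/(_ l (i ⊗ q)) := hom_equiv b phi dg.
  rewrite mxE sum_tens [in RHS]mxE => E.
  transitivity (\sum_j ract V phi g l j * map_mx phi (hmx b) j (i ⊗ q)).
    rewrite -E mxE exchange_big; apply: eq_bigr => j _.
    rewrite summxE mulr_suml; apply: eq_bigr => i' _.
    by rewrite (ract_tensE (X := V) (Y := V)) !mxE -/rho mulrCA mulrA.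
  by rewrite mxE; apply: eq_bigr => j _; rewrite [map_mx _ _ _ _]mxE [adA i _ _]mxE [ad _ _ _]mxE.
have inv : rho^T *m map_mx phi killing *m rho = map_mx phi killing.
  apply/matrixP=> i j; rewrite -mulmxA mxE [RHS]mxE [killing _ _]mxE.
  transitivity (\tr ((rho *m adA i *m rho') *m (rho *m adA j *m rho'))).
    rewrite -!adj mulmx_suml raddf_sum; apply: eq_bigr => l _ /=.
    rewrite mxE -scalemxAl mxtraceZ mulmx_sumr raddf_sum; congr (_ * _).
    rewrite mxE; apply: eq_bigr => l' _ /=; rewrite -scalemxAr mxtraceZ mulrC; congr (_ * _).
    rewrite [map_mx _ _ _ _]mxE [killing _ _]mxE.
    by rewrite /adA -map_mxM -trace_map_mx.
  have r'r : rho' *m rho = 1%:M by rewrite /rho /rho' -ractM ?det_adj1 // mul_adj_mx dg ract1.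
  rewrite !mulmxA -[_ *m rho' *m rho]mulmxA r'r mulmx1 mxtrace_mulC !mulmxA r'r mul1mx.
  by rewrite /adA -map_mxM -trace_map_mx.
rewrite -[LHS]mul1mx -(trmx1 A N) -rr trmx_mul /= /dual_act -/rho' -!mulmxA.
by congr (_ *m _); rewrite mulmxA inv.
Qed.
Definition killing_hom : hom V (dual V) := @Hom k V (dual V) killing killing_subproof.

Lemma killing_scalar : exists c, W *m killing = c%:M.
Proof. exact: (end_dualWeyl (hom_comp (form k m.+1) killing_hom)). Qed.

(** The signs [(-1)^i] and [(-1)^(n - i)] agree because [n = m.+1] is even. *)
Lemma form_sym : W^T = W.
Proof.
apply/matrixP=> i j; rewrite !mxE eq_sym (can2_eq rev_ordK rev_ordK).
have [->|_] := eqVneq j (rev_ord i); last by rewrite !mulr0.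
have in' : (i <= m.+1)%N by rewrite -ltnS.
rewrite /= subSS (bin_sub in') !mulr1; congr (_ * _).
have on : odd m.+1 = false by rewrite nh addnn odd_double.
by rewrite -signr_odd oddB // on addFb signr_odd.
Qed.

(* The Casimir element acts on V_(2h) by the scalar 2h(h + 1). *)
Lemma casimir_trace :
  \sum_(c < 2) \sum_(d < 2) \tr (sl c d *m sl d c) = (m.+2 * (2 * (h * h.+1)))%:R.
Proof.
have T0 : \tr (sl 0 0 *m sl 0 0) = \sum_(j < N) (j%:R - h%:R) ^+ 2 :> k.
  apply: eq_bigr => j _; rewrite mxE.
  under eq_bigr => i _ do rewrite !slop00 mulrA [j == i]eq_sym.
  by rewrite sum_delta_ord eqxx mulr1 expr2.
have T1 := tr_fop_eop k m.+1.
(* Reversing one of the two equal sums makes the total summand independent of [j]. *)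
have T2 : \sum_(j < N) (m.+1 - j)%:R * j.+1%:R = \sum_(j < N) j%:R * (m.+1 - j).+1%:R :> k.
  rewrite [LHS](reindex_inj rev_ord_inj); apply: eq_bigr => j _ /=.
  by rewrite subSS subKn // -ltnS.
have T1' : \tr (eop V *m fop V) = \sum_(j < N) (m.+1 - j)%:R * j.+1%:R.
  exact: etrans (mxtrace_mulC _ _) T1.
rewrite big_ord2 !(big_ord2 (fun d => \tr _)) slop11 slop01 slop10 mulNmx mulmxN opprK.
rewrite [LHS](congr2 +%R (congr2 +%R T0 T1') (congr2 +%R T1 T0)).
rewrite {2}T2 addrC !addrA -!big_split /=.
rewrite (eq_bigr (fun=> (2 * (h * h.+1))%:R)) => [|j _].
  by rewrite sumr_const card_ord [RHS]natrM mulr_natl.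
have jn : (j <= m.+1)%N by rewrite -ltnS.
have nE : m.+1%:R = h%:R + h%:R :> k by rewrite nh natrD.
rewrite -[(m.+1 - j).+1%:R]natr1 -[j.+1%:R]natr1 natrB // nE !natrM -[h.+1%:R]natr1; ring.
Qed.

(** Every factor is positive and less than [p], since [2 h + 1 < p]. *)
Lemma two_h_neq0 : (m.+2 * (2 * (h * h.+1)))%:R != 0 :> k.
Proof.
rewrite !natrM !mulf_neq0 //; apply: (natr_lt_neq0 p_char); lia.
Qed.

Hypothesis b_skew : forall l i j, hmx b l (i ⊗ j) = - hmx b l (j ⊗ i).
Hypothesis b_jacobi : forall u : hom V (tens (tens V V) V),
  \tr (hmx u *m hmx (hom_comp (hom_comp b (hom_tens b (hom_id V)))
        (hom_add (hom_add (hom_id _) (cyc V)) (hom_comp (cyc V) (cyc V))))) = 0.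

Let sl_b : hom (tens (natrep k) (dual (natrep k))) V := hom_comp b (sltens k m h).

Lemma torus_natrep : @torus_diag k (natrep k) (fun i => (i == 0 :> nat)%N) (fun i => (i == 1 :>
  nat)%N).
Proof.
move=> A phi s t i j; rewrite /= mxE.
by case: (ord2P i) => ->; case: (ord2P j) => ->; rewrite /= ?expr0 ?expr1 ?mul1r ?mulr1 ?mulr1n
  ?mulr0n.
Qed.

Lemma torus_dual_natrep :
  @torus_diag k (dual (natrep k)) (fun i => (i == 1 :> nat)%N) (fun i => (i == 0 :> nat)%N).
Proof.
move=> A phi s t i j; rewrite /= /dual_act adj_mx2 oppr0 !mxE.
by case: (ord2P i) => ->; case: (ord2P j) => ->; rewrite /= ?expr0 ?expr1 ?mul1r ?mulr1 ?mulr1n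
  ?mulr0n.
Qed.

(* 2h > 2 is not a weight of [natrep ⊗ dual natrep]. *)
Lemma sl_b_eq0 : hmx sl_b = 0.
Proof.
apply: (hom_row0_inj (f := sl_b) (g := hom_zero _ _)); apply/rowP=> r.
case: (mxtens_indexP r) => i j; rewrite mxE [RHS]mxE [RHS]mxE; apply/eqP; apply: contraT.
move/(hom_weight (torus_tens torus_natrep torus_dual_natrep) (@torus_dualWeyl k m.+1)).
rewrite !mxtens_indexK /= subn0; move: nh h_gt1.
by case: (ord2P i) => ->; case: (ord2P j) => ->; rewrite /=; lia.
Qed.

(* Contracting the Jacobi identity with the Casimir element, viewed as a map
   V -> V ⊗ V ⊗ V: the bracket of its first two legs is 0 by [sl_b_eq0], and the
   other two terms give the trace of the Casimir element paired with the Killing form. *)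
Lemma killing_scalar0 : W *m killing = 0.
Proof.
have [c cE] := killing_scalar; suff c0 : c = 0 by rewrite cE c0 raddf0.
pose u : hom V (tens (tens V V) V) :=
  hom_comp (@hom_tens k _ _ V V (sltens k m h) (hom_id V)) (slcoact k m h).
have uE i j q l : hmx u ((i ⊗ j) ⊗ q) l = \sum_c \sum_d (sl c d *m W) i j * sl d c q l.
  rewrite [hmx u _ _]tensmx1_mulE sum_tens; apply: eq_bigr => c' _; apply: eq_bigr => d' _.
  by rewrite [hmx (sltens _ _ _) _ _]sltens_mxE [hmx (slcoact _ _ _) _ _]slcoact_mxE.
(* With its third argument left open and antisymmetry used, the Jacobi expression is [ad [v_i, v_j]
   - [ad v_i, ad v_j]]. *)
pose Jm i j : 'M[k]_N := \sum_r hmx b r (i ⊗ j) *: ad r + (ad j *m ad i - ad i *m ad j).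
have JE l i j q : hmx (hom_comp (hom_comp b (hom_tens b (hom_id V)))
        (hom_add (hom_add (hom_id _) (cyc V)) (hom_comp (cyc V) (cyc V)))) l ((i ⊗ j) ⊗ q) = Jm i
          j l q.
  rewrite jacobiE !big_split /= -addrA /Jm mxE summxE; congr (_ + _).
    by apply: eq_bigr => r _; rewrite !mxE.
  rewrite mxE [in RHS]mxE [X in _ = _ + X]mxE [X in _ = _ - X]mxE -sumrN; congr (_ + _).
    by apply: eq_bigr => r _; rewrite !mxE (b_skew r q i) (b_skew l r j) mulrNN mulrC.
  by apply: eq_bigr => r _; rewrite !mxE (b_skew l r i) mulrN mulrC.
have part c' d' : \sum_i \sum_j (sl c' d' *m W) i j * \tr (Jm i j *m sl d' c') = - (c * \tr (sl
  c' d' *m sl d' c')).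
  set s := sl c' d'; set z := sl d' c'.
  have tJ i j : \tr (Jm i j *m z) = \sum_r \tr (ad r *m z) * hmx b r (i ⊗ j) + (killing *m z) i j.
    rewrite mulmxDl raddfD mulmx_suml raddf_sum /=; congr (_ + _).
      by apply: eq_bigr => r _; rewrite -scalemxAl mxtraceZ mulrC.
    (* Cyclicity of the trace shifts the commutator onto [z], which acts as a derivation. *)
    transitivity (\tr (ad i *m (z *m ad j - ad j *m z))).
      have trE (a a' y : 'M[k]_N) : \tr ((a' *m a - a *m a') *m y) = \tr (a *m (y *m a' - a' *m y)).
        by rewrite mulmxBl mulmxBr !raddfB /= -mulmxA mxtrace_mulC -!mulmxA.
      exact: trE.
    rewrite (slop_derivation d' c' j) mulmx_sumr raddf_sum mxE; apply: eq_bigr => l _.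
    by rewrite [killing _ _]mxE /= -scalemxAr mxtraceZ mulrC.
  under eq_bigr => i _ do (under eq_bigr => j _ do rewrite tJ mulrDr).
  under eq_bigr => i _ do rewrite big_split /=.
  rewrite big_split /= [X in X + _](_ : _ = 0) ?add0r.
    transitivity (\tr ((s *m W)^T *m (killing *m z))).
      rewrite [RHS]/mxtrace exchange_big; apply: eq_bigr => j _; rewrite mxE.
      by apply: eq_bigr => i _; rewrite [(s *m W)^T _ _]mxE.
    (* Symmetry of [W] and invariance of the Killing form bring [W *m killing], the scalar [c],
       together. *)
    rewrite trmx_mul form_sym -mulmxA [s^T *m _]mulmxA (killing_inv (slop_derivation c' d')).
    by rewrite mulNmx mulmxN -mulmxA mulmxA cE mul_scalar_mx raddfN /= mxtraceZ.
  transitivity (\sum_r \tr (ad r *m z) * hmx sl_b r (c' ⊗ d')); last first.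
    by rewrite big1 // => r _; rewrite sl_b_eq0 mxE mulr0.
  under eq_bigr => i _ do (under eq_bigr => j _ do rewrite mulr_sumr).
  under eq_bigr => i _ do rewrite exchange_big /=.
  rewrite exchange_big; apply: eq_bigr => r _; rewrite /= mxE sum_tens mulr_sumr.
  apply: eq_bigr => i _; rewrite mulr_sumr; apply: eq_bigr => j _.
  by rewrite sltens_mxE mulrCA [X in _ * X]mulrC.
have swap4 (I J I' J' : finType) (F : I -> J -> I' -> J' -> k) :
    \sum_i \sum_j \sum_i' \sum_j' F i j i' j' = \sum_i' \sum_j' \sum_i \sum_j F i j i' j'.
  under eq_bigr => i _ do rewrite exchange_big.
  rewrite exchange_big; apply: eq_bigr => i' _ /=.
  under eq_bigr => i _ do rewrite exchange_big.
  exact: exchange_big.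
have := b_jacobi u; rewrite mxtrace_mulC => /eqP.
rewrite [X in X == 0](_ : _ = - (c * (m.+2 * (2 * (h * h.+1)))%:R)).
  by rewrite oppr_eq0 mulf_eq0 (negbTE two_h_neq0) orbF => /eqP.
rewrite -casimir_trace mulr_sumr -sumrN.
transitivity (\sum_i \sum_j \sum_c' \sum_d' (sl c' d' *m W) i j * \tr (Jm i j *m sl d' c')).
  rewrite [LHS]/mxtrace.
  under eq_bigr => l _ do rewrite mxE sum_tens sum_tens.
  rewrite exchange_big; apply: eq_bigr => i _; rewrite exchange_big; apply: eq_bigr => j _ /=.
  transitivity (\sum_l \sum_q \sum_c' \sum_d' (sl c' d' *m W) i j * (Jm i j l q * sl d' c' q l)).
    apply: eq_bigr => l _; apply: eq_bigr => q _.
    rewrite JE uE mulr_sumr; apply: eq_bigr => c' _.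
    by rewrite mulr_sumr; apply: eq_bigr => d' _; rewrite mulrCA.
  rewrite swap4; apply: eq_bigr => c' _; apply: eq_bigr => d' _.
  rewrite [\tr _]/mxtrace mulr_sumr; apply: eq_bigr => l _.
  by rewrite [(Jm i j *m _) l l]mxE mulr_sumr.
rewrite swap4; apply: eq_bigr => c' _; rewrite mulr_sumr -sumrN; apply: eq_bigr => d' _.
exact: part.
Qed.
End KillingForm.

(* Self-duality of V turns a map V -> V ⊗ V into a bracket, hence into a multiple of
   [b], and its pairing with [b] into a contraction of the Killing form. *)
Lemma killing0_negligible (k : fieldType) (p m : nat)
    (b : hom (tens (dualWeyl k m.+1) (dualWeyl k m.+1)) (dualWeyl k m.+1)) :
  p \in [pchar k] -> (m.+1 < p)%N -> form_mx k m.+1 *m killing b = 0 ->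
  ver_eq b (hom_zero _ _).
Proof.
move=> p_char lt_mp WK; set V := dualWeyl k m.+1; set W := form_mx k m.+1.
have bnz i : (i <= m.+1)%N -> 'C(m.+1, i)%:R != 0 :> k by exact: bin_pchar_neq0 p_char lt_mp.
pose B := form_inv_mx k m.+1; have BW : B *m W = 1%:M := mulmx1C (form_mxV bnz).
have K0 : killing b = 0 by rewrite -[LHS]mul1mx -BW -mulmxA WK mulmx0.
apply/ver_eqP => d; rewrite mulmx0 raddf0 mxtrace_mulC.
have [->|b_nz] := EM (hmx b = 0); first by rewrite mul0mx raddf0.
pose d' : hom (tens V V) V := hom_comp (contr V V) (hom_tens (form_inv bnz) d).
have [nu dE] := br_unique p_char lt_mp d' b_nz.
have [C CE dC] : exists2 C : 'M[k]_(m.+2, m.+2 * (m.+2 * m.+2)),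
    (forall l i a q, C l (i ⊗ (a ⊗ q)) = (i == a)%:R * (l == q)%:R)
    & hmx d' = C *m (B *t hmx d).
  by exists (hmx (contr V V)) => [l i a q|]; [exact: (contrE (X := V) (Y := V))|].
have d'E l i q : hmx d' l (i ⊗ q) = \sum_a B a i * hmx d (a ⊗ l) q.
  rewrite dC mxE sum_tens; apply: eq_bigr => a _.
  rewrite sum_tens (bigD1 a) //= [X in _ + X]big1 ?addr0 => [|a' na']; last first.
    by rewrite big1 // => q' _; rewrite CE [a == _]eq_sym (negbTE na') !mul0r.
  rewrite (bigD1 l) //= big1 ?addr0 => [|q' nq']; last first.
    by rewrite CE [l == _]eq_sym (negbTE nq') mulr0 mul0r.
  by rewrite CE !eqxx !mul1r tensmxE.
(* The duality is undone with [B *m W = 1], which expresses [d] through the bracket [d'], that is,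
   [nu] times [b]. *)
have dE' a l q : hmx d (a ⊗ l) q = nu * \sum_i hmx b l (i ⊗ q) * W i a.
  transitivity (\sum_i hmx d' l (i ⊗ q) * W i a); last first.
    by rewrite mulr_sumr; apply: eq_bigr => i _; rewrite dE mxE mulrA.
  under eq_bigr => i _ do rewrite d'E mulr_suml.
  rewrite exchange_big /=.
  transitivity (\sum_a' hmx d (a' ⊗ l) q * (a' == a)%:R); first by rewrite sum_delta_ord.
  apply: eq_bigr => a' _; have /matrixP/(_ a' a) := BW; rewrite !mxE => <-.
  by rewrite mulr_sumr; apply: eq_bigr => i _; rewrite mulrAC mulrC.
transitivity (nu * \sum_a \sum_i W i a * killing b a i); last first.
  by rewrite big1 ?mulr0 // => a _; rewrite big1 // => i _; rewrite K0 [X in _ * X]mxE mulr0.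
have KE a i : killing b a i = \sum_q \sum_l hmx b q (a ⊗ l) * hmx b l (i ⊗ q).
  by rewrite mxE; apply: eq_bigr => q _; rewrite mxE; apply: eq_bigr => l _; rewrite !mxE.
rewrite /mxtrace; under eq_bigr => q _ do rewrite mxE sum_tens.
rewrite exchange_big mulr_sumr; apply: eq_bigr => a _ /=.
under [in RHS]eq_bigr => i _ do rewrite KE mulr_sumr.
rewrite [in RHS]exchange_big mulr_sumr; apply: eq_bigr => q _ /=.
under [in RHS]eq_bigr => i _ do rewrite mulr_sumr.
rewrite [in RHS]exchange_big mulr_sumr; apply: eq_bigr => l _ /=.
rewrite dE' mulrCA; congr (_ * _); rewrite mulr_sumr; apply: eq_bigr => i _.
by ring.
Qed.

(** * Transport of structure and classification *)

Section Transport.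
Variable k : fieldType.

Lemma cyc_mulE (X : sl2rep k) l (M : 'M[k]_(rdim X * rdim X * rdim X, l)) i j q c :
  (hmx (cyc X) *m M) ((i ⊗ j) ⊗ q) c = M ((j ⊗ q) ⊗ i) c.
Proof.
rewrite /cyc /= -mulmxA (reindex_mulE _ _ _ (@assoc_inv_ixK _ _ _) (@assoc_ixK _ _ _)).
by rewrite assoc_ixE (reindex_mulE _ _ _ (@swap_ixK _ _) (@swap_ixK _ _)) swap_ixE.
Qed.

Lemma cyc_tens (X Y : sl2rep k) (f : 'M[k]_(rdim Y, rdim X)) :
  hmx (cyc Y) *m ((f *t f) *t f) = ((f *t f) *t f) *m hmx (cyc X).
Proof.
apply/matrixP=> r c; case: (mxtens_indexP r) => ij q; case: (mxtens_indexP ij) => i j.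
case: (mxtens_indexP c) => ab d; case: (mxtens_indexP ab) => a b.
by rewrite cyc_mulE cycE !tensmxE; ring.
Qed.

Definition cyc_sum (X : sl2rep k) : hom (tens (tens X X) X) (tens (tens X X) X) :=
  hom_add (hom_add (hom_id _) (cyc X)) (hom_comp (cyc X) (cyc X)).

Lemma cyc_sum_tens (X Y : sl2rep k) (f : 'M[k]_(rdim Y, rdim X)) :
  hmx (cyc_sum Y) *m ((f *t f) *t f) = ((f *t f) *t f) *m hmx (cyc_sum X).
Proof.
have gen m n (P : 'M[k]_m) (Q : 'M[k]_n) (F : 'M[k]_(m, n)) : P *m F = F *m Q ->
    (1%:M + P + P *m P) *m F = F *m (1%:M + Q + Q *m Q).
  by move=> E; rewrite !mulmxDl !mulmxDr mul1mx mulmx1 -mulmxA E mulmxA E -mulmxA.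
exact/gen/cyc_tens.
Qed.

Variables (g : alg k) (V : sl2rep k).
Variables (i : hom V (alg_obj g)) (r : hom (alg_obj g) V).
Hypotheses (ri : hmx r *m hmx i = 1%:M) (ir : ver_eq (hom_comp i r) (hom_id (alg_obj g))).

(** Here [r i = 1] holds exactly but [i r = 1] only modulo negligible maps: [V] is a summand with
    negligible complement. *)
Definition transport : alg k :=
  Alg (hom_comp (hom_comp r (alg_br g)) (hom_tens i i)).

Lemma transport_iso : alg_iso g transport.
Proof.
exists r; split.
  by exists i; split=> //; apply: ver_eq_hmx.
have E : ver_eq (hom_comp (hom_comp r (alg_br g)) (hom_tens (hom_comp i r) (hom_comp i r)))
               (hom_comp r (alg_br g)).
  apply: ver_eq_trans (ver_eq_compl _ (ver_eq_tens ir ir)) _; apply: ver_eq_hmx.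
  by rewrite /= tens1mx1 mulmx1.
apply: ver_eq_trans (ver_eq_sym E) _; apply: ver_eq_hmx.
by rewrite /= -!mulmxA tensmx_mul.
Qed.

Lemma transport_lie : tilting V -> operadic_lie g -> operadic_lie transport.
Proof.
move=> tV [_ sk jac]; split=> //=.
  apply: ver_eq_trans (ver_eq_trans (ver_eq_compr (hom_tens i i) (ver_eq_compl r sk)) _).
    by apply: ver_eq_hmx; rewrite /= -!mulmxA braid_tens.
  by apply: ver_eq_hmx; rewrite /= mulmxN mulNmx.
set b := alg_br g; pose i3 := hom_tens (hom_tens i i) i.
(* The inner factor [i r] is the identity only in Ver_p, so the two double brackets are compared up
   to negligible maps. *)
have E1 : ver_eq (hom_comp (hom_comp (hom_comp r b) (hom_tens i i))
                   (hom_tens (hom_comp (hom_comp r b) (hom_tens i i)) (hom_id V)))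
                 (hom_comp (hom_comp r (hom_comp b (hom_tens b (hom_id _)))) i3).
  apply: (@ver_eq_trans _ _ _ _ (hom_comp (hom_comp (hom_comp r b)
      (hom_tens (hom_comp i r) (hom_id _))) (hom_comp (hom_tens b (hom_id _)) i3))).
    apply: ver_eq_hmx; rewrite /= -!mulmxA !tensmx_mul; congr (_ *m (_ *m (_ *t _))).
      by rewrite !mulmxA.
    by rewrite !mul1mx mulmx1.
  apply: ver_eq_trans (ver_eq_compr _ (ver_eq_compl _ (ver_eq_tensl ir))) _.
  by apply: ver_eq_hmx; rewrite /= tens1mx1 mulmx1 -!mulmxA.
apply: ver_eq_trans (ver_eq_compr _ E1) _.
apply: ver_eq_trans (ver_eq_trans (ver_eq_compr i3 (ver_eq_compl r jac)) _).
  apply: ver_eq_hmx.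
  have gen (a c d e : nat) (R : 'M[k]_(a, c)) (N : 'M_(c, d)) (I : 'M_(d, e)) (P : 'M_d) (Q :
    'M_e) :
      P *m I = I *m Q -> R *m (N *m P) *m I = R *m N *m I *m Q.
    by move=> PI; rewrite -!mulmxA PI.
  by symmetry; apply/gen/cyc_sum_tens.
by apply: ver_eq_hmx; rewrite /= mulmx0 mul0mx.
Qed.
End Transport.

(** * Vanishing of the bracket for [n] different from 2 *)

Section Classification.
Variables (k : fieldType) (p : nat).
Hypothesis p_char : p \in [pchar k].

(** Brackets form a line, so braiding multiplies [b] by some [nu] with [nu ^+ 2 = 1]. As [nu = 1]
    would make [2 b] negligible, antisymmetry holds exactly. *)
Lemma br_skew n (b : hom (tens (dualWeyl k n) (dualWeyl k n)) (dualWeyl k n)) :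
  (n < p)%N -> 2%:R != 0 :> k -> ~ ver_eq b (hom_zero _ _) ->
  ver_eq (hom_comp b (braid _ _)) (hom_opp b) ->
  forall l i j, hmx b l (i ⊗ j) = - hmx b l (j ⊗ i).
Proof.
move=> lt_np nz2 nb sk; set V := dualWeyl k n.
have nz : hmx b <> 0 by move=> b0; apply: nb; apply: ver_eq_hmx.
have [nu nuE] := br_unique p_char lt_np (hom_comp b (braid V V)) nz.
have bE l i j : hmx b l (j ⊗ i) = nu * hmx b l (i ⊗ j).
  have /matrixP/(_ l (i ⊗ j)) := nuE; rewrite [LHS]mul_reindexE swap_ixE => ->.
  by rewrite mxE.
have [l [i [j lij]]] : exists l i j, hmx b l (i ⊗ j) != 0.
  apply: contrapT => no; apply: nz; apply/matrixP=> l r; case: (mxtens_indexP r) => i j.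
  by rewrite [RHS]mxE; apply/eqP; apply: contraT => ne; case: no; exists l, i, j.
have : nu ^+ 2 == 1.
  have := bE l j i; rewrite (bE l i j) mulrA -expr2 => E.
  by apply/eqP; apply: (mulIf lij); rewrite mul1r -E.
rewrite sqrf_eq1 => /orP[] /eqP nu1 {lij} {}l {}i {}j; last by rewrite bE nu1 mulN1r.
case: nb; apply/ver_eqP => h; have /ver_eqP/(_ h) := sk.
rewrite nuE nu1 scale1r mulmx0 raddf0 mulmxN raddfN /= => /eqP.
by rewrite -addr_eq0 -mulr2n -mulr_natl mulf_eq0 (negbTE nz2) => /eqP.
Qed.

(** With structure constant [c], antisymmetry says [2 c = 0] and Jacobi says [3 c^2 = 0]; together
    they give [c = 0] in every characteristic, 2 and 3 included. The trace test multiplies [c] by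
    the entry [e] of [d]. *)
Lemma lie_dualWeyl0 b : operadic_lie (Alg b) ->
  ver_eq b (hom_zero (tens (dualWeyl k 0) (dualWeyl k 0)) (dualWeyl k 0)).
Proof.
case=> /= _ sk jac; apply/ver_eqP => d; rewrite mulmx0 raddf0.
set V := dualWeyl k 0.
apply: contrapT => /eqP nz.
pose c := hmx b 0 (0 ⊗ 0); pose e := hmx d (0 ⊗ 0) 0.
have trd (M : 'M[k]_(1, 1 * 1)) : \tr (hmx d *m M) = M 0 (0 ⊗ 0) * e.
  by rewrite mxtrace_mulC /mxtrace big_ord1 mxE sum_tens !big_ord1.
have c2 : c * e + c * e = 0.
  move: sk => /ver_eqP/(_ d); rewrite !trd mul_reindexE swap_ixE => /eqP.
  by rewrite [(- hmx b) _ _]mxE mulNr -addr_eq0 => /eqP.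
(* The entry of this test map is [e ^+ 2], so the Jacobi identity becomes a relation in the product
   [c * e]. *)
pose u : hom V (tens (tens V V) V) := hom_comp (hom_tens d (hom_id V)) d.
have tru (M : 'M[k]_(1, 1 * 1 * 1)) : \tr (hmx u *m M) = M 0 ((0 ⊗ 0) ⊗ 0) * (e * e).
  rewrite mxtrace_mulC /mxtrace big_ord1 mxE sum_tens sum_tens !big_ord1; congr (_ * _).
  by rewrite tensmx1_mulE big_ord1.
have c3 : c * e * (c * e) + c * e * (c * e) + c * e * (c * e) = 0.
  move: jac => /ver_eqP/(_ u); rewrite mulmx0 raddf0 => <-.
  rewrite tru (_ : (_ : 'M_(1, _)) 0 _ = c * c + c * c + c * c); first by ring.
  by rewrite [LHS](jacobiE b (0 : 'I_1) (0 : 'I_1) (0 : 'I_1) (0 : 'I_1)) big_ord1.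
have nz' : c * e != 0 by move: nz; rewrite trd.
by move/eqP: c3; rewrite -mulrDl c2 mul0r add0r mulf_eq0 (negbTE nz').
Qed.

Lemma lie_dualWeyl n (b : hom (tens (dualWeyl k n) (dualWeyl k n)) (dualWeyl k n)) :
  (n <= p - 2)%N -> n != 2%N -> operadic_lie (Alg b) -> ver_eq b (hom_zero _ _).
Proof.
move=> le_np n2 lie_b; have p_gt1 : (1 < p)%N := prime_gt1 (pcharf_prime p_char).
have lt_np : (n < p)%N by lia.
apply: contrapT => nb.
have [h nh] : exists h, n = (h + h)%N.
  (* For odd [n] there is no middle index [j], and [br_zero] applies vacuously. *)
  apply: contrapT => no; apply: nb; apply: ver_eq_hmx; apply: (br_zero p_char lt_np) => j jn.
  by case: no; exists j; rewrite addnn -mul2n.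
case: n => [|m] in b le_np n2 lie_b lt_np nb nh *; first by apply: nb; apply: lie_dualWeyl0.
case: lie_b => /= _ sk /ver_eqP jac.
have h_gt1 : (1 < h)%N by move: n2; lia.
have lt_mp : (m.+2 < p)%N by lia.
have nz2 : 2%:R != 0 :> k by apply: (natr_lt_neq0 p_char); lia.
have b_skew := br_skew lt_np nz2 nb sk.
apply: nb; apply: (killing0_negligible p_char lt_np).
apply: (killing_scalar0 p_char nh h_gt1 lt_mp b_skew) => u.
by rewrite jac mulmx0 raddf0.
Qed.
End Classification.

(** * sl_2 *)

Section GeneralLinear.
Variables (k : fieldType) (X : sl2rep k).
Notation d := (rdim X).
Notation gX := (tens X (dual X)).

Lemma gl_mulE (x y a b c e : 'I_d) :
  hmx (gl_mul X) (x ⊗ y) ((a ⊗ b) ⊗ (c ⊗ e)) = (x == a)%:R * (b == c)%:R * (y == e)%:R.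
Proof.
transitivity ((((1%:M : 'M[k]_d) *t hmx (contr X (dual X))) *m reindex_mx k (@assoc_ix d d (d * d)))
  (x ⊗ y) ((a ⊗ b) ⊗ (c ⊗ e))) => //.
rewrite mul_reindexE assoc_ixE tensmxE [_%:M _ _]mxE -mulrA.
by congr (_ * _); apply: (contrE (X := X) (Y := dual X)).
Qed.

Lemma gl_brE (x y a b c e : 'I_d) :
  hmx (alg_br (gl X)) (x ⊗ y) ((a ⊗ b) ⊗ (c ⊗ e))
  = (x == a)%:R * (b == c)%:R * (y == e)%:R - (x == c)%:R * (e == a)%:R * (y == b)%:R.
Proof.
transitivity ((hmx (gl_mul X) - hmx (gl_mul X) *m reindex_mx k (@swap_ix (d * d) (d * d)))
  (x ⊗ y) ((a ⊗ b) ⊗ (c ⊗ e))) => //.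
rewrite mxE [X in _ + X]mxE gl_mulE; congr (_ - _).
by rewrite mul_reindexE swap_ixE gl_mulE.
Qed.

Lemma gl_braid : hmx (hom_comp (alg_br (gl X)) (braid gX gX)) = - hmx (alg_br (gl X)).
Proof.
have gen m n (M : 'M[k]_(m, n)) S : S *m S = 1%:M -> (M - M *m S) *m S = - (M - M *m S).
  by move=> SS; rewrite mulmxBl opprB -mulmxA SS mulmx1.
exact/gen/braid_inv.
Qed.

Lemma gl_traceE o (x y : 'I_d) : hmx (gl_trace X) o (x ⊗ y) = (x == y)%:R.
Proof. by rewrite /= mul_reindexE swap_ixE mxE mxtens_indexK eq_sym. Qed.

Lemma gl_trace_br : hmx (hom_comp (gl_trace X) (alg_br (gl X))) = 0.
Proof.
apply/matrixP=> o r; case: (mxtens_indexP r) => ab ce.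
case: (mxtens_indexP ab) => a b; case: (mxtens_indexP ce) => c e.
transitivity (\sum_x \sum_y hmx (gl_trace X) o (x ⊗ y)
   * hmx (alg_br (gl X)) (x ⊗ y) ((a ⊗ b) ⊗ (c ⊗ e))); first by rewrite mxE sum_tens.
transitivity (\sum_x ((b == c)%:R * (x == e)%:R * (x == a)%:R
   - (e == a)%:R * (x == b)%:R * (x == c)%:R) : k).
  apply: eq_bigr => x _; under eq_bigr => y _ do rewrite gl_traceE gl_brE mulrC [x == y]eq_sym.
  by rewrite sum_delta_ord; ring.
rewrite sumrB !sum_delta_ord mxE [a == e]eq_sym [c == b]eq_sym mulrC subrr //.
Qed.

Lemma gl_jacobi :
  hmx (hom_comp (hom_comp (alg_br (gl X)) (hom_tens (alg_br (gl X)) (hom_id gX)))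
        (hom_add (hom_add (hom_id _) (cyc gX)) (hom_comp (cyc gX) (cyc gX)))) = 0.
Proof.
pose dl (u v : 'I_d) : k := (u == v)%:R.
have T (x y a b c e f h : 'I_d) :
    \sum_r hmx (alg_br (gl X)) r ((a ⊗ b) ⊗ (c ⊗ e)) * hmx (alg_br (gl X)) (x ⊗ y) (r ⊗ (f ⊗ h))
  = dl b c * (dl x a * dl e f * dl y h - dl x f * dl h a * dl y e)
    - dl e a * (dl x c * dl b f * dl y h - dl x f * dl h c * dl y b).
  rewrite sum_tens.
  transitivity (\sum_s \sum_t (dl b c * (dl x s * dl t f * dl y h - dl x f * dl h s * dl y t) *
    dl t e * dl s a
     - dl e a * (dl x s * dl t f * dl y h - dl x f * dl h s * dl y t) * dl t b * dl s c)).
    by apply: eq_bigr => s _; apply: eq_bigr => t _; rewrite !gl_brE -/(dl _ _); rewrite /dl; ring.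
  under eq_bigr => s _ do rewrite sumrB -!mulr_suml !sum_delta_ord.
  by rewrite sumrB !sum_delta_ord.
apply/matrixP=> l r; case: (mxtens_indexP l) => x y; case: (mxtens_indexP r) => uv w.
case: (mxtens_indexP uv) => u v; case: (mxtens_indexP u) => a b.
case: (mxtens_indexP v) => c e; case: (mxtens_indexP w) => f h.
by rewrite [LHS]jacobiE !big_split /= !T [RHS]mxE; ring.
Qed.

(** The identity of [X] as an element of [gl(X)]; preceded by the trace and suitably scaled, it
    projects onto the scalars. *)
Definition coev_mx : 'M[k]_(d * d, 1) :=
  \matrix_(r, _) ((mxtens_unindex r).1 == (mxtens_unindex r).2)%:R.

Lemma coev_subproof (A : comNzRingType) (phi : {rmorphism k -> A}) (g : 'M[A]_2) :
  \det g = 1 ->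
  map_mx phi coev_mx *m ract (tunit k) phi g = ract gX phi g *m map_mx phi coev_mx.
Proof.
move=> dg; rewrite /= /unit_act mulmx1; apply/matrixP=> r o; case: (mxtens_indexP r) => a b.
have /matrixP/(_ a b) : ract X phi g *m ract X phi (\adj g) = 1%:M.
  by rewrite -ractM ?det_adj1 // mul_mx_adj dg ract1.
rewrite !mxE sum_tens mxtens_indexK rmorph_nat => <-; apply: eq_bigr => i _.
transitivity (\sum_j (ract X phi g a i * ract X phi (\adj g) j b) * (j == i)%:R).
  by rewrite sum_delta_ord.
apply: eq_bigr => j _.
by rewrite /tens_act tensmxE !mxE mxtens_indexK rmorph_nat eq_sym.
Qed.
Definition coev : hom (tunit k) gX := @Hom k (tunit k) gX coev_mx coev_subproof.

Lemma coev_traceE a b a' b' :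
  (hmx coev *m hmx (gl_trace X)) (a ⊗ b) (a' ⊗ b') = (a == b)%:R * (a' == b')%:R.
Proof.
transitivity (\sum_(o < 1) hmx coev (a ⊗ b) o * hmx (gl_trace X) o (a' ⊗ b')); first by rewrite mxE.
by rewrite big_ord1 gl_traceE mxE mxtens_indexK.
Qed.
End GeneralLinear.

Section SpecialLinear.
Variables (k : fieldType) (p : nat).
Hypothesis p_char : p \in [pchar k].
Hypothesis p_gt2 : (2 < p)%N.
Notation X := (dualWeyl k 1).
Notation V := (dualWeyl k 2).
Notation gX := (tens X (dual X)).

(** The symplectic identification of the natural representation with its dual is antidiagonal, but
    [V_1] lists [y] before [x]; in these bases it becomes diagonal. *)
Definition kap_mx : 'M[k]_2 := mx2 (-1) 0 0 1.

Lemma kap_subproof (A : comNzRingType) (phi : {rmorphism k -> A}) (g : 'M[A]_2) :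
  \det g = 1 ->
  map_mx phi kap_mx *m ract (natrep k) phi g = ract (dual X) phi g *m map_mx phi kap_mx.
Proof.
move=> _; rewrite [g]mx2_eta /= /dual_act adj_mx2 map_mx2 [(_ : 'M_2)^T]mx2_eta !mx2M rmorphN1
  rmorph0 rmorph1.
by apply: mx2P; rewrite !mxE /= /substx /substy !mxE /= ?(expr0, expr1, mul1r, mulr1, coefD,
  coefZ, coefC, coefX) /=; ring.
Qed.
Definition kap : hom (natrep k) (dual X) := @Hom k (natrep k) (dual X) kap_mx kap_subproof.

Lemma kap_mxV : kap_mx *m kap_mx = 1%:M.
Proof. by rewrite mx2M mx2_1; congr mx2; ring. Qed.
Definition kap_inv : hom (dual X) (natrep k) :=
  @hom_inv k (natrep k) (dual X) kap kap_mx kap_mxV kap_mxV.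

Definition sl_in : hom V gX := hom_comp (hom_tens (hom_id X) kap) (polar k 1).
(** By Euler's relation multiplication after polarization is 2 on [V_2], which accounts for the
    factor 1/2. *)
Definition sl_out : hom gX V :=
  hom_scale 2%:R^-1 (hom_comp (mult k 1) (hom_tens (hom_id X) kap_inv)).

Lemma sl_inE (x : 'I_2) (j : 'I_3) :
  (hmx sl_in (x ⊗ 0) j = - (j%:R * (j == x.+1 :> nat)%:R)) *
  (hmx sl_in (x ⊗ 1) j = (2 - j)%:R * (j == x :> nat)%:R).
Proof.
by split; rewrite [LHS]tens1mx_mulE big_ord2 !polar_mxE !mxE /= ?mul0r ?mul1r ?mulN1r ?add0r ?addr0.
Qed.

Lemma sl_outE (j : 'I_3) (x : 'I_2) :
  (hmx sl_out j (x ⊗ 0) = - 2%:R^-1 * (j == x.+1 :> nat)%:R) *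
  (hmx sl_out j (x ⊗ 1) = 2%:R^-1 * (j == x :> nat)%:R).
Proof.
by split; rewrite [LHS]mxE mul_tens1mxE big_ord2 !mult_mxE !mxE /= ?mulr0 ?mulr1 ?mulrN1 ?add0r
  ?addr0 ?mulrN ?mulNr.
Qed.

Lemma nz2 : 2%:R != 0 :> k.
Proof. by apply: (natr_lt_neq0 p_char). Qed.

Lemma sl_outK : hmx sl_out *m hmx sl_in = 1%:M.
Proof.
apply/matrixP=> i j; rewrite mxE sum_tens !big_ord2 !sl_outE !sl_inE [RHS]mxE.
have := nz2.
by case: i => [[|[|[|]]] hi] //; case: j => [[|[|[|]]] hj] //=; move=> nz;
  rewrite ?(subn0, subSS, subnn); field.
Qed.

(** For odd [p] the algebra [gl(V_1)] is the sum of its traceless part and the scalars; the right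
    side is the projection onto the former. *)
Lemma sl_inK : hmx sl_in *m hmx sl_out = 1%:M - 2%:R^-1 *: (hmx (coev X) *m hmx (gl_trace X)).
Proof.
apply/matrixP=> r c; case: (mxtens_indexP r) => a b; case: (mxtens_indexP c) => a' b'.
rewrite mxE !big_ord_recl big_ord0 [RHS]mxE [_%:M _ _]mxE [X in _ = _ + X]mxE [X in _ = _ - X]mxE.
rewrite (coev_traceE (X := X) a b a' b').
rewrite (can_eq (@mxtens_indexK 2 2)) xpair_eqE.
have := nz2.
by case: (ord2P a) => ->; case: (ord2P b) => ->; case: (ord2P a') => ->; case: (ord2P b') => ->;
  rewrite !sl_inE !sl_outE /= /bump /= ?(add1n, subn0, subSS, subnn) => nz; field.
Qed.
End SpecialLinear.

Section SpecialLinearAlgebra.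
Variables (k : fieldType) (p : nat).
Hypothesis p_char : p \in [pchar k].
Hypothesis p_gt2 : (2 < p)%N.
Notation X := (dualWeyl k 1).
Notation V := (dualWeyl k 2).
Notation gX := (tens X (dual X)).
Notation br := (alg_br (gl X)).
Notation sl_in := (sl_in k).
Notation sl_out := (sl_out k).

Definition sl2 : alg k := Alg (hom_comp (hom_comp sl_out br) (hom_tens sl_in sl_in)).

(** [sl_in] after [sl_out] fixes traceless elements, and commutators are traceless. *)
Lemma sl_in_br :
  hmx sl_in *m hmx (alg_br sl2) = hmx br *m (hmx sl_in *t hmx sl_in).
Proof.
have gen (m n l q : nat) (i : 'M[k]_(m, n)) o c (t : 'M_(l, m)) (B : 'M_(m, q)) (I : 'M_(q, n *
  n)) a :
    i *m o = 1%:M - a *: (c *m t) -> t *m B = 0 -> i *m (o *m B *m I) = B *m I.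
  move=> io tB; rewrite !mulmxA io mulmxBl mul1mx -scalemxAl -mulmxA tB mulmx0 scaler0 subr0 //.
exact: gen (sl_inK p_char p_gt2) (gl_trace_br X).
Qed.

Lemma sl2_lie : operadic_lie sl2.
Proof.
split; first exact: (tilting_dualWeyl p_char p_gt2).
  apply: ver_eq_hmx.
  have gen (m n l : nat) (o : 'M[k]_(l, m)) (B : 'M[k]_(m, n)) I S S' :
      B *m S' = - B -> S' *m I = I *m S :> 'M_(n, l * l) -> o *m B *m I *m S = - (o *m B *m I).
    by move=> BS SI; rewrite -mulmxA -SI mulmxA -[o *m B *m _]mulmxA BS mulmxN mulNmx.
  exact: gen (gl_braid X) (braid_tens _ _).
apply: ver_eq_hmx.
have BB : hmx (hom_comp (alg_br sl2) (hom_tens (alg_br sl2) (hom_id V)))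
    = hmx sl_out *m (hmx br *m (hmx br *t 1%:M)) *m ((hmx sl_in *t hmx sl_in) *t hmx sl_in).
  transitivity (hmx sl_out *m hmx br *m (hmx sl_in *t hmx sl_in) *m (hmx (alg_br sl2) *t 1%:M))
    => //.
  rewrite -!mulmxA !tensmx_mul sl_in_br; do 2!congr (_ *m _).
  by rewrite mulmx1 mul1mx.
transitivity (hmx (hom_comp (alg_br sl2) (hom_tens (alg_br sl2) (hom_id V))) *m hmx (cyc_sum V))
  => //.
have J : hmx br *m (hmx br *t 1%:M) *m hmx (cyc_sum gX) = 0 := gl_jacobi X.
have gen a b c (R : 'M[k]_(a, b)) (M : 'M_(b, c)) (C : 'M_c) (I : 'M_(c, 3 * 3 * 3)) Q :
    C *m I = I *m Q -> M *m C = 0 -> R *m M *m I *m Q = 0.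
  by move=> CI MC; rewrite -!mulmxA -CI [M *m _]mulmxA MC mul0mx mulmx0.
by rewrite BB; apply: gen J; exact: (cyc_sum_tens (hmx sl_in)).
Qed.

(** By [sl_inK] a map [h] into [gl(V_1)] differs from [sl_in (sl_out h)] by a map through its trace,
    which is negligible by assumption. Uniqueness comes from [sl_out *m sl_in = 1]. *)
Lemma sl2_is_sl : is_sl X sl2.
Proof.
split; first exact: (tilting_dualWeyl p_char p_gt2).
exists sl_in; split; last by apply: ver_eq_hmx; exact: sl_in_br.
have oi := sl_outK p_char p_gt2; have io := sl_inK p_char p_gt2.
have tc : hmx (gl_trace X) *m hmx sl_in = 0.
  apply/matrixP=> o j; rewrite mxE sum_tens [RHS]mxE big_ord2 !(big_ord2 (fun y => hmx _ _ _ * _)).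
  rewrite !gl_traceE !sl_inE.
  by case: j => [[|[|[|]]] hj] //=; rewrite ?(subn0, subSS, subnn); ring.
split=> [|Z _ h th]; first exact: ver_eq_hmx.
exists (hom_comp sl_out h); split=> [|u' iu].
  have E : hmx h = hmx (hom_comp sl_in (hom_comp sl_out h))
      + hmx (hom_comp (hom_scale 2%:R^-1 (coev X)) (hom_comp (gl_trace X) h)).
    have gen m n c (i : 'M[k]_(m, n)) o e (t : 'M_(c, m)) (H : 'M_(m, rdim Z)) a :
        i *m o = 1%:M - a *: (e *m t) -> H = i *m (o *m H) + (a *: e) *m (t *m H).
      by move=> E; rewrite !mulmxA E mulmxBl mul1mx -!scalemxAl subrK.
    exact: gen io.
  apply/ver_eqP => v; have /ver_eqP E' := ver_eq_compl (hom_scale 2%:R^-1 (coev X)) th.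
  by rewrite [X in _ = \tr (_ *m X)]E mulmxDr raddfD /= [X in _ = _ + X]E' /= !mulmx0 raddf0 addr0.
have /ver_eqP E := ver_eq_compl sl_out iu; apply/ver_eqP => v; rewrite -E; congr (\tr (_ *m _)).
by rewrite /= mulmxA oi mul1mx.
Qed.

(** One coordinate of the bracket of [y^2] and [x y] inside [gl(V_1)] equals 4, which is nonzero for
    odd [p]. *)
Lemma sl2_neq0 : hmx (alg_br sl2) <> 0.
Proof.
move=> b0; have := sl_in_br; rewrite b0 mulmx0.
pose u : 'I_2 := 0; pose v : 'I_2 := 1; pose j0 : 'I_3 := 0; pose j1 : 'I_3 := 1.
move=> /matrixP/(_ (u ⊗ v) (j0 ⊗ j1)) /esym.
rewrite [RHS]mxE.
have -> : (hmx br *m (hmx sl_in *t hmx sl_in)) (u ⊗ v) (j0 ⊗ j1) = \sum_(a < 2) \sum_(b < 2)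
    \sum_(c < 2) \sum_(e < 2) hmx br (u ⊗ v) ((a ⊗ b) ⊗ (c ⊗ e)) * (hmx sl_in (a ⊗ b) j0 * hmx
      sl_in (c ⊗ e) j1).
  rewrite mxE sum_tens sum_tens; apply: eq_bigr => a _; apply: eq_bigr => b _.
  rewrite sum_tens; apply: eq_bigr => c _; apply: eq_bigr => e _.
  by rewrite tensmxE.
rewrite !big_ord2 !gl_brE !sl_inE /= => /eqP; apply/negP.
rewrite modn_small // subn0 subn1 [X in X != 0](_ : _ = 2%:R * 2%:R) /=; last by ring.
by rewrite mulf_neq0 ?(nz2 p_char p_gt2).
Qed.
End SpecialLinearAlgebra.

Lemma ver_eq_scale (k : fieldType) (X Y : sl2rep k) c (f g : hom X Y) :
  ver_eq f g -> ver_eq (hom_scale c f) (hom_scale c g).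
Proof.
by move=> /ver_eqP E; apply/ver_eqP => h; rewrite /= -!scalemxAr !mxtraceZ E.
Qed.

(** A bracket has two inputs and one output: if [f] carries the bracket of [g] to [c b], then [c f]
    carries it to [b]. *)
Lemma alg_iso_scale (k : fieldType) (g : alg k) (V : sl2rep k) (b b' : hom (tens V V) V) c :
  c != 0 -> hmx b' = c *: hmx b -> alg_iso g (Alg b') -> alg_iso g (Alg b).
Proof.
move=> nz bE [f [[h [hf fh]] fE]]; exists (hom_scale c f); split.
  exists (hom_scale c^-1 h); split.
    apply: ver_eq_trans hf; apply: ver_eq_hmx.
    by rewrite /= -scalemxAl -scalemxAr scalerA mulVf ?scale1r.
  apply: ver_eq_trans fh; apply: ver_eq_hmx.
  by rewrite /= -scalemxAl -scalemxAr scalerA mulfV ?scale1r.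
have E : hmx (hom_comp (hom_scale c f) (alg_br g)) = hmx (hom_scale c (hom_comp f (alg_br g))).
  by rewrite /= scalemxAl.
apply: ver_eq_trans (ver_eq_hmx E) (ver_eq_trans (ver_eq_scale c fE) _).
apply: ver_eq_hmx; rewrite /= bE -scalemxAl !scalemxAr; congr (_ *m _).
by apply/matrixP=> r s; rewrite !mxE; ring.
Qed.

Local Close Scope ring_scope.
Theorem theorem4p0p6 (k : fieldType) (p : nat) (p_prime : prime p)
    (char_k : p \in [pchar k]%R) (g : alg k)
    (lie_g : operadic_lie g) (length_g : ver_length1 (alg_obj g)) :
  (5 <= p /\ exists s : alg k,
      operadic_lie s /\ is_sl (dualWeyl k 1) s /\ alg_iso g s)
  \/ (exists n : nat, n <= p - 2 /\ alg_iso g (trivial_alg (dualWeyl k n))).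
Proof.
have [tX _ _] := lie_g.
have [n [le_n [i [r [ri ir]]]]] := simple_dualWeyl char_k tX length_g.
pose t := transport i r; have t_iso : alg_iso g t := transport_iso ri ir.
have lie_t : operadic_lie t.
  by apply: transport_lie lie_g => //; apply: (tilting_dualWeyl char_k); have := prime_gt1 p_prime; lia.
have [t0|nt] := EM (ver_eq (alg_br t) (hom_zero _ _)).
  right; exists n; split=> //; have [f [f_iso fE]] := t_iso; exists f; split=> //.
  apply: ver_eq_trans fE _; apply: ver_eq_trans (ver_eq_compr _ t0) _.
  by apply: ver_eq_hmx; rewrite /= !mul0mx.
have n2 : n = 2.
  by apply/eqP; apply: contra_notT nt => n2; apply: (lie_dualWeyl char_k le_n n2 lie_t).
left; subst n.
(* The bound [2 <= p - 2] only gives [4 <= p]; primality excludes 4. *)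
have p5 : 5 <= p.
  have : p != 4 by apply: contraTneq p_prime => ->.
  lia.
have p_gt2 : 2 < p by lia.
split=> //; exists (sl2 k); split; first exact: (sl2_lie char_k p_gt2).
split; first exact: (sl2_is_sl char_k p_gt2).
(* The bracket of [t] is a multiple of that of [sl2], and the factor is nonzero because the bracket
   of [t] is not negligible. *)
have [c cE] := br_unique char_k p_gt2 (alg_br t) (@sl2_neq0 k p char_k p_gt2).
apply: (alg_iso_scale _ cE t_iso); apply: contra_not_neq nt => c0.
by apply: ver_eq_hmx; rewrite cE c0 scale0r.
Qed.
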